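(* Let $n,d\ge1$ be integers. Take a complete probability space with a countably generated filtration $\mathcal H_0\subseteq\cdots\subseteq\mathcal H_n$, supporting $\mathbb R^d$-valued square-integrable random vectors $X_1,\ldots,X_n$ such that $X_i$ is $\mathcal H_i$-measurable with $\mathbb E[X_i\mid\mathcal H_{i-1}]=0$ for $1\le i\le n$. Let $S=\sum_{i=1}^nX_i$, let $\Sigma$ be a non-random positive semi-definite $d\times d$ matrix, let $V_i=\mathrm{Var}[X_i\mid\mathcal H_{i-1}]$ and $\Omega=\sum_{i=1}^nV_i-\Sigma$, and let $T\sim\mathcal N(0,\Sigma)$. Let $\mathbf X=(X_1,\ldots,X_n)$ and let $\hat\Sigma$ be an $\mathbf X$-measurable random $d\times d$ positive semi-definite matrix. Then for any class $\mathcal A$ of measurable subsets of $\mathbb R^d$, $$\begin{aligned}&\sup_{A\in\mathcal A}\left|\mathbb P\big(S\in A\big)-\mathbb P\big(\hat\Sigma^{1/2}Z\in A\mid\mathbf X\big)\right|\\&\quad\le\inf_{p\in[1,\infty]}\inf_{\eta>0}\left\{\Gamma_p(\eta)+2\Delta_p(\mathcal A,\eta)+2d\exp\left(\frac{-\eta^2}{2d^{2/p}\big\|\hat\Sigma^{1/2}-\Sigma^{1/2}\big\|_2^2}\right)\right\},\end{aligned}$$ where $Z\sim\mathcal N(0,I_d)$ is independent of $\mathbf X$ and $$\Gamma_p(\eta)=24\left(\frac{\beta_{p,2}\,\phi_p(d)^2}{\eta^3}\right)^{1/3}+17\left(\frac{\mathbb E[\|\Omega\|_2]\,\phi_p(d)^2}{\eta^2}\right)^{1/3},$$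 $$\Delta_p(\mathcal A,\eta)=\sup_{A\in\mathcal A}\max\big\{\mathbb P(T\in A_p^\eta\setminus A),\ \mathbb P(T\in A\setminus A_p^{-\eta})\big\}.$$
   Context: $A_p^\eta=\{x\in\mathbb R^d:\|x-A\|_p\le\eta\}$, $A_p^{-\eta}=\mathbb R^d\setminus(\mathbb R^d\setminus A)_p^\eta$, $\|x-A\|_p=\inf_{x'\in A}\|x-x'\|_p$, with $\|\cdot\|_p$ the $\ell_p$-norm. For $p\in[1,\infty)$, $\phi_p(d)=\sqrt{p\,d^{2/p}}$, and $\phi_\infty(d)=\sqrt{2\log2d}$; $d^{2/\infty}=1$. The exponential is read as $0$ when $\hat\Sigma^{1/2}=\Sigma^{1/2}$. $$\beta_{p,2}=\sum_{i=1}^n\mathbb E\big[\|X_i\|_2^2\|X_i\|_p+\|V_i^{1/2}Z_i\|_2^2\|V_i^{1/2}Z_i\|_p\big]$$ with $Z_1,\ldots,Z_n$ i.i.d. $\mathcal N(0,I_d)$ independent of $\mathcal H_n$. $\|\cdot\|_2$ of a matrix is the $\ell_2$ operator norm, $A^{1/2}$ of a matrix is the positive semi-definite square root, and $\mathrm{Var}[\cdot\mid\mathcal H]$ is the conditional covariance matrix. Conditional probabilities given $\mathbf X$ are evaluated using the regular conditional law of $\hat\Sigma^{1/2}Z$ given $\mathbf X$, which is $\mathcal N(0,\hat\Sigma)$. *)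

(* Defs.v *)
From HB Require Import structures.
From mathcomp Require Import all_boot all_order all_algebra.
From mathcomp Require Import all_classical all_reals all_analysis.
From mathcomp Require Import measurable_realfun.

Set Implicit Arguments.
Unset Strict Implicit.
Unset Printing Implicit Defensive.

Import Order.TTheory GRing.Theory Num.Theory.
Import numFieldTopology.Exports numFieldNormedType.Exports.

Local Open Scope classical_set_scope.
Local Open Scope ring_scope.

(* R^(m x k) with its Borel sigma-algebra; MathComp-Analysis has no canonical
   measurable structure on matrices. It is convertible to 'M[R]_(m, k), and the
   topology of 'M[R]_(m, k) is the product topology. *)
Notation mxBorel R m k := (g_sigma_algebraType (@open 'M[R]_(m, k))).

Section linear_algebra.
Context {R : realType}.
Implicit Types p : \bar R.

Definition lpnorm d p (x : 'cV[R]_d) : R :=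
  match p with
  | r%:E => (\sum_(i < d) `|x i 0| `^ r) `^ r^-1
  | _ => \big[Num.max/0]_(i < d) `|x i 0|
  end.

Definition opnorm2 d (M : 'M[R]_d) : R :=
  sup [set lpnorm 2%:E (M *m x) | x in [set x | lpnorm 2%:E x <= 1]].

Definition psd d (M : 'M[R]_d) : Prop :=
  M^T = M /\ forall x : 'cV[R]_d, 0 <= (x^T *m M *m x) 0 0.

(* The unique positive semi-definite B with B^2 = M (0 if M is not positive
   semi-definite). *)
Definition mxsqrt d (M : 'M[R]_d) : 'M[R]_d :=
  xget 0 [set B | psd B /\ B *m B = M].

(* The infimum is taken in \bar R, so that the distance to the empty set is
   +oo. *)
Definition lpdist d p (x : 'cV[R]_d) (A : set 'cV[R]_d) : \bar R :=
  ereal_inf [set (lpnorm p (x - y))%:E | y in A].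

Definition enlarge d p (eta : R) (A : set 'cV[R]_d) : set 'cV[R]_d :=
  [set x | (lpdist p x A <= eta%:E)%E].

Definition shrink d p (eta : R) (A : set 'cV[R]_d) : set 'cV[R]_d :=
  ~` enlarge p eta (~` A).

(* d^(2/p), with 2/oo = 0 *)
Definition dimpow p (d : nat) : R :=
  match p with r%:E => d%:R `^ (2 / r) | _ => 1 end.

Definition phi p (d : nat) : R :=
  match p with
  | r%:E => Num.sqrt (r * dimpow p d)
  | _ => Num.sqrt (2 * ln (2 * d%:R))
  end.

(* The supremum of a set of values in [0, +oo], equal to 0 for the empty
   set (ereal_sup set0 is -oo). *)
Definition sup_nneg (D : set (\bar R)) : \bar R :=
  ereal_sup ([set 0%E] `|` D).

(* N(0, v) on the line; normal_prob takes the standard deviation, and is not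
   the point mass when the latter is 0. *)
Definition normal0 (v : R) (B : set R) : \bar R :=
  if v == 0 then \d_(0 : R) B else normal_prob 0 (Num.sqrt v) B.

(* mu = N(0, Sigma), possibly singular: every linear functional u is
   distributed as N(0, u^T Sigma u). *)
Definition mvnormal0 d (Sigma : 'M[R]_d) (mu : set 'cV[R]_d -> \bar R) : Prop :=
  forall (u : 'cV[R]_d) (B : set R), measurable B ->
    mu [set x | B ((u^T *m x) 0 0)] = normal0 ((u^T *m Sigma *m u) 0 0) B.

End linear_algebra.

Section probability.
Context {R : realType} {disp : measure_display} {W : measurableType disp}.
Variable P : probability W R.
Implicit Types G H : set (set W).

Definition sub_measurable {disp' : measure_display} {U : measurableType disp'}
    G (f : W -> U) : Prop :=
  forall B, measurable B -> G (f @^-1` B).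

Definition law d (Y : W -> 'cV[R]_d) (B : set 'cV[R]_d) : \bar R :=
  P (Y @^-1` B).

Definition random_vector d (Y : W -> 'cV[R]_d) : Prop :=
  measurable_fun setT (Y : W -> mxBorel R d 1).

Definition sigma_of (n d : nat) (X : 'I_n -> W -> 'cV[R]_d) : set (set W) :=
  <<s [set A | exists i (B : set (mxBorel R d 1)),
        measurable B /\ A = X i @^-1` B] >>.

Definition indep_sigma G H : Prop :=
  forall A B, G A -> H B -> P (A `&` B) = (P A * P B)%E.

Definition mutually_indep (n d : nat) (Z : 'I_n -> W -> 'cV[R]_d) : Prop :=
  forall (J : {set 'I_n}) (B : 'I_n -> set (mxBorel R d 1)),
    (forall i, measurable (B i)) ->
    P (\bigcap_(i in [set` J]) (Z i @^-1` B i))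
      = (\prod_(i in J) P (Z i @^-1` B i))%E.

(* (H k)_{0 <= k <= n}; H k is irrelevant for k > n *)
Definition filtration (n : nat) (H : nat -> set (set W)) : Prop :=
  (forall k, (k <= n)%N -> sigma_algebra setT (H k) /\ H k `<=` measurable) /\
  (forall k, (k < n)%N -> H k `<=` H k.+1).

Definition countably_generated G : Prop :=
  exists C : set (set W), countable C /\ G = <<s C >>.

(* g is a version of E[f | G] *)
Definition cond_exp G (f g : W -> R) : Prop :=
  [/\ P.-integrable setT (EFin \o f),
      P.-integrable setT (EFin \o g),
      sub_measurable G g &
      forall A, G A ->
        (\int[P]_(w in A) (g w)%:E = \int[P]_(w in A) (f w)%:E)%E].

Definition cond_mean d G (Y M : W -> 'cV[R]_d) : Prop :=
  forall j, cond_exp G (fun w => Y w j 0) (fun w => M w j 0).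

(* V is a version of Var[Y | G] *)
Definition cond_var d G (Y : W -> 'cV[R]_d) (V : W -> 'M[R]_d) : Prop :=
  exists M : W -> 'cV[R]_d, cond_mean G Y M /\
    forall j k, cond_exp G
      (fun w => (Y w - M w) j 0 * (Y w - M w) k 0) (fun w => V w j k).

Definition regular_cond_law d G (Y : W -> 'cV[R]_d)
    (K : W -> probability (mxBorel R d 1) R) : Prop :=
  forall B : set (mxBorel R d 1), measurable B ->
    sub_measurable G (fun w => K w B) /\
    forall A, G A -> (\int[P]_(w in A) K w B = P (A `&` Y @^-1` B))%E.

Local Open Scope ereal_scope.

Definition beta2 (n d : nat) (X : 'I_n -> W -> 'cV[R]_d)
    (V : 'I_n -> W -> 'M[R]_d) (Z : 'I_n -> W -> 'cV[R]_d) (p : \bar R)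
    : \bar R :=
  \sum_(i < n) 'E_P[fun w =>
    (lpnorm 2%:E (X i w) ^+ 2 * lpnorm p (X i w)
     + lpnorm 2%:E (mxsqrt (V i w) *m Z i w) ^+ 2
       * lpnorm p (mxsqrt (V i w) *m Z i w))%R].

Definition Gamma (n d : nat) (X : 'I_n -> W -> 'cV[R]_d)
    (V : 'I_n -> W -> 'M[R]_d) (Z : 'I_n -> W -> 'cV[R]_d)
    (Omega : W -> 'M[R]_d) (p : \bar R) (eta : R) : \bar R :=
  24%:E * poweR (beta2 X V Z p * (phi p d ^+ 2 / eta ^+ 3)%:E) (3^-1)%R
  + 17%:E * poweR ('E_P[fun w => opnorm2 (Omega w)]
                   * (phi p d ^+ 2 / eta ^+ 2)%:E) (3^-1)%R.

Definition Delta d (T : W -> 'cV[R]_d) (p : \bar R)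
    (C : set (set 'cV[R]_d)) (eta : R) : \bar R :=
  sup_nneg [set maxe (P (T @^-1` (enlarge p eta A `\` A)))
                     (P (T @^-1` (A `\` shrink p eta A))) | A in C].

End probability.

Definition exp_term {R : realType} d (Sigma1 Sigma2 : 'M[R]_d) (p : \bar R)
    (eta : R) : R :=
  if mxsqrt Sigma1 == mxsqrt Sigma2 then 0
  else expR (- eta ^+ 2
             / (2 * dimpow p d * opnorm2 (mxsqrt Sigma1 - mxsqrt Sigma2) ^+ 2)).

(* Main.v *)
(** Lindeberg's replacement method, with Gaussian smoothing. Let g be the ramp
    that equals 1 on the eta/3-enlargement of A and 0 off its 2 eta/3-enlargement;
    it is (3/eta)-Lipschitz for the p-norm. Put F(Q, x) = E g(x + N(0, Q) + s N(0, I)).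
    Two of the three derivatives in the Taylor remainder of F(Q, -) fall on the
    Gaussian density and the third one is replaced by the Lipschitz constant, so
    the remainder at h is at most (6 / (eta s^2)) |h|_2^2 |h|_p.

    Start at F(Sigma + v^2 I, 0). At step k, add X_k to the argument and remove
    V_k from the covariance: the first two moments match conditionally on H_{k-1},
    and by the semigroup property of Gaussian laws removing V_k amounts to
    removing a Gaussian increment N(0, V_k). Steps that would leave a covariance
    that is not positive semi-definite are skipped. No step is skipped when
    |Omega|_2 < v^2, which by Markov's inequality fails with probability at most
    E|Omega|_2 / v^2; then the covariance left at the end is v^2 I - Omega, with
    diagonal entries at most 2 v^2. Comparing F with the indicators of A and of
    its eta-enlargement costs two Gaussian tails beyond eta/3 in the p-norm, each
    linear in phi_p(d) times the standard deviation. Taking s and v proportional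
    to eta / phi_p(d) gives P(S in A) <= P(T in A^eta) + Gamma_p(eta), and
    the complement of A gives the opposite bound.

    The laws of Sigma^{1/2} Z and Shat^{1/2} Z are coupled through the same Z: the
    coordinates of the difference are subgaussian with parameter the operator norm
    of Shat^{1/2} - Sigma^{1/2}, whence the exponential term.

    Gaussian laws are handled through the Cameron-Martin formula, from which the
    moments, the characteristic function (by Stein's identity) and the
    Cramer-Wold theorem follow. *)

Require Import Defs.
From HB Require Import structures.
From mathcomp Require Import all_boot all_order all_algebra.
From mathcomp Require Import all_classical all_reals all_analysis.
From mathcomp Require Import measurable_realfun.
From mathcomp Require Import ring lra.

Set Implicit Arguments.
Unset Strict Implicit.
Unset Printing Implicit Defensive.

Import Order.TTheory GRing.Theory Num.Theory.
Import numFieldTopology.Exports numFieldNormedType.Exports.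

Local Open Scope classical_set_scope.
Local Open Scope ring_scope.

(** * Borel measurability of matrix functions *)

Section matrix_borel.
Context {R : realType}.

(** The conditional covariances are random and need not add up to [Sigma], so no fixed Gaussian sum
    can match the increments; the added multiple of the identity leaves room for [Omega]. Whether a
    step is skipped is known one step ahead, so the centring and the covariance of the increment may
    be used against everything that multiplies them. The states before and after a step are both
    compared with a single expansion, at the covariance after the removal and the sum before the
    addition. The Gaussian increments are integrated out inside F, so the probability space is never
    enlarged. F is evaluated at a random covariance, which forces the matrix square root, defined by
    choice, to be a Borel function: it is rebuilt as a limit of explicit polynomials. Gaussian
    vectors are given only by their one-dimensional marginals, possibly degenerate; identifying such
    a law with an image of N(0, I) is the role of the Cramer-Wold theorem. The smoothing scales must
    be positive while the quantities that they balance may vanish, so the one-sided bound takes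
    positive majorants of the two cube roots, which are let down to their values at the very end. *)

Lemma mxBorel_openP m k (U : set 'M[R]_(m, k)) : open U ->
  U = \bigcup_(qe in [set qe : 'M[rat]_(m, k) * nat |
        [set M : 'M[R]_(m, k) | forall i j,
          `|M i j - ratr (qe.1 i j)| < qe.2.+1%:R^-1] `<=` U])
      [set M | forall i j, `|M i j - ratr (qe.1 i j)| < qe.2.+1%:R^-1].
Proof.
move=> oU; apply/seteqP; split=> [M UM|M [qe qeU]]; last exact: qeU.
have /nbhs_ballP[e /= e0 eU] := open_nbhs_nbhs (conj oU UM).
(* The cube around the rational centre contains [M], and two of its points differ by less than twice
   the radius in each entry; hence the half. *)
have [N Ne] : exists N : nat, (N.+1%:R^-1 : R) < e / 2.
  have e20 : 0 < e / 2 by rewrite divr_gt0.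
  by have [N _ /(_ N (leqnn N))] := near_infty_natSinv_lt (PosNum e20); exists N.
have N0 : 0 < N.+1%:R^-1 :> R by [].
move: N0 Ne; set r := (N.+1%:R^-1 : R) => N0 Ne.
have h i j : {q : rat | ratr q \in `](M i j - r), (M i j + r)[ }.
  apply: cid; have [] := @rat_in_itvoo R (M i j - r) (M i j + r).
    by lra.
  by move=> q hq; exists q.
exists ((\matrix_(i, j) projT1 (h i j)), N) => /=; last first.
  move=> i j; rewrite mxE; case: (h i j) => q /= /[!in_itv]/= /andP[q1 q2].
  by rewrite -/r ltr_distl; apply/andP; split; lra.
move=> M' M'q; apply: eU; split => // i j.
have := M'q i j; rewrite mxE; case: (h i j) => q /= /[!in_itv]/= /andP[q1 q2] ; rewrite -/r => M'q'.
rewrite /ball/= [ltLHS](_ : _ = `|(M i j - ratr q) + (ratr q - M' i j)|); last first.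
  by rewrite addrA subrK.
rewrite (le_lt_trans (ler_normD _ _))// [ltRHS](splitr e) ltrD//.
  by rewrite (lt_trans _ Ne)// ltr_distl; apply/andP; split; lra.
by rewrite distrC (lt_trans M'q').
Qed.

(** Open sets generate the Borel sets and are countable unions of rational cubes; the preimage of a
    cube is a finite intersection of conditions on single entries. *)
Lemma measurable_mxP d (T : measurableType d) m k (f : T -> mxBorel R m k) :
  (forall i j, measurable_fun setT (fun t => (f t : 'M[R]_(m, k)) i j)) ->
  measurable_fun setT f.
Proof.
move=> mf; apply: (@measurability _ _ _ _ setT f (@open 'M[R]_(m, k)) erefl) => _ [U oU <-].
rewrite setTI (mxBorel_openP oU) preimage_bigcup.
rewrite bigcup_mkcond; apply: countable_bigcupT_measurable => // -[q n].
case: ifP => // _.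
rewrite (_ : _ @^-1` _ = \bigcap_(ij in [set: 'I_m * 'I_k])
   [set t | `|(f t : 'M[R]_(m, k)) ij.1 ij.2 - ratr (q ij.1 ij.2)| < n.+1%:R^-1]).
  apply: fin_bigcap_measurable => //= ij _.
  rewrite -[X in measurable X]setTI.
  apply: (@measurable_fun_ltr _ _ _ _ (fun t => `|(f t : 'M[R]_(m, k)) ij.1 ij.2 - ratr (q ij.1 ij.2)|) (cst n.+1%:R^-1)) => //.
  by apply: measurableT_comp => //; apply: measurable_funB => //; exact: mf.
by apply/seteqP; split=> t /= h => [ij _|i j]; [exact: h|exact: (h (i, j))].
Qed.

Lemma continuous_mxBorel m k (g : 'M[R]_(m, k) -> R) : continuous g ->
  measurable_fun setT (g : mxBorel R m k -> R).
Proof.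
move=> cg; apply: (measurability _ (RGenOpens.measurableE R)).
move=> _ [_ [a [b ->] <-]]; rewrite setTI; apply: sub_gen_smallest.
by move/continuousP: cg; apply; exact: interval_open.
Qed.

Lemma measurable_coord m k i j :
  measurable_fun setT (fun M : mxBorel R m k => (M : 'M[R]_(m, k)) i j).
Proof. by apply: continuous_mxBorel; exact: coord_continuous. Qed.

End matrix_borel.

(** * Positive semi-definite matrices and their square roots *)

Arguments lpnorm : simpl never.

Section measurable_matrix_ops.
Context {R : realType} {disp : measure_display} {T : measurableType disp}.

Lemma measurable_fun_coord m k (f : T -> mxBorel R m k) i j :
  measurable_fun setT f ->
  measurable_fun setT (fun t => (f t : 'M[R]_(m, k)) i j).
Proof.
move=> mf; apply: (measurableT_comp (f := fun M : mxBorel R m k => (M : 'M[R]_(m, k)) i j)) => //.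
exact: measurable_coord.
Qed.

Lemma measurable_mulmx m k l (f : T -> mxBorel R m k) (g : T -> mxBorel R k l) :
  measurable_fun setT f -> measurable_fun setT g ->
  measurable_fun setT ((fun t => (f t : 'M[R]_(m, k)) *m (g t : 'M[R]_(k, l))) : T -> mxBorel R m l).
Proof.
move=> mf mg; apply: measurable_mxP => i j; under eq_fun do rewrite mxE.
by apply: measurable_sum => h; apply: measurable_funM; exact: measurable_fun_coord.
Qed.

Lemma measurable_addmx m k (f g : T -> mxBorel R m k) :
  measurable_fun setT f -> measurable_fun setT g ->
  measurable_fun setT ((fun t => (f t : 'M[R]_(m, k)) + (g t : 'M[R]_(m, k))) : T -> mxBorel R m k).
Proof.
move=> mf mg; apply: measurable_mxP => i j; under eq_fun do rewrite mxE.
by apply: measurable_funD; exact: measurable_fun_coord.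
Qed.

Lemma measurable_scalemx m k (c : T -> R) (g : T -> mxBorel R m k) :
  measurable_fun setT c -> measurable_fun setT g ->
  measurable_fun setT ((fun t => c t *: (g t : 'M[R]_(m, k))) : T -> mxBorel R m k).
Proof.
move=> mf mg; apply: measurable_mxP => i j; under eq_fun do rewrite mxE.
by apply: measurable_funM => //; exact: measurable_fun_coord.
Qed.

Lemma measurable_oppmx m k (g : T -> mxBorel R m k) :
  measurable_fun setT g ->
  measurable_fun setT ((fun t => - (g t : 'M[R]_(m, k))) : T -> mxBorel R m k).
Proof.
move=> mg; apply: measurable_mxP => i j; under eq_fun do rewrite mxE.
by apply: measurableT_comp => //; exact: measurable_fun_coord.
Qed.

Lemma measurable_summx m k (I : Type) (r : seq I) (g : I -> T -> mxBorel R m k) :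
  (forall i, measurable_fun setT (g i)) ->
  measurable_fun setT ((fun t => \sum_(i <- r) (g i t : 'M[R]_(m, k))) : T -> mxBorel R m k).
Proof.
move=> mg; apply: measurable_mxP => i j; under eq_fun do rewrite summxE.
by apply: measurable_sum => h; exact: measurable_fun_coord.
Qed.

End measurable_matrix_ops.

Lemma cvg_sumr {R : realType} {T : Type} {F : set_system T} {FF : Filter F}
    {I : Type} (r : seq I) (f : I -> T -> R) (a : I -> R) :
  (forall i, f i x @[x --> F] --> a i) ->
  (\sum_(i <- r) f i x) @[x --> F] --> \sum_(i <- r) a i.
Proof.
move=> fa; elim: r => [|i r ih].
  by rewrite big_nil; under eq_fun do rewrite big_nil; exact: cvg_cst.
by rewrite big_cons; under eq_fun do rewrite big_cons; exact: cvgD.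
Qed.

Section psd_matrices.
Context {R : realType}.

Definition dotv d (u x : 'cV[R]_d) : R := (u^T *m x) 0 0.

Lemma dotvE d (u x : 'cV[R]_d) : dotv u x = \sum_i u i 0 * x i 0.
Proof. by rewrite /dotv mxE; apply: eq_bigr => i _; rewrite mxE. Qed.

Lemma dotv_ge0 d (x : 'cV[R]_d) : 0 <= dotv x x.
Proof. by rewrite dotvE; apply: sumr_ge0 => i _; rewrite -expr2 sqr_ge0. Qed.

Lemma dotvC d (u x : 'cV[R]_d) : dotv u x = dotv x u.
Proof. by rewrite !dotvE; apply: eq_bigr => i _; rewrite mulrC. Qed.

Lemma dotvDr d (u x y : 'cV[R]_d) : dotv u (x + y) = dotv u x + dotv u y.
Proof. by rewrite /dotv mulmxDr mxE. Qed.

Lemma dotvZr d (u x : 'cV[R]_d) c : dotv u (c *: x) = c * dotv u x.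
Proof. by rewrite /dotv -scalemxAr mxE. Qed.

Lemma dotvDl d (u x y : 'cV[R]_d) : dotv (x + y) u = dotv x u + dotv y u.
Proof. by rewrite dotvC dotvDr !(dotvC u). Qed.

Lemma dotvZl d (u x : 'cV[R]_d) c : dotv (c *: x) u = c * dotv x u.
Proof. by rewrite dotvC dotvZr dotvC. Qed.

Lemma dotvNr d (u x : 'cV[R]_d) : dotv u (- x) = - dotv u x.
Proof. by rewrite -scaleN1r dotvZr mulN1r. Qed.

Lemma dotvNl d (u x : 'cV[R]_d) : dotv (- x) u = - dotv x u.
Proof. by rewrite dotvC dotvNr dotvC. Qed.

Lemma dotv_mulmx d k (u : 'cV[R]_d) (B : 'M[R]_(d, k)) y :
  dotv u (B *m y) = dotv (B^T *m u) y.
Proof. by rewrite /dotv trmx_mul trmxK mulmxA. Qed.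

Lemma dotv_qf d (M : 'M[R]_d) x : dotv x (M *m x) = (x^T *m M *m x) 0 0.
Proof. by rewrite /dotv mulmxA. Qed.

Lemma dotv_1B d (M : 'M[R]_d) x :
  dotv x x - dotv x (M *m x) = dotv x ((1%:M - M) *m x).
Proof. by rewrite mulmxBl mul1mx dotvDr dotvNr. Qed.

Lemma dotv_delta d (i : 'I_d) x : dotv (delta_mx i 0) x = x i 0.
Proof.
rewrite dotvE (bigD1 i)//= mxE !eqxx mul1r big1 ?addr0// => j ji.
by rewrite mxE (negbTE ji) mul0r.
Qed.

Lemma mulmx_delta d k (M : 'M[R]_(k, d)) (j : 'I_d) i : (M *m delta_mx j 0 : 'cV[R]_k) i 0 = M i j.
Proof.
rewrite mxE (bigD1 j)//= mxE !eqxx mulr1 big1 ?addr0// => l lj.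
by rewrite mxE (negbTE lj) mulr0.
Qed.

Lemma psdP d (M : 'M[R]_d) :
  psd M <-> M^T = M /\ forall x, 0 <= dotv x (M *m x).
Proof. by split=> -[? h]; split=> // x; have := h x; rewrite dotv_qf. Qed.

Lemma psd0 d : psd (0 : 'M[R]_d).
Proof. by apply/psdP; split=> [|x]; rewrite ?trmx0// mul0mx /dotv mulmx0 mxE. Qed.

Lemma psd1 d : psd (1%:M : 'M[R]_d).
Proof. by apply/psdP; split=> [|x]; rewrite ?trmx1// mul1mx dotv_ge0. Qed.

Lemma psdD d (M N : 'M[R]_d) : psd M -> psd N -> psd (M + N).
Proof.
move=> /psdP[sM pM] /psdP[sN pN]; apply/psdP; split; first by rewrite linearD/= sM sN.
by move=> x; rewrite mulmxDl dotvDr addr_ge0.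
Qed.

Lemma psdZ d (M : 'M[R]_d) c : 0 <= c -> psd M -> psd (c *: M).
Proof.
move=> c0 /psdP[sM pM]; apply/psdP; split; first by rewrite linearZ/= sM.
by move=> x; rewrite -scalemxAl dotvZr mulr_ge0.
Qed.

Lemma psd_congr d k (M : 'M[R]_d) (A : 'M[R]_(d, k)) :
  psd M -> psd (A^T *m M *m A).
Proof.
move=> /psdP[sM pM]; apply/psdP; split.
  by rewrite !trmx_mul sM trmxK mulmxA.
by move=> x; rewrite -!mulmxA dotv_mulmx trmxK.
Qed.

Lemma psd_gram d k (A : 'M[R]_(d, k)) : psd (A^T *m A).
Proof. by rewrite -[X in X *m _]mulmx1; exact/psd_congr/psd1. Qed.

Lemma psd_diag_ge0 d (M : 'M[R]_d) i : psd M -> 0 <= M i i.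
Proof.
by move=> /psdP[_ /(_ (delta_mx i 0))]; rewrite dotv_delta mulmx_delta.
Qed.

Lemma psd_tr_ge0 d (M : 'M[R]_d) : psd M -> 0 <= \tr M.
Proof. by move=> pM; apply: sumr_ge0 => i _; exact: psd_diag_ge0. Qed.

(** Polarisation. It turns convergence of quadratic forms, which monotonicity provides, into
    convergence of entries. *)
Lemma dotv_polar d (M : 'M[R]_d) i j : M^T = M ->
  M i j = 2^-1 * (dotv (delta_mx i 0 + delta_mx j 0) (M *m (delta_mx i 0 + delta_mx j 0))
     - dotv (delta_mx i 0) (M *m delta_mx i 0) - dotv (delta_mx j 0) (M *m delta_mx j 0)).
Proof.
move=> sM; rewrite mulmxDr !dotvDr !dotvDl !dotv_delta !mulmx_delta.
have -> : M j i = M i j by rewrite -{1}sM mxE.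
by field.
Qed.

(** The diagonal entries are nonnegative with sum 0, hence vanish. The form at [e_i + c e_j] is then
    [2 c M_ij], nonnegative for both signs of [c]. *)
Lemma psd_tr0 d (M : 'M[R]_d) : psd M -> \tr M = 0 -> M = 0.
Proof.
move=> pM tM; have dM i : M i i = 0.
  apply/eqP; rewrite eq_le psd_diag_ge0// andbT -tM /mxtrace (bigD1 i)//= lerDl.
  by apply: sumr_ge0 => k _; exact: psd_diag_ge0.
move/psdP : (pM) => [sM qM]; apply/matrixP => i j; rewrite [RHS]mxE.
have Mji : M j i = M i j by rewrite -{1}sM mxE.
have h c : 0 <= 2 * c * M i j.
  have := qM (delta_mx i 0 + c *: delta_mx j 0).
  rewrite mulmxDr -scalemxAr !dotvDr !dotvDl !dotvZr !dotvZl !dotv_delta !mulmx_delta !dM Mji.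
  by move/le_trans; apply; lra.
apply/eqP; rewrite eq_le; apply/andP; split.
  by have := h (-1); lra.
by have := h 1; lra.
Qed.

(** The diagonal of [A^T A] consists of the squared norms of the columns of [A]. *)
Lemma gram_eq0 d k (A : 'M[R]_(d, k)) : A^T *m A = 0 -> A = 0.
Proof.
move=> AA; apply/matrixP => i j; rewrite [RHS]mxE.
have : (A^T *m A) j j = 0 by rewrite AA mxE.
rewrite mxE => /eqP; rewrite psumr_eq0; last first.
  by move=> l _; rewrite mxE -expr2 sqr_ge0.
by move=> /allP/(_ i (mem_index_enum _)); rewrite mxE -expr2 sqrf_eq0 => /eqP.
Qed.

(* For D = B - C one has B D = - D C, so the traces of the two positive
   semi-definite matrices D B D and D C D are opposite. *)
Lemma psd_sqr_inj d (B C : 'M[R]_d) : psd B -> psd C ->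
  B *m B = C *m C -> B = C.
Proof.
move=> pB pC BC; set D := B - C.
have sD : D^T = D by rewrite linearB/= (proj1 pB) (proj1 pC).
have BD : B *m D = - (D *m C).
  by rewrite /D mulmxBr mulmxBl opprB BC.
have pDB : psd (D *m B *m D) by rewrite -{1}sD; exact: psd_congr.
have pDC : psd (D *m C *m D) by rewrite -{1}sD; exact: psd_congr.
have tr_opp : \tr (D *m B *m D) = - \tr (D *m C *m D).
  by rewrite -mulmxA BD mulmxN linearN/= mxtrace_mulC.
have tB := psd_tr_ge0 pDB; have tC := psd_tr_ge0 pDC.
have DB0 : D *m B *m D = 0 by apply: psd_tr0 => //; lra.
have DC0 : D *m C *m D = 0 by apply: psd_tr0 => //; lra.
have D3 : D *m D *m D = 0.
  have -> : D *m D *m D = D *m B *m D - D *m C *m D by rewrite -mulmxBl -mulmxBr.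
  by rewrite DB0 DC0 subrr.
have D2 : D *m D = 0.
  by apply: gram_eq0; rewrite trmx_mul sD mulmxA D3 mul0mx.
by apply/subr0_eq/gram_eq0; rewrite -/D sD.
Qed.

End psd_matrices.

Section square_root.
Context {R : realType} {d : nat}.
Implicit Types A B M : 'M[R]_d.

Definition mxpow A j : 'M[R]_d := iter j (mulmx A) 1%:M.

Lemma mxpowD A i j : mxpow A (i + j) = mxpow A i *m mxpow A j.
Proof.
by elim: i => [|i ih]; rewrite ?mul1mx// addSn /= ih mulmxA.
Qed.

(** An even power is a Gram matrix, an odd one a congruence of [A] by a symmetric power. *)
Lemma mxpow_psd A j : psd A -> psd (mxpow A j).
Proof.
move=> pA; have sA i : (mxpow A i)^T = mxpow A i.
  elim: i => [|i ih]; first by rewrite /mxpow/= trmx1.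
  rewrite {1}/mxpow/= trmx_mul -/(mxpow A i) ih (proj1 pA).
  by have := mxpowD A i 1; rewrite addn1 {3}/mxpow/= mulmx1 => <-.
rewrite -(odd_double_half j) -addnn addnC -addnA mxpowD.
case: (odd j); last by rewrite addn0 -{1}sA; exact: psd_gram.
by rewrite addn1/= mulmxA -{1}sA; exact: psd_congr.
Qed.

(** Polynomials in [A] with nonnegative coefficients. Unlike positive semi-definite matrices in
    general, they are closed under products, which is what the quadratic recursion for the square
    root needs. *)
Inductive power_cone A : 'M[R]_d -> Prop :=
| power_cone0 : power_cone A 0
| power_coneS c j B : 0 <= c -> power_cone A B ->
    power_cone A (c *: mxpow A j + B).

Lemma power_coneD A B C : power_cone A B -> power_cone A C ->
  power_cone A (B + C).
Proof.
move=> cB cC; elim: cB => [|c j B' c0 _ ih]; first by rewrite add0r.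
by rewrite -addrA; exact: power_coneS.
Qed.

Lemma power_coneZ A B c : 0 <= c -> power_cone A B -> power_cone A (c *: B).
Proof.
move=> c0; elim=> [|e j B' e0 _ ih]; first by rewrite scaler0; exact: power_cone0.
by rewrite scalerDr scalerA; apply: power_coneS => //; exact: mulr_ge0.
Qed.

Lemma power_coneM A B C : power_cone A B -> power_cone A C ->
  power_cone A (B *m C).
Proof.
move=> cB cC; elim: cB => [|c j B' c0 _ ih]; first by rewrite mul0mx; exact: power_cone0.
rewrite mulmxDl; apply: power_coneD => //; rewrite -scalemxAl.
apply: power_coneZ => //; elim: cC => [|e i C' e0 _ ih']; first by rewrite mulmx0; exact: power_cone0.
by rewrite mulmxDr -scalemxAr -mxpowD; exact: power_coneS.
Qed.

Lemma power_cone_psd A B : psd A -> power_cone A B -> psd B.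
Proof.
move=> pA; elim=> [|c j B' c0 _ ih]; first exact: psd0.
by apply: psdD => //; apply: psdZ => //; exact: mxpow_psd.
Qed.

(* The fixed points Y of the iteration satisfy (1 - Y)^2 = 1 - A. All iterates and
   their differences are polynomials in A with nonnegative coefficients. *)
Fixpoint sqrt_iter A k : 'M[R]_d :=
  if k is k'.+1 then 2^-1 *: (A + sqrt_iter A k' *m sqrt_iter A k') else 0.

Lemma sqrt_iter_cone A k : power_cone A (sqrt_iter A k).
Proof.
elim: k => [|k ih] /=; first exact: power_cone0.
apply: power_coneZ => //; apply: power_coneD; last exact: power_coneM.
have := @power_coneS A 1 1 0 ler01 (power_cone0 A).
by rewrite scale1r addr0 /mxpow/= mulmx1.
Qed.

(** With [D = Y_(k+1) - Y_k], the next difference is half of [D Y_(k+1) + Y_k D], so the cone is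
    preserved by induction. *)
Lemma sqrt_iter_nd A k : power_cone A (sqrt_iter A k.+1 - sqrt_iter A k).
Proof.
elim: k => [|k ih].
  rewrite /= mul0mx addr0 subr0; apply: power_coneZ => //.
  have := @power_coneS A 1 1 0 ler01 (power_cone0 A).
  by rewrite scale1r addr0 /mxpow/= mulmx1.
have -> : sqrt_iter A k.+2 - sqrt_iter A k.+1 =
    2^-1 *: ((sqrt_iter A k.+1 - sqrt_iter A k) *m sqrt_iter A k.+1
      + sqrt_iter A k *m (sqrt_iter A k.+1 - sqrt_iter A k)).
  rewrite mulmxBl mulmxBr addrA subrK /= -scalerBr; congr (_ *: _).
  by rewrite opprD addrACA subrr add0r.
apply: power_coneZ => //; apply: power_coneD; apply: power_coneM => //;
  exact: sqrt_iter_cone.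
Qed.

(** Up to the factor 1/2, [1 - Y_(k+1)] is [(1 - A) + (1 - Y^2)], and [1 - Y^2 = (1 - Y) + Y (1 - Y)
    Y + (1 - Y) Y (1 - Y)] is a sum of congruences of matrices already known to be positive
    semi-definite. *)
Lemma sqrt_iter_le1 A k : psd A -> psd (1%:M - A) ->
  psd (1%:M - sqrt_iter A k).
Proof.
move=> pA pA1; elim: k => [|k ih]; first by rewrite subr0; exact: psd1.
have -> : 1%:M - sqrt_iter A k.+1 =
    2^-1 *: ((1%:M - A) + ((1%:M - sqrt_iter A k) +
      ((sqrt_iter A k)^T *m (1%:M - sqrt_iter A k) *m sqrt_iter A k +
       (1%:M - sqrt_iter A k)^T *m sqrt_iter A k *m (1%:M - sqrt_iter A k)))).
  have pY := power_cone_psd pA (sqrt_iter_cone A k).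
  rewrite (proj1 ih) (proj1 pY) /=; set Y := sqrt_iter A k.
  rewrite !(mulmxBl, mulmxBr, mul1mx, mulmx1).
  apply/(scalerI (a := 2)) => //; rewrite scalerA divff// scale1r.
  rewrite scalerBr scalerA divff// scale1r.
  apply/matrixP => i j; rewrite !mxE; ring.
apply: psdZ => //; apply: psdD => //; apply: psdD => //; apply: psdD.
  exact: psd_congr.
exact/psd_congr/(power_cone_psd pA)/sqrt_iter_cone.
Qed.

(** The quadratic form of the iterates at [x] is nondecreasing and bounded by the squared norm of
    [x]. Polarisation gives the entrywise limits, and the recursion passes to the limit. *)
Lemma sqrt_iter_cvg A : psd A -> psd (1%:M - A) ->
  exists L, [/\ psd (1%:M - L), 2 *: L = A + L *m L &
    forall i j, (sqrt_iter A k i j) @[k --> \oo] --> L i j].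
Proof.
move=> pA pA1.
have pY k := power_cone_psd pA (sqrt_iter_cone A k).
have cq x : cvgn (fun k => dotv x (sqrt_iter A k *m x)).
  apply: nondecreasing_is_cvgn.
    apply/nondecreasing_seqP => k; rewrite -subr_ge0 -dotvNr -dotvDr -mulNmx -mulmxDl.
    by have /psdP[_] := power_cone_psd pA (sqrt_iter_nd A k); exact.
  exists (dotv x x) => _ [k _ <-]; rewrite -subr_ge0 dotv_1B.
  by have /psdP[_] := sqrt_iter_le1 k pA pA1; exact.
have ce i j : cvgn (fun k => sqrt_iter A k i j).
  under eq_fun => k do rewrite dotv_polar ?(proj1 (pY k))//.
  apply: is_cvgMr; apply: is_cvgB; last exact: cq.
  by apply: is_cvgB; exact: cq.
pose L : 'M[R]_d := \matrix_(i, j) limn (fun k => sqrt_iter A k i j).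
have cL i j : (sqrt_iter A k i j) @[k --> \oo] --> L i j by rewrite mxE; exact: ce.
have cqL x : dotv x (sqrt_iter A k *m x) @[k --> \oo] --> dotv x (L *m x).
  rewrite dotvE (_ : (fun k => _) = (fun k => \sum_i x i 0 * \sum_j sqrt_iter A k i j * x j 0)); last first.
    by apply/funext => k; rewrite dotvE; apply: eq_bigr => i _; rewrite mxE.
  under eq_bigr do rewrite mxE.
  apply: cvg_sumr => i; apply: cvgMr; apply: cvg_sumr => j.
  by apply: cvgMl.
exists L; split => //.
  apply/psdP; split.
    rewrite linearB/= trmx1; congr (_ - _); apply/matrixP => i j.
    rewrite !mxE; congr (lim (_ @ \oo)); apply/funext => k.
    by rewrite -{1}(proj1 (pY k)) mxE.
  move=> x; rewrite mulmxBl mul1mx dotvDr dotvNr subr_ge0.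
  have := cqL x; move/cvg_lim => <- //.
  apply: limr_le; first exact: cq.
  apply: nearW => k; rewrite -subr_ge0 dotv_1B.
  by have /psdP[_] := sqrt_iter_le1 k pA pA1; exact.
apply/matrixP => i j.
have h1 : (sqrt_iter A k.+1 i j) @[k --> \oo] --> L i j by rewrite (cvg_shiftS (fun k => sqrt_iter A k i j)).
have h2 : (sqrt_iter A k.+1 i j) @[k --> \oo] --> 2^-1 * (A i j + \sum_l L i l * L l j).
  rewrite (_ : (fun k => _) = (fun k => 2^-1 * (A i j + \sum_l sqrt_iter A k i l * sqrt_iter A k l j))); last first.
    by apply/funext => k; rewrite !mxE.
  apply: cvgMr; apply: cvgD; first exact: cvg_cst.
  by apply: cvg_sumr => l; exact: cvgM.
have e : L i j = _ := cvg_unique (@Rhausdorff R) h1 h2.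
by rewrite [LHS]mxE [RHS]mxE e mulrA divff// mul1r [in RHS]mxE.
Qed.

(* A scale for which M / c lies between 0 and the identity. *)
Definition sqrt_scale M : R := 1 + \sum_i \sum_j `|M i j|.

Lemma sqrt_scale_gt0 M : 0 < sqrt_scale M.
Proof. by rewrite ltr_pwDl// sumr_ge0// => i _; rewrite sumr_ge0. Qed.

Lemma dotv_sqrt_scale M x : dotv x (M *m x) <= sqrt_scale M * dotv x x.
Proof.
have le_sq i : x i 0 ^+ 2 <= dotv x x.
  rewrite dotvE (bigD1 i)//= -expr2 lerDl.
  by apply: sumr_ge0 => j _; rewrite -expr2 sqr_ge0.
rewrite dotvE mulrDl mul1r.
apply: (@le_trans _ _ (\sum_i \sum_j `|M i j| * dotv x x)).
  apply: ler_sum => i _; rewrite mxE mulr_sumr; apply: ler_sum => j _.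
  apply: (@le_trans _ _ (`|M i j| * (`|x i 0| * `|x j 0|))).
    by rewrite -!normrM (le_trans (ler_norm _))// mulrCA.
  apply: ler_wpM2l => //.
  have := sqr_ge0 (`|x i 0| - `|x j 0|).
  have := le_sq i; have := le_sq j.
  rewrite -(real_normK (num_real (x i 0))) -(real_normK (num_real (x j 0))).
  by nra.
rewrite mulr_suml ler_wpDl ?dotv_ge0//; apply: ler_sum => i _.
by rewrite mulr_suml.
Qed.

(** For [A = 1 - M / c], with [c] the scale, a fixed point [Y] satisfies [(1 - Y)^2 = M / c]. Each
    approximant is an explicit, hence measurable, function of [M]. *)
Definition sqrt_approx M k : 'M[R]_d :=
  Num.sqrt (sqrt_scale M) *: (1%:M - sqrt_iter (1%:M - (sqrt_scale M)^-1 *: M) k).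

Lemma sqrt_approx_cvg M : psd M -> exists B, [/\ psd B, B *m B = M &
  forall i j, (sqrt_approx M k i j) @[k --> \oo] --> B i j].
Proof.
move=> pM; set c := sqrt_scale M; have c0 : 0 < c := sqrt_scale_gt0 M.
have p1 : psd (1%:M - c^-1 *: M).
  apply/psdP; split; first by rewrite linearB/= linearZ/= trmx1 (proj1 pM).
  move=> x; rewrite -dotv_1B -scalemxAl dotvZr subr_ge0 ler_pdivrMl//.
  exact: dotv_sqrt_scale.
have p2 : psd (1%:M - (1%:M - c^-1 *: M)).
  by rewrite subKr; apply: psdZ => //; rewrite invr_ge0 ltW.
have [L [pL eL cL]] := sqrt_iter_cvg p1 p2.
exists (Num.sqrt c *: (1%:M - L)); split.
- by apply: psdZ.
- rewrite -scalemxAl -scalemxAr scalerA -expr2 sqr_sqrtr ?ltW//.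
  have -> : (1%:M - L) *m (1%:M - L) = 1%:M - 2 *: L + L *m L.
    rewrite mulmxBl mul1mx mulmxBr mulmx1 scaler_nat mulr2n.
    by apply/matrixP => i j; rewrite !mxE; ring.
  rewrite eL opprD addrA subrK subKr scalerA divff ?scale1r// gt_eqF//.
- move=> i j; rewrite !mxE; under eq_fun do rewrite !mxE.
  by apply: cvgMr; apply: cvgB => //; exact: cvg_cst.
Qed.

Lemma mxsqrtP M : psd M -> psd (mxsqrt M) /\ mxsqrt M *m mxsqrt M = M.
Proof.
move=> /sqrt_approx_cvg[B [pB BM _]].
exact: (@xgetPex _ 0 [set B | psd B /\ B *m B = M] (ex_intro _ B (conj pB BM))).
Qed.

Lemma mxsqrt_unique M B : psd B -> B *m B = M -> mxsqrt M = B.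
Proof.
move=> pB BM; have pM : psd M by rewrite -BM -{1}(proj1 pB); exact: psd_gram.
have [p e] := mxsqrtP pM.
by apply: psd_sqr_inj => //; rewrite e.
Qed.

Lemma mxsqrt_cvg M i j : psd M -> (sqrt_approx M k i j) @[k --> \oo] --> mxsqrt M i j.
Proof.
by move=> /sqrt_approx_cvg[B [pB BM cB]]; rewrite (mxsqrt_unique pB BM).
Qed.

Lemma mxsqrt_npsd M : ~ psd M -> mxsqrt M = 0.
Proof.
move=> npM; rewrite /mxsqrt; case: xgetP => // B _ [pB BM]; exfalso; apply: npM.
by rewrite -BM -{1}(proj1 pB); exact: psd_gram.
Qed.

Lemma mxsqrt0 : mxsqrt (0 : 'M[R]_d) = 0.
Proof. by apply: mxsqrt_unique; rewrite ?mul0mx//; exact: psd0. Qed.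

Lemma mxsqrt_gram M : psd M -> mxsqrt M *m (mxsqrt M)^T = M.
Proof. by move=> /mxsqrtP[[-> _] ?]. Qed.

Lemma closed_psd : closed [set M : 'M[R]_d | psd M].
Proof.
have qc x : continuous (fun M => dotv x (M *m x)).
  move=> M; rewrite /continuous_at dotvE; under eq_fun do rewrite dotvE.
  apply: (cvg_sumr (F := nbhs M)) => i; apply: cvgMr; rewrite mxE.
  under eq_fun do rewrite mxE.
  by apply: (cvg_sumr (F := nbhs M)) => j; apply: cvgMl; exact: coord_continuous.
have sc i j : continuous (fun M : 'M[R]_d => M i j - M j i).
  move=> M; apply: (@continuousB _ R^o 'M[R]_d (fun M : 'M[R]_d => M i j) (fun M : 'M[R]_d => M j i) M).
    exact: coord_continuous.
  exact: coord_continuous.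
rewrite (_ : mkset _ = (\bigcap_(ij in [set: 'I_d * 'I_d])
    [set M : 'M[R]_d | M ij.1 ij.2 - M ij.2 ij.1 = 0]) `&`
    \bigcap_(x in [set: 'cV[R]_d]) [set M : 'M[R]_d | 0 <= dotv x (M *m x)]).
  apply: closedI; apply: closed_bigI => z _.
    apply: (@preimage_closed _ _ (fun M : 'M[R]_d => M z.1 z.2 - M z.2 z.1) [set 0]).
      by move=> M _; exact: sc.
    exact: closed_eq.
  apply: (@preimage_closed _ _ (fun M : 'M[R]_d => dotv z (M *m z)) [set y | 0 <= y]).
    by move=> M _; exact: qc.
  exact: closed_ge.
apply/seteqP; split=> [M /psdP[sM pM]|M [sM pM]]/=.
  split=> [ij _|x _]/=; last exact: pM.
  by have := congr1 (fun N : 'M[R]_d => N ij.1 ij.2) sM; rewrite mxE => ->; rewrite subrr.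
apply/psdP; split=> [|x]; last exact: pM.
by apply/matrixP => i j; rewrite mxE; apply/subr0_eq/(sM (j, i)).
Qed.

Lemma measurable_psd : measurable ([set M | psd M] : set (mxBorel R d d)).
Proof.
rewrite -[X in measurable X]setCK; apply: measurableC; apply: sub_gen_smallest.
exact/closed_openC/closed_psd.
Qed.

Lemma measurable_sqrt_iter k :
  measurable_fun setT (sqrt_iter^~ k : mxBorel R d d -> mxBorel R d d).
Proof.
elim: k => [|k ih] /=; first exact: measurable_cst.
apply: measurable_scalemx => //; apply: measurable_addmx; first exact: measurable_id.
exact: measurable_mulmx.
Qed.

Lemma measurable_sqrt_approx k :
  measurable_fun setT (sqrt_approx^~ k : mxBorel R d d -> mxBorel R d d).
Proof.
have mc : measurable_fun setT (sqrt_scale : mxBorel R d d -> R).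
  apply: measurable_funD => //; apply: measurable_sum => i; apply: measurable_sum => j.
  by apply: measurableT_comp => //; exact: measurable_coord.
apply: measurable_scalemx.
  by apply: measurableT_comp => //; apply: continuous_measurable_fun; exact: sqrt_continuous.
apply: measurable_addmx => //; apply: measurable_oppmx.
apply: (measurableT_comp (measurable_sqrt_iter k)).
apply: measurable_addmx => //; apply: measurable_oppmx.
apply: measurable_scalemx; last exact: measurable_id.
rewrite (_ : (fun _ => _) = fun M : mxBorel R d d => sqrt_scale M `^ (-1)).
  by apply: (measurableT_comp (f := @powR R ^~ (-1))) => //; exact: measurable_powR.
by apply/funext => M; rewrite powR_inv1// ltW// sqrt_scale_gt0.
Qed.

(** On the closed set of positive semi-definite matrices the root is the pointwise limit of
    [sqrt_approx]; off this set it takes the default value 0. *)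
Lemma measurable_mxsqrt :
  measurable_fun setT (@mxsqrt R d : mxBorel R d d -> mxBorel R d d).
Proof.
apply: measurable_mxP => i j.
pose h k (M : mxBorel R d d) : R := if `[< psd (M : 'M[R]_d) >] then sqrt_approx M k i j else 0.
apply: (measurable_fun_cvg (h := h)) => [k|M _].
  apply: measurable_fun_ifT => //.
    rewrite (_ : (fun _ => _) = fun M : mxBorel R d d => M \in [set M : mxBorel R d d | psd (M : 'M[R]_d)]).
      apply: (measurable_fun_bool true); rewrite setTI.
      rewrite (_ : _ @^-1` _ = [set M : mxBorel R d d | psd (M : 'M[R]_d)]); first exact: measurable_psd.
      by apply/seteqP; split=> M pM; [exact: (set_mem pM)|exact: (mem_set pM)].
    by apply/funext => M; apply/asboolP/idP; rewrite inE.
  apply: (@measurable_fun_coord R _ (mxBorel R d d) d d (sqrt_approx^~ k) i j).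
  exact: measurable_sqrt_approx.
rewrite /h; case: asboolP => [pM|npM]; first exact: mxsqrt_cvg.
by rewrite mxsqrt_npsd// mxE; exact: cvg_cst.
Qed.

End square_root.

(** * The Euclidean operator norm *)

Section operator_norm.
Context {R : realType} {d : nat}.
Implicit Types (M : 'M[R]_d) (x : 'cV[R]_d).

Lemma lpnorm2E x : lpnorm 2%:E x = Num.sqrt (dotv x x).
Proof.
rewrite /lpnorm dotvE -powR12_sqrt; last by rewrite sumr_ge0// => i _; rewrite -expr2 sqr_ge0.
congr (_ `^ _); apply: eq_bigr => i _.
by rewrite powR_mulrn// real_normK ?num_real.
Qed.

Lemma lpnorm2_ge0 x : 0 <= lpnorm 2%:E x.
Proof. by rewrite lpnorm2E. Qed.

Lemma lpnorm2_sqr x : lpnorm 2%:E x ^+ 2 = dotv x x.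
Proof. by rewrite lpnorm2E sqr_sqrtr// dotv_ge0. Qed.

(** A supremum in the reals bounds its set only if the set is bounded. Here the squared norm of
    [M y] is the quadratic form of [M^T M] at [y]. *)
Lemma opnorm2_has_ubound M :
  has_ubound [set lpnorm 2%:E (M *m y) | y in [set y | lpnorm 2%:E y <= 1]].
Proof.
exists (Num.sqrt (sqrt_scale (M^T *m M))) => _ [y y1 <-].
rewrite lpnorm2E; apply: ler_wsqrtr; rewrite dotv_mulmx mulmxA dotvC.
rewrite (le_trans (dotv_sqrt_scale _ _))// ler_piMr// ?(ltW (sqrt_scale_gt0 _))//.
by rewrite -lpnorm2_sqr expr_le1// lpnorm2_ge0.
Qed.

Lemma opnorm2P M x : lpnorm 2%:E (M *m x) <= opnorm2 M * lpnorm 2%:E x.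
Proof.
have [x0|x0] := eqVneq (dotv x x) 0.
  have -> : x = 0 by apply: gram_eq0; apply/matrixP => i j; rewrite !ord1 [LHS]x0 mxE.
  by rewrite mulmx0 lpnorm2E /dotv mulmx0 mxE sqrtr0 mulr0.
have n0 : 0 < lpnorm 2%:E x by rewrite lpnorm2E sqrtr_gt0 lt_def x0 dotv_ge0.
rewrite -ler_pdivrMr//; apply: ub_le_sup; first exact: opnorm2_has_ubound.
exists ((lpnorm 2%:E x)^-1 *: x) => /=.
  by rewrite lpnorm2E dotvZl dotvZr -lpnorm2_sqr mulrA -expr2 -exprMn mulVf ?gt_eqF// expr1n sqrtr1.
rewrite -scalemxAr !lpnorm2E dotvZl dotvZr mulrA -expr2 sqrtrM ?sqr_ge0// sqrtr_sqr.
by rewrite ger0_norm ?invr_ge0 ?sqrtr_ge0// mulrC.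
Qed.

Lemma opnorm2_ge0 M : 0 <= opnorm2 M.
Proof.
apply: ub_le_sup; first exact: opnorm2_has_ubound.
by exists 0; rewrite ?mulmx0/= lpnorm2E /dotv mulmx0 mxE sqrtr0.
Qed.

Lemma opnorm2_sqrP M x : dotv (M *m x) (M *m x) <= opnorm2 M ^+ 2 * dotv x x.
Proof.
rewrite -!lpnorm2_sqr -exprMn lerXn2r ?nnegrE ?lpnorm2_ge0//; last exact: opnorm2P.
exact: le_trans (lpnorm2_ge0 _) (opnorm2P _ _).
Qed.

(** Cauchy-Schwarz in disguise: expand the squared norms of [c x - M x] and [c x + M x], use that
    the squared norm of [M x] is at most [c^2] times that of [x], and divide by [2 c]. The case
    [c = 0], where [M x = 0], is separate. *)
Lemma opnorm2_qf M x c : opnorm2 M <= c -> `|dotv x (M *m x)| <= c * dotv x x.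
Proof.
move=> Mc; have c0 := le_trans (opnorm2_ge0 M) Mc.
have h : dotv (M *m x) (M *m x) <= c ^+ 2 * dotv x x.
  apply: le_trans (opnorm2_sqrP M x) _; apply: ler_wpM2r; first exact: dotv_ge0.
  by rewrite lerXn2r ?nnegrE ?opnorm2_ge0.
have [c00|c1] := eqVneq c 0.
  have z : M *m x = 0.
    apply: gram_eq0; apply/matrixP => i j; rewrite !ord1 [RHS]mxE -/(dotv _ _).
    by apply/eqP; rewrite eq_le dotv_ge0 andbT (le_trans h)// c00 expr0n mul0r.
  by rewrite z c00 /dotv mulmx0 mxE normr0 mul0r.
have {}c0 : 0 < c by rewrite lt_def c1.
have s1 : 0 <= dotv (c *: x - M *m x) (c *: x - M *m x) := dotv_ge0 _.
have s2 : 0 <= dotv (c *: x + M *m x) (c *: x + M *m x) := dotv_ge0 _.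
move: s1 s2; rewrite !(dotvDl, dotvDr, dotvZl, dotvZr, dotvNl, dotvNr) (dotvC (M *m x) x).
move: h; set a := dotv x (M *m x); set b := dotv (M *m x) _; set e := dotv x x => h s1 s2.
have t1 : 0 <= 2 * c * (c * e - a) by lra.
have t2 : 0 <= 2 * c * (c * e + a) by lra.
move: t1 t2; rewrite !pmulr_rge0 ?mulr_gt0// => t1 t2.
by rewrite ler_norml; apply/andP; split; lra.
Qed.

End operator_norm.

(** * The p-norm, distances and subgaussian tails *)

Section lp_norm.
Context {R : realType} {d : nat}.
Implicit Types (x y : 'cV[R]_d) (p : \bar R) (r : R).

Lemma lpnormrE r x : lpnorm r%:E x = (\sum_(i < d) `|x i 0| `^ r) `^ r^-1.
Proof. by []. Qed.

Lemma lpnormyE x : lpnorm +oo%E x = \big[Num.max/0]_(i < d) `|x i 0|.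
Proof. by []. Qed.

Lemma lp_exponentP p : (1 <= p)%E -> (exists2 r, 1 <= r & p = r%:E) \/ p = +oo%E.
Proof.
case: p => [r| |//]; last by right.
by rewrite lee_fin => r1; left; exists r.
Qed.

Lemma lpnorm_ge0 p x : 0 <= lpnorm p x.
Proof. by case: p => [r| |]; rewrite ?lpnormrE ?powR_ge0//; exact: bigmax_ge_id. Qed.

Lemma lpnormN p x : lpnorm p (- x) = lpnorm p x.
Proof.
case: p => [r| |]; rewrite ?lpnormrE; last 2 first.
- by apply: eq_bigr => i _; rewrite mxE normrN.
- by apply: eq_bigr => i _; rewrite mxE normrN.
by congr (_ `^ _); apply: eq_bigr => i _; rewrite mxE normrN.
Qed.

Lemma lpnormZ p c x : (1 <= p)%E -> 0 <= c -> lpnorm p (c *: x) = c * lpnorm p x.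
Proof.
move=> /lp_exponentP[[r r1 ->]|->] c0; last first.
  rewrite !lpnormyE; under eq_bigr do rewrite mxE normrM (ger0_norm c0).
  by rewrite (big_morph ( *%R c) (id1 := 0) (op1 := Num.max)) ?mulr0// => a b; rewrite maxr_pMr.
rewrite !lpnormrE; under eq_bigr do rewrite mxE normrM (ger0_norm c0) powRM//.
rewrite -mulr_sumr powRM ?powR_ge0//; last by rewrite sumr_ge0// => i _; exact: powR_ge0.
by rewrite -powRrM divff ?powRr1// gt_eqF// (lt_le_trans ltr01).
Qed.

Lemma lpnorm0 p : (1 <= p)%E -> lpnorm p (0 : 'cV[R]_d) = 0.
Proof. by move=> p1; rewrite -(scale0r (0 : 'cV[R]_d)) lpnormZ// mul0r. Qed.

Lemma powR_norm_le_lpnorm r x : 0 < r -> (lpnorm r%:E x) `^ r = \sum_(i < d) `|x i 0| `^ r.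
Proof.
by move=> r0; rewrite lpnormrE -powRrM mulVf ?gt_eqF// powRr1// sumr_ge0// => i _; exact: powR_ge0.
Qed.

Lemma normr_le_lpnorm p x i : (1 <= p)%E -> `|x i 0| <= lpnorm p x.
Proof.
move=> /lp_exponentP[[r r1 ->]|->]; last by rewrite lpnormyE; exact: le_bigmax.
have r0 : 0 < r by rewrite (lt_le_trans ltr01).
rewrite leNgt; apply/negP => h.
have := gt0_ltr_powR r0 _ _ h.
rewrite !nnegrE lpnorm_ge0 normr_ge0 => /(_ isT isT).
by rewrite powR_norm_le_lpnorm// (bigD1 i)//= ltNge lerDl sumr_ge0.
Qed.

Lemma convex_powR_comb r t a b : 1 <= r -> 0 <= t <= 1 -> 0 <= a -> 0 <= b ->
  (t * a + (1 - t) * b) `^ r <= t * a `^ r + (1 - t) * b `^ r.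
Proof.
move=> r1 /andP[t0 t1] a0 b0.
by apply: (convex_powR r1 (Itv01 t0 t1)); rewrite inE/= in_itv/= andbT.
Qed.

(** Minkowski's inequality. With [a] and [b] the two norms, [(x + y) / (a + b)] is the convex
    combination of [x / a] and [y / b] with weights [a / (a + b)] and [b / (a + b)]; convexity of
    the power [r] is applied to each coordinate. Vanishing norms are removed first, because of the
    divisions. *)
Lemma lpnormD p x y : (1 <= p)%E -> lpnorm p (x + y) <= lpnorm p x + lpnorm p y.
Proof.
move=> /[dup] p1 /lp_exponentP[[r r1 pr]|pr]; last first.
  rewrite {1}pr lpnormyE; apply/bigmax_leP; split=> [|i _].
    by rewrite addr_ge0// lpnorm_ge0.
  by rewrite mxE (le_trans (ler_normD _ _))// lerD// normr_le_lpnorm.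
have zero (z : 'cV[R]_d) : lpnorm p z = 0 -> z = 0.
  move=> z0; apply/matrixP => i j; rewrite ord1 mxE; apply/eqP.
  by rewrite -normr_le0 -z0; exact: normr_le_lpnorm.
have [x0|x0] := eqVneq (lpnorm p x) 0; first by rewrite (zero _ x0) add0r lerDr lpnorm_ge0.
have [y0|y0] := eqVneq (lpnorm p y) 0; first by rewrite (zero _ y0) addr0 lerDl lpnorm_ge0.
have {}x0 : 0 < lpnorm p x by rewrite lt_def x0 lpnorm_ge0.
have {}y0 : 0 < lpnorm p y by rewrite lt_def y0 lpnorm_ge0.
have r0 : 0 < r by rewrite (lt_le_trans ltr01).
set a := lpnorm p x in x0 *; set b := lpnorm p y in y0 *.
have ab0 : 0 < a + b by rewrite addr_gt0.
have sum_a : \sum_(i < d) (`|x i 0| / a) `^ r = 1.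
  under eq_bigr do rewrite powRM// ?invr_ge0 ?(ltW x0)//.
  rewrite -mulr_suml -powR_norm_le_lpnorm// -pr -/a -powRM ?ltW// ?invr_gt0//.
  by rewrite divff ?powR1// gt_eqF.
have sum_b : \sum_(i < d) (`|y i 0| / b) `^ r = 1.
  under eq_bigr do rewrite powRM// ?invr_ge0 ?(ltW y0)//.
  rewrite -mulr_suml -powR_norm_le_lpnorm// -pr -/b -powRM ?ltW// ?invr_gt0//.
  by rewrite divff ?powR1// gt_eqF.
have t01 : 0 <= a / (a + b) <= 1.
  apply/andP; split; first by rewrite divr_ge0 ?ltW.
  by rewrite ler_pdivrMr// mul1r lerDl ltW.
have key : \sum_(i < d) (`|(x + y) i 0| / (a + b)) `^ r <= 1.
  apply: (@le_trans _ _ (\sum_(i < d)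
      (a / (a + b) * (`|x i 0| / a) `^ r + (1 - a / (a + b)) * (`|y i 0| / b) `^ r))).
    apply: ler_sum => i _.
    have xa0 : 0 <= `|x i 0| / a by rewrite divr_ge0// ltW.
    have yb0 : 0 <= `|y i 0| / b by rewrite divr_ge0// ltW.
    apply: le_trans (convex_powR_comb r1 t01 xa0 yb0).
    apply: ge0_ler_powR; rewrite ?nnegrE; first exact: ltW.
    - by rewrite divr_ge0// ltW.
    - apply: addr_ge0; apply: mulr_ge0; rewrite ?subr_ge0//; by case/andP : t01.
    - have -> : a / (a + b) * (`|x i 0| / a) + (1 - a / (a + b)) * (`|y i 0| / b) =
         (`|x i 0| + `|y i 0|) / (a + b) by field; rewrite !gt_eqF.
      by rewrite ler_pM2r ?invr_gt0// mxE ler_normD.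
  by rewrite big_split/= -!mulr_sumr sum_a sum_b !mulr1 addrC subrK.
rewrite {1}pr lpnormrE.
have -> : a + b = ((a + b) `^ r) `^ r^-1 by rewrite -powRrM divff ?gt_eqF// powRr1// ltW.
apply: ge0_ler_powR; rewrite ?nnegrE ?invr_ge0 ?(ltW r0) ?powR_ge0//.
  by rewrite sumr_ge0// => i _; exact: powR_ge0.
rewrite -[leRHS]mul1r -ler_pdivrMr ?powR_gt0// mulr_suml.
move: key; under eq_bigr do rewrite powRM// ?invr_ge0 ?(ltW ab0)//.
rewrite (_ : \sum_(i < d) _ = \sum_(i < d) `|(x + y) i 0| `^ r / (a + b) `^ r)//.
by apply: eq_bigr => i _; rewrite -powR_inv1 ?ltW// -powRrM mulN1r powRN.
Qed.

Lemma lpnorm_distrC p x y : lpnorm p (x - y) = lpnorm p (y - x).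
Proof. by rewrite -lpnormN opprB. Qed.

Lemma dimpow_ge0 p : 0 <= dimpow p d :> R.
Proof. by case: p => [r| |] //=; exact: powR_ge0. Qed.

(** The factor [Num.sqrt (dimpow p d)] is [d^(1/p)], read as 1 when [p] is infinite. *)
Lemma lpnorm_le_max p x m : (1 <= p)%E -> 0 <= m ->
  (forall i, `|x i 0| <= m) -> lpnorm p x <= Num.sqrt (dimpow p d) * m.
Proof.
move=> /lp_exponentP[[r r1 ->]|->] m0 xm; last first.
  by rewrite lpnormyE/= sqrtr1 mul1r; apply/bigmax_leP; split.
have r0 : 0 < r by rewrite (lt_le_trans ltr01).
rewrite -powR12_sqrt ?dimpow_ge0//= -powRrM (_ : 2 / r * 2^-1 = r^-1); last first.
  by field; rewrite gt_eqF.
have -> : d%:R `^ r^-1 * m = (d%:R * m `^ r) `^ r^-1.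
  by rewrite powRM ?powR_ge0// -powRrM divff ?powRr1// gt_eqF.
apply: ge0_ler_powR; rewrite ?nnegrE ?invr_ge0 ?(ltW r0)//.
- by rewrite sumr_ge0// => i _; exact: powR_ge0.
- by rewrite mulr_ge0// powR_ge0.
- rewrite mulr_natl -[X in _ *+ X]card_ord -sumr_const; apply: ler_sum => i _.
  by apply: ge0_ler_powR; rewrite ?nnegrE ?(ltW r0).
Qed.

Lemma measurable_lpnorm p : measurable_fun setT (lpnorm p : mxBorel R d 1 -> R).
Proof.
have mmax : measurable_fun setT ((fun x => \big[Num.max/0]_(i < d) `|x i 0|) : mxBorel R d 1 -> R).
  elim: (index_enum _) => [|i s ih].
    by under eq_fun do rewrite big_nil; exact: measurable_cst.
  under eq_fun do rewrite big_cons; apply: measurable_maxr => //.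
  by apply: measurableT_comp => //; exact: measurable_coord.
case: p => [r| |] //.
apply: (measurableT_comp (f := @powR R ^~ r^-1)); first exact: measurable_powR.
apply: measurable_sum => i; apply: (measurableT_comp (f := @powR R ^~ r)); first exact: measurable_powR.
by apply: measurableT_comp => //; exact: measurable_coord.
Qed.

Lemma lipschitz_measurable p (f : 'cV[R]_d -> R) C : (1 <= p)%E ->
  (forall x y, `|f x - f y| <= C * lpnorm p (x - y)) ->
  measurable_fun setT (f : mxBorel R d 1 -> R).
Proof.
move=> p1 fL; apply: continuous_mxBorel => x.
apply/(cvgrPdist_lt (F := nbhs x)) => e e0.
(* The balls of the matrix topology are cubes, whence the comparison of the p-norm with the largest
   entry. The two added ones keep [c] positive. *)
pose c := (`|C| + 1) * (Num.sqrt (dimpow p d) + 1).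
have c0 : 0 < c by rewrite mulr_gt0// ltr_wpDl// sqrtr_ge0.
apply/nbhs_ballP; exists (e / c) => /=; first by rewrite divr_gt0.
move=> y [_ xy]; apply: (le_lt_trans (fL _ _)).
apply: (@le_lt_trans _ _ (`|C| * (Num.sqrt (dimpow p d) * (e / c)))).
  apply: (le_trans (ler_wpM2r (lpnorm_ge0 _ _) (ler_norm C))); apply: ler_wpM2l => //.
  apply: lpnorm_le_max => // [|i]; first by rewrite divr_ge0 ?ltW.
  by rewrite !mxE ltW//; exact: xy.
rewrite !mulrA ltr_pdivrMr// [ltRHS]mulrC ltr_pM2r// /c.
have := normr_ge0 C; have := sqrtr_ge0 (dimpow p d : R); nra.
Qed.

End lp_norm.

Section set_distance.
Context {R : realType} {d : nat} (p : \bar R) (p1 : (1 <= p)%E).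
Context (A : set 'cV[R]_d) (A0 : A !=set0).
Implicit Types x y : 'cV[R]_d.

(** Real-valued distance. It agrees with [lpdist] for a nonempty set only: the infimum of the empty
    set is 0 in the reals but infinite in [\bar R]. *)
Definition rdist x : R := inf [set lpnorm p (x - y) | y in A].

Lemma rdist_has_inf x : has_inf [set lpnorm p (x - y) | y in A].
Proof.
split; first by case: A0 => y Ay; exists (lpnorm p (x - y)); exists y.
by exists 0 => _ [y _ <-]; exact: lpnorm_ge0.
Qed.

Lemma lpdistE x : lpdist p x A = (rdist x)%:E.
Proof.
have [ne lb] := rdist_has_inf x.
rewrite /lpdist -ereal_inf_EFin//; congr ereal_inf.
by rewrite -image_comp.
Qed.

Lemma rdist_ge0 x : 0 <= rdist x.
Proof.
apply: lb_le_inf; first by case: (rdist_has_inf x).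
by move=> _ [y _ <-]; exact: lpnorm_ge0.
Qed.

Lemma rdist_le x y : A y -> rdist x <= lpnorm p (x - y).
Proof. by move=> Ay; apply: ge_inf; [case: (rdist_has_inf x)|exists y]. Qed.

Lemma rdist_in x : A x -> rdist x = 0.
Proof.
move=> Ax; apply/eqP; rewrite eq_le rdist_ge0 andbT.
by rewrite (le_trans (rdist_le x Ax))// subrr lpnorm0.
Qed.

Lemma rdist_lip x y : rdist x <= rdist y + lpnorm p (x - y).
Proof.
rewrite -lerBlDr; apply: lb_le_inf; first by case: (rdist_has_inf y).
move=> _ [z Az <-]; rewrite lerBlDr (le_trans (rdist_le x Az))//.
have -> : x - z = (y - z) + (x - y) by rewrite [RHS]addrC addrA subrK.
exact: lpnormD.
Qed.

Lemma enlargeE eta : enlarge p eta A = [set x | rdist x <= eta].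
Proof. by apply/seteqP; split=> x; rewrite /enlarge/= lpdistE lee_fin. Qed.

(* Equal to 1 on the a-enlargement of A and to 0 off the (a + b)-enlargement. *)
Definition ramp (a b : R) x : R :=
  Num.max 0 (Num.min 1 (1 + (a - rdist x) / b)).

Lemma ramp_ge0 a b x : 0 <= ramp a b x.
Proof. by rewrite /ramp le_max lexx. Qed.

Lemma ramp_le1 a b x : ramp a b x <= 1.
Proof. by rewrite /ramp ge_max ler01 ge_min lexx. Qed.

Lemma ramp_one a b x : 0 < b -> rdist x <= a -> ramp a b x = 1.
Proof.
move=> b0 xa; rewrite /ramp min_l ?max_r//.
by rewrite lerDl divr_ge0 ?subr_ge0// ltW.
Qed.

Lemma ramp_zero a b x : 0 < b -> a + b <= rdist x -> ramp a b x = 0.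
Proof.
move=> b0 xa; rewrite /ramp max_l// ge_min; apply/orP; right.
by rewrite -lerBrDl sub0r ler_pdivrMr// mulN1r; lra.
Qed.

Lemma ramp_lip a b x y : 0 < b -> `|ramp a b x - ramp a b y| <= b^-1 * lpnorm p (x - y).
Proof.
move=> b0; set L := b^-1 * _.
have L0 : 0 <= L by apply: mulr_ge0; [rewrite invr_ge0 ltW|exact: lpnorm_ge0].
have h u v : rdist v <= rdist u + lpnorm p (v - u) ->
    1 + (a - rdist u) / b <= 1 + (a - rdist v) / b + b^-1 * lpnorm p (v - u).
  move=> uv; rewrite mulrC [_ / b]mulrC -addrA lerD2l -mulrDr ler_pM2l ?invr_gt0//; lra.
have h1 := h x y (rdist_lip y x); have h2 := h y x (rdist_lip x y).
rewrite lpnorm_distrC -/L in h1; rewrite -/L in h2.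
move: h1 h2; rewrite /ramp; set s := 1 + _; set t := 1 + _ => h1 h2.
(* Clamping to [0, 1] is monotone and does not increase distances. *)
have clamp u v : u <= v + L -> Num.max 0 (Num.min 1 u) <= Num.max 0 (Num.min 1 v) + L.
  move=> uv; rewrite ge_max; apply/andP; split; first by rewrite addr_ge0// le_max lexx.
  rewrite -lerBlDr le_max; apply/orP; right; rewrite le_min; apply/andP; split.
    by rewrite lerBlDr ge_min; apply/orP; left; rewrite lerDl.
  by rewrite lerBlDr ge_min uv orbT.
by rewrite ler_distl; apply/andP; split; rewrite ?lerBlDr clamp.
Qed.

Lemma measurable_ramp a b : 0 < b ->
  measurable_fun setT (ramp a b : mxBorel R d 1 -> R).
Proof. by move=> b0; apply: (lipschitz_measurable p1) => x y; exact: ramp_lip. Qed.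

Lemma measurable_rdist : measurable_fun setT (rdist : mxBorel R d 1 -> R).
Proof.
apply: (lipschitz_measurable (C := 1) p1) => x y; rewrite mul1r ler_norml.
have := rdist_lip x y; have := rdist_lip y x; rewrite (lpnorm_distrC p y).
by move=> ? ?; apply/andP; split; lra.
Qed.

End set_distance.

(** A sublevel set of the Lipschitz function [rdist]; the enlargement of the empty set is empty, its
    distance being infinite. *)
Lemma measurable_enlarge {R : realType} {d : nat} (p : \bar R) eta (A : set 'cV[R]_d) :
  (1 <= p)%E -> measurable (enlarge p eta A : set (mxBorel R d 1)).
Proof.
move=> p1; have [->|/set0P A0] := eqVneq A set0.
  rewrite (_ : enlarge _ _ _ = set0); first exact: measurable0.
  by apply/seteqP; split=> x //; rewrite /enlarge/= /lpdist image_set0 ereal_inf0.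
rewrite enlargeE// -[X in measurable X]setTI.
apply: (@measurable_fun_ler _ _ _ _ (rdist p A : mxBorel R d 1 -> R) (cst eta)) => //.
exact: measurable_rdist.
Qed.

Section subgaussian_tails.
Context {R : realType} {d : nat}.
Variable mu : probability (mxBorel R d 1) R.

Definition subgauss (s : R) : Prop := forall (j : 'I_d) (l : R),
  (\int[mu]_x (expR (l * (x : 'cV[R]_d) j 0))%:E <= (expR (l ^+ 2 * s ^+ 2 / 2))%:E)%E.

Lemma measurable_exp_coord (j : 'I_d) l :
  measurable_fun setT (fun x : mxBorel R d 1 => expR (l * (x : 'cV[R]_d) j 0)).
Proof.
by apply: measurableT_comp => //; apply: measurable_funM => //; exact: measurable_coord.
Qed.

(** Chernoff's bound in a form common to all p: the indicator of [E] is dominated by [c] times the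
    sum of [exp (l |x_j|)]. Each [exp (l |x_j|)] is at most [exp (l x_j) + exp (- l x_j)], whence
    the factor [2 d]. *)
Lemma subgauss_tail s l c (E : set (mxBorel R d 1)) : subgauss s -> measurable E -> 0 <= c ->
  (forall x : 'cV[R]_d, E x -> 1 <= c * \sum_j expR (l * `|x j 0|)) ->
  (mu E <= (c * (2 * d%:R * expR (l ^+ 2 * s ^+ 2 / 2)))%:E)%E.
Proof.
move=> sg mE c0 h.
pose f j (x : mxBorel R d 1) := expR (l * (x : 'cV[R]_d) j 0) + expR (- l * (x : 'cV[R]_d) j 0).
have mf j : measurable_fun setT (f j).
  by apply: measurable_funD; exact: measurable_exp_coord.
have f0 j x : 0 <= f j x by rewrite addr_ge0// expR_ge0.
have := integral_indic mu measurableT mE; rewrite setIT => <-.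
apply: (@le_trans _ _ (\int[mu]_x (c%:E * \sum_j (f j x)%:E)))%E.
  apply: ge0_le_integral => //.
  - exact/measurable_EFinP/measurable_indic.
  - by apply: emeasurable_funM => //; apply: emeasurable_sum => j; exact/measurable_EFinP.
  - move=> x _; rewrite indicE; case: (boolP (x \in E)) => [/set_mem Ex|_]; last first.
      by rewrite mule_ge0 ?lee_fin// sume_ge0// => j _; rewrite lee_fin.
    rewrite sumEFin -EFinM lee_fin; apply: (le_trans (h x Ex)).
    apply: ler_wpM2l => //; apply: ler_sum => j _; rewrite /f.
    by case: (ger0P ((x : 'cV[R]_d) j 0)) => _; rewrite ?mulrN ?mulNr ?lerDl ?lerDr expR_ge0.
rewrite ge0_integralZl//; last 2 first.
- by apply: emeasurable_sum => j; exact/measurable_EFinP.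
- by move=> x _; apply: sume_ge0 => j _; rewrite lee_fin.
rewrite EFinM; apply: lee_wpmul2l; first by rewrite lee_fin.
rewrite ge0_integral_sum//; last 2 first.
- by move=> j; exact/measurable_EFinP.
- by move=> j x _; rewrite lee_fin.
rewrite (_ : 2 * d%:R * expR _ = \sum_(j < d) (2 * expR (l ^+ 2 * s ^+ 2 / 2))); last first.
  by rewrite sumr_const card_ord -mulr_natl; ring.
rewrite -sumEFin; apply: lee_sum => j _; rewrite /f.
under eq_integral do rewrite EFinD.
rewrite [leLHS](_ : _ = \int[mu]_x (expR (l * (x : 'cV[R]_d) j 0))%:E + \int[mu]_x (expR (- l * (x : 'cV[R]_d) j 0))%:E)%E; last first.
  by rewrite ge0_integralD//; apply/measurable_EFinP; exact: measurable_exp_coord.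
rewrite mulr_natl mulr2n EFinD; apply: leeD; first exact: sg.
by rewrite (le_trans (sg j (- l)))// sqrrN.
Qed.

Lemma measurable_some_coord_gt a :
  measurable ([set x : 'cV[R]_d | exists j, (a < `|x j 0|)%R] : set (mxBorel R d 1)).
Proof.
rewrite (_ : mkset _ = \bigcup_(j in [set: 'I_d]) [set x : 'cV[R]_d | (a < `|x j 0|)%R]); last first.
  by apply/seteqP; split=> x /= [j]; [exists j|move=> _ ?; exists j].
apply: fin_bigcup_measurable => // j _; rewrite -[X in measurable X]setTI.
apply: (@measurable_fun_ltr _ (mxBorel R d 1) _ _ (cst a) (fun x => `|(x : 'cV[R]_d) j 0|)) => //.
by apply: measurableT_comp => //; exact: measurable_coord.
Qed.

Lemma measurable_lpnorm_gt p a :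
  measurable ([set v : 'cV[R]_d | a < lpnorm p v] : set (mxBorel R d 1)).
Proof.
rewrite -[X in measurable X]setTI.
apply: (@measurable_fun_ltr _ (mxBorel R d 1) _ _ (cst a) (lpnorm p)) => //.
exact: measurable_lpnorm.
Qed.

Lemma subgauss_tail_max (s a : R) : subgauss s -> 0 < s -> 0 <= a ->
  (mu [set x : 'cV[R]_d | exists j, (a < `|x j 0|)%R]
    <= (2 * d%:R * expR (- a ^+ 2 / (2 * s ^+ 2)))%:E)%E.
Proof.
(* The minimiser of the exponent [l^2 s^2 / 2 - l a]. *)
move=> sg s0 a0; pose l := a / s ^+ 2.
have l0 : 0 <= l by rewrite divr_ge0 ?sqr_ge0.
have mE := measurable_some_coord_gt a.
apply: (le_trans (subgauss_tail (c := expR (- (l * a))) sg mE (expR_ge0 _) (l := l) _)).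
  move=> x /= [j aj]; rewrite (bigD1 j)//= mulrDr -expRD.
  apply: (@le_trans _ _ (expR (- (l * a) + l * `|x j 0|))).
    by rewrite -[leLHS]expR0 ler_expR addrC subr_ge0 ler_wpM2l// ltW.
  by rewrite lerDl mulr_ge0 ?expR_ge0// sumr_ge0// => i _; exact: expR_ge0.
rewrite lee_fin mulrCA -expRD le_eqVlt; apply/orP; left; apply/eqP.
by congr (_ * expR _); rewrite /l; field; rewrite gt_eqF.
Qed.

Lemma subgauss_tail_lp p (s a : R) : (0 < d)%N -> (1 <= p)%E -> subgauss s -> 0 < s -> 0 < a ->
  (mu [set x : 'cV[R]_d | (a < lpnorm p x)%R] <= (2 * phi p d * s / a)%:E)%E.
Proof.
move=> d0 p1 sg s0 a0.
have mE := measurable_lpnorm_gt p a.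
have dR : 1 <= d%:R :> R by rewrite ler1n.
have phi0 : 0 <= phi p d :> R by case: (p) => [r| |]; exact: sqrtr_ge0.
(* A bound of at least 1 is trivial. Below 1 there is room to weaken the true decay, which is a
   power or Gaussian, to a linear one. *)
have [big|small] := lerP 1 (2 * phi p d * s / a).
  by rewrite (le_trans (probability_le1 mu mE))// lee_fin.
case: (lp_exponentP p1) => [[r r1 pr]|pr]; subst p.
  have r0 : 0 < r by rewrite (lt_le_trans ltr01).
  have sr0 : 0 < Num.sqrt r by rewrite sqrtr_gt0.
  (* The inequality [y <= exp (y - 1)] at [y = l |x_j| / r], raised to the power [r], bounds
     [|x_j|^r] by [(sqrt r s)^r exp (- r) exp (l |x_j|)]. With this [l] the moment factor is
     [exp (r / 2)], so the tail is at most [2 t^r exp (- r / 2)], and [t^r <= t] because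
     [t <= 1 <= r]. *)
  pose l := Num.sqrt r / s; have l0 : 0 < l by rewrite divr_gt0.
  have rl : r / l = Num.sqrt r * s.
    by rewrite /l -{1}[r]sqr_sqrtr ?ltW//; field; rewrite !gt_eqF.
  pose c := (Num.sqrt r * s) `^ r * expR (- r) / a `^ r.
  have c0 : 0 <= c by rewrite !mulr_ge0 ?powR_ge0 ?expR_ge0 ?invr_ge0 ?powR_ge0.
  apply: (le_trans (subgauss_tail sg mE c0 (l := l) _)).
    move=> x /= ax.
    have : a `^ r <= \sum_(j < d) `|x j 0| `^ r.
      rewrite -powR_norm_le_lpnorm//; apply: ge0_ler_powR; rewrite ?nnegrE ?lpnorm_ge0 ?ltW//.
    rewrite -[X in X <= _]mul1r -ler_pdivlMr ?powR_gt0// => /le_trans; apply.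
    rewrite /c mulrAC ler_pM2r ?invr_gt0 ?powR_gt0// mulr_sumr; apply: ler_sum => j _.
    rewrite -mulrA -expRD.
    have e1 : `|x j 0| <= Num.sqrt r * s * expR (l * `|x j 0| / r - 1).
      rewrite -rl -ler_pdivrMl ?divr_gt0// invf_div.
      by rewrite mulrAC; have := expR_ge1Dx (l * `|x j 0| / r - 1); lra.
    apply: (le_trans (ge0_ler_powR (ltW r0) _ _ e1)); rewrite ?nnegrE//.
      by rewrite !mulr_ge0 ?expR_ge0 ?sqrtr_ge0 ?(ltW s0).
    rewrite powRM ?expR_ge0 ?mulr_ge0 ?sqrtr_ge0 ?(ltW s0)// -expRM.
    by rewrite le_eqVlt; apply/orP; left; apply/eqP; congr (_ * expR _); field; rewrite gt_eqF.
  rewrite lee_fin.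
  have l2 : l ^+ 2 * s ^+ 2 / 2 = r / 2.
    by rewrite /l exprMn exprVn sqr_sqrtr ?ltW//; field; rewrite gt_eqF.
  have sd0 : 0 < d%:R `^ r^-1 :> R by rewrite powR_gt0// (lt_le_trans ltr01).
  have phiE : phi r%:E d = Num.sqrt r * d%:R `^ r^-1.
    rewrite /phi/= sqrtrM ?ltW// -(@powR12_sqrt _ (d%:R `^ (2 / r))) ?powR_ge0// -powRrM; congr (_ * _ `^ _).
    by field; rewrite gt_eqF.
  pose t := phi r%:E d * s / a.
  have t0 : 0 < t by rewrite /t phiE !mulr_gt0// invr_gt0.
  have t1 : t <= 1 by move: small; rewrite -!mulrA -/t; rewrite /t !mulrA in t0 *; lra.
  have tr : t `^ r <= t by apply: ge1r_powR => //; rewrite t0.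
  apply: (@le_trans _ _ (2 * t `^ r)); last first.
    by rewrite -!mulrA ler_pM2l//; move: tr; rewrite /t !mulrA.
  have -> : t `^ r = d%:R * (Num.sqrt r * s) `^ r / a `^ r.
    rewrite (_ : t = d%:R `^ r^-1 * (Num.sqrt r * s) / a); last by rewrite /t phiE; ring.
    rewrite powRM ?mulr_ge0 ?invr_ge0 ?(ltW sr0) ?(ltW s0) ?(ltW a0) ?(ltW sd0)//.
    rewrite powRM ?mulr_ge0 ?(ltW sr0) ?(ltW s0) ?(ltW sd0)// -powRrM mulVf ?gt_eqF//.
    rewrite powRr1 ?(le_trans _ dR)//; congr (_ * _).
    by rewrite -powR_inv1 ?ltW// -powRrM mulN1r powRN.
  rewrite l2 /c; set u := (_ * s) `^ r; set v := a `^ r.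
  have -> : u * expR (- r) / v * (2 * d%:R * expR (r / 2)) = 2 * (d%:R * u / v) * expR (- (r / 2)).
    rewrite (_ : expR (- (r / 2)) = expR (- r) * expR (r / 2)); first by ring.
    by rewrite -expRD; congr expR; field.
  rewrite ler_piMr ?mulr_ge0 ?invr_ge0 ?powR_ge0//.
  by rewrite -[leRHS]expR0 ler_expR oppr_le0 divr_ge0 ?ltW.
have mE' : measurable ([set x : 'cV[R]_d | exists j, (a < `|x j 0|)%R] : set (mxBorel R d 1)).
  rewrite (_ : mkset _ = \bigcup_(j in [set: 'I_d]) [set x : 'cV[R]_d | (a < `|x j 0|)%R]); last first.
    by apply/seteqP; split=> x /= [j]; [exists j|move=> _ ?; exists j].
  apply: fin_bigcup_measurable => // j _; rewrite -[X in measurable X]setTI.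
  apply: (@measurable_fun_ltr _ (mxBorel R d 1) _ _ (cst a) (fun x => `|(x : 'cV[R]_d) j 0|)) => //.
  by apply: measurableT_comp => //; exact: measurable_coord.
apply: (@le_trans _ _ (mu [set x : 'cV[R]_d | exists j, (a < `|x j 0|)%R])).
  apply: le_measure; rewrite ?inE// => x /= ax; apply: contrapT => nex.
  move: ax; rewrite ltNge => /negP; apply; rewrite lpnormyE; apply/bigmax_leP; split; first exact: ltW.
  by move=> j _; rewrite leNgt; apply/negP => aj; apply: nex; exists j.
apply: (le_trans (subgauss_tail_max sg s0 (ltW a0))); rewrite lee_fin.
have d2 : 0 < 2 * d%:R :> R by rewrite mulr_gt0// (lt_le_trans ltr01).
(* From [ln (1/2) <= - 1/2]. It makes [phi_oo] at least 1, as the last comparison requires. *)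
have ln2d : 2^-1 <= ln (2 * d%:R) :> R.
  apply: (@le_trans _ _ (ln 2)).
    have := @le_ln1Dx R (- 2^-1) ltac:(lra).
    by rewrite (_ : 1 - 2^-1 = 2^-1); [rewrite lnV ?posrE//; lra|field].
  by rewrite ler_ln ?posrE// ler_peMr.
have phi2 : phi +oo d ^+ 2 = 2 * ln (2 * d%:R) :> R by rewrite /phi/= sqr_sqrtr//; lra.
have phi1 : 1 <= phi +oo d :> R.
  by rewrite -(@ler_pXn2r _ 2)// ?nnegrE// expr1n phi2; lra.
rewrite -{1}[2 * d%:R](lnK d2) -expRD (_ : ln _ = phi +oo d ^+ 2 / 2); last by rewrite phi2; field.
move: small phi1 phi0; set L := phi _ _; move=> small phi1 phi0.
pose u := a / s; have u0 : 0 < u by rewrite divr_gt0.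
have uL : 2 * L < u by move: small; rewrite -mulrA -invf_div -/u ltr_pdivrMr// mul1r.
have -> : 2 * L * s / a = 2 * L / u by rewrite /u; field; rewrite !gt_eqF.
have -> : L ^+ 2 / 2 + - a ^+ 2 / (2 * s ^+ 2) = - ((u ^+ 2 - L ^+ 2) / 2).
  by rewrite /u; field; rewrite gt_eqF.
(* The union bound is [exp (- (u^2 - L^2) / 2)], because [2 d = exp (L^2 / 2)]. Since [u > 2 L], at
   most a quarter of [u^2] is lost; then [exp (- y) <= 1 / (1 + y)] brings the comparison with
   [2 L / u] down to a quadratic inequality in [u]. *)
have v0 : 3 / 8 * u ^+ 2 <= (u ^+ 2 - L ^+ 2) / 2 by nra.
have q0 : 0 <= 3 / 8 * u ^+ 2 by apply: mulr_ge0 => //; exact: sqr_ge0.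
have q1 : 0 < 1 + 3 / 8 * u ^+ 2 by rewrite ltr_pwDl.
apply: (@le_trans _ _ (1 + 3 / 8 * u ^+ 2)^-1).
  rewrite expRN lef_pV2 ?posrE ?expR_gt0//.
  by apply: le_trans (expR_ge1Dx _); rewrite lerD2l.
rewrite -[leLHS]mul1r ler_pdivrMr//.
rewrite mulrAC ler_pdivlMr// mul1r.
nra.
Qed.

End subgaussian_tails.

(** * The Cameron-Martin formula and Gaussian moments *)

Section push.
Context d1 d2 {T1 : measurableType d1} {T2 : measurableType d2} {R : realType}.
Variables (P : probability T1 R) (f : T1 -> T2) (mf : measurable_fun setT f).

(** The image measure. The proof of measurability is an argument so that the probability structure
    can be inferred from the term. *)
Definition push (_ : measurable_fun setT f) (A : set T2) : \bar R := P (f @^-1` A).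

Let push0 : push mf set0 = 0%E.
Proof. by rewrite /push preimage_set0 measure0. Qed.

Let push_ge0 A : (0 <= push mf A)%E.
Proof. exact: measure_ge0. Qed.

Let push_sigma_additive : semi_sigma_additive (push mf).
Proof.
exact: (measure_semi_sigma_additive
  (s := measure_function_pushforward__canonical__measure_function_Measure P mf)).
Qed.

HB.instance Definition _ := isMeasure.Build _ _ _ (push mf) push0 push_ge0 push_sigma_additive.

Let pushT : push mf setT = 1%E.
Proof. by rewrite /push preimage_setT probability_setT. Qed.

HB.instance Definition _ := Measure_isProbability.Build _ _ R (push mf) pushT.

Lemma ge0_integral_push (k : T2 -> \bar R) : measurable_fun setT k -> (forall x, 0 <= k x)%E ->
  (\int[push mf]_x k x = \int[P]_x k (f x))%E.
Proof.
move=> mk k0; have := ge0_integral_pushforward mf P measurableT mk (fun x _ => k0 x).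
by rewrite preimage_setT => <-; apply: eq_measure_integral.
Qed.

End push.

Section density.
Local Open Scope ereal_scope.
Context d (T : measurableType d) (R : realType).
Variables (mu nu : {measure set T -> \bar R}) (g : T -> R).
Hypotheses (mg : measurable_fun setT g) (g0 : forall x, (0 <= g x)%R).
Hypothesis nuE : forall A, measurable A -> nu A = \int[mu]_(x in A) (g x)%:E.

Import HBNNSimple.

(** Both sides are limits along the same increasing simple functions, by monotone convergence; on an
    indicator the equality is [nuE]. *)
Lemma ge0_integral_density (f : T -> \bar R) :
  measurable_fun setT f -> (forall x, 0 <= f x) ->
  \int[nu]_x f x = \int[mu]_x (f x * (g x)%:E).
Proof.
move=> mf f0; pose h := nnsfun_approx measurableT mf.
have -> : \int[nu]_x f x = limn (fun n => \int[nu]_x (EFin \o h n) x).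
  rewrite -monotone_convergence//; last 3 first.
  - by move=> n; exact/measurable_EFinP.
  - by move=> n x _; rewrite lee_fin.
  - by move=> x _ a b ab; rewrite lee_fin; exact/lefP/nd_nnsfun_approx.
  by apply: eq_integral => x _; apply/esym/cvg_lim => //; exact: cvg_nnsfun_approx.
have -> : \int[mu]_x (f x * (g x)%:E) = limn (fun n => \int[mu]_x ((h n x)%:E * (g x)%:E)).
  rewrite -monotone_convergence//; last 3 first.
  - by move=> n; apply: emeasurable_funM; exact/measurable_EFinP.
  - by move=> n x _; rewrite mule_ge0 ?lee_fin.
  - move=> x _ a b ab; apply: lee_wpmul2r; first by rewrite lee_fin.
    by rewrite lee_fin; exact/lefP/nd_nnsfun_approx.
  apply: eq_integral => x _; apply/esym/cvg_lim => //; apply: cvgeZr => //.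
  exact: cvg_nnsfun_approx.
congr (limn _); apply/funext => n.
transitivity (\int[nu]_x (\sum_(y \in range (h n)) (y * \1_(h n @^-1` [set y]) x)%:E)).
  by apply: eq_integral => t _; rewrite /= fimfunE -fsumEFin.
rewrite ge0_integral_fsum//; last 2 first.
- by move=> y; apply/measurable_EFinP; exact: measurable_funM.
- by move=> y x _; exact: nnfun_muleindic_ge0.
transitivity (\int[mu]_x (\sum_(y \in range (h n))
    ((y * \1_(h n @^-1` [set y]) x)%:E * (g x)%:E))); last first.
  apply: eq_integral => x _; rewrite -ge0_mule_fsuml; last first.
    by move=> y; exact: nnfun_muleindic_ge0.
  by rewrite fsumEFin // -(fimfunE _ x).
rewrite ge0_integral_fsum//; last 2 first.
- move=> y; apply: emeasurable_funM; last exact/measurable_EFinP.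
  by apply/measurable_EFinP; exact: measurable_funM.
- by move=> y x _; rewrite mule_ge0 ?lee_fin//; exact: nnfun_muleindic_ge0.
apply: eq_fsbigr => r rhn.
have mA : measurable (h n @^-1` [set r]) by exact: measurable_sfunP.
rewrite integralZl_indic_nnsfun//.
have r0 : (0 <= r)%R by move: rhn; rewrite inE => -[x _ <-].
under [RHS]eq_integral do rewrite EFinM -muleA.
rewrite ge0_integralZl ?lee_fin//; last 2 first.
- by apply: emeasurable_funM; apply/measurable_EFinP.
- by move=> x _; rewrite mule_ge0 ?lee_fin.
congr (_ * _); rewrite integral_indic// setIT nuE// [LHS]integral_mkcond.
apply: eq_integral => x _; rewrite patchE indicE.
by case: ifPn => _; rewrite ?mul1e ?mul0e.
Qed.

End density.

Section translation.
Context {R : realType}.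
Local Notation leb := (@lebesgue_measure R).

Lemma lebesgue_measure_shift (c : R) (A : set R) : measurable A ->
  pushforward leb ((fun x => x + c) : measurableTypeR R -> measurableTypeR R) A = leb A.
Proof.
move=> mA.
have mc : measurable_fun setT ((fun x => x + c) : measurableTypeR R -> measurableTypeR R).
  exact: measurable_funD.
pose m : {measure set (measurableTypeR R) -> \bar R} :=
  measure_function_pushforward__canonical__measure_function_Measure leb mc.
apply/esym; apply: (lebesgue_measure_unique (mu := m)) => //= _ [[a b]] _ <-.
rewrite /m/= /pushforward (_ : _ @^-1` _ = `]a - c, b - c]%classic); last first.
  by apply/seteqP; split=> x /=; rewrite !in_itv/= ltrBlDr lerBrDr.
rewrite !lebesgue_measure_itv/= !lte_fin ltrD2r; case: ifP => // _.
by rewrite -!EFinB opprB addrA subrK.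
Qed.

Lemma ge0_integral_shift (c : R) (f : R -> \bar R) :
  measurable_fun setT f -> (forall x, 0 <= f x)%E ->
  (\int[leb]_x f (x + c)%R = \int[leb]_x f x)%E.
Proof.
move=> mf f0.
have mc : measurable_fun setT ((fun x => x + c) : measurableTypeR R -> measurableTypeR R).
  exact: measurable_funD.
have := @ge0_integral_pushforward _ _ _ _ R _ mc leb setT f measurableT mf (fun x _ => f0 x).
rewrite preimage_setT => <-; apply: eq_measure_integral => A mA _.
exact: lebesgue_measure_shift.
Qed.

End translation.

(* gaussf mu a v says that a is N(0, v)-distributed under mu, in the form of the
   Cameron-Martin formula; the case v = 0 is a = 0 almost everywhere. *)
Definition gaussf {R : realType} d {T : measurableType d} (mu : {measure set T -> \bar R})
    (a : T -> R) (v : R) : Prop :=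
  forall (h : R) (f : R -> \bar R), measurable_fun setT f -> (forall x, 0 <= f x)%E ->
  (\int[mu]_x f (a x + v * h)%R = \int[mu]_x (f (a x) * (expR (h * a x - v * h ^+ 2 / 2))%:E))%E.

Section gaussf_base.
Context {R : realType}.

Lemma integral_normal_prob (s : R) (f : R -> \bar R) :
  measurable_fun setT f -> (forall x, 0 <= f x)%E ->
  (\int[normal_prob 0 s]_x f x = \int[lebesgue_measure]_x (f x * (normal_pdf 0 s x)%:E))%E.
Proof.
move=> mf f0; apply: (ge0_integral_density (mu := lebesgue_measure) (nu := normal_prob 0 s)) => //.
- exact: measurable_normal_pdf.
- exact: normal_pdf_ge0.
Qed.

Lemma gaussf_normal (s : R) : s != 0 ->
  gaussf (normal_prob 0 s : {measure set (measurableTypeR R) -> \bar R}) idfun (s ^+ 2).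
Proof.
move=> s0 h f mf f0 /=.
have msh (c : R) : measurable_fun setT (fun x : R => x + c) by exact: measurable_funD.
rewrite integral_normal_prob//; last exact: (measurableT_comp mf).
rewrite integral_normal_prob; last 2 first.
- apply: emeasurable_funM => //; apply/measurable_EFinP; apply: measurableT_comp => //.
  by apply: measurable_funB => //; exact: measurable_funM.
- by move=> x; rewrite mule_ge0// lee_fin expR_ge0.
(* In [k] the translation sits in the density instead of the argument of [f], so that translation
   invariance of Lebesgue measure leaves only a quotient of two Gaussian densities. *)
pose k x := (f x * (normal_pdf 0 s (x - s ^+ 2 * h))%:E)%E.
rewrite [LHS](_ : _ = (\int[lebesgue_measure]_(x in [set: R]) k (x + s ^+ 2 * h)%R)%E); last first.
  by apply: eq_integral => x _; rewrite /k addrK.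
rewrite ge0_integral_shift; last 2 first.
- apply: emeasurable_funM => //; apply/measurable_EFinP.
  by apply: measurableT_comp; [exact: measurable_normal_pdf|exact: msh].
- by move=> x; rewrite mule_ge0// lee_fin normal_pdf_ge0.
apply: eq_integral => x _; rewrite /k -muleA; congr (_ * _)%E; rewrite -EFinM; congr EFin.
rewrite normal_pdfE//= mulrCA; congr (_ * _); rewrite /normal_fun !subr0 -expRD; congr expR.
by field.
Qed.

Lemma gaussf_dirac0 : gaussf (\d_(0 : measurableTypeR R) : {measure set (measurableTypeR R) -> \bar R}) idfun 0.
Proof.
move=> h f mf f0; rewrite !integral_dirac//=; last 2 first.
- apply: emeasurable_funM => //; apply/measurable_EFinP; apply: measurableT_comp => //.
  by apply: measurable_funB => //; exact: measurable_funM.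
- by apply: (measurableT_comp mf); exact: measurable_funD.
by rewrite diracT !mul1e !(mulr0, mul0r, addr0, subr0) expR0 mule1.
Qed.

Lemma gaussf_normal0 d (T : measurableType d) (mu : probability T R) (a : T -> R) v :
  0 <= v -> measurable_fun setT a ->
  (forall B, measurable B -> mu (a @^-1` B) = normal0 v B) -> gaussf mu a v.
Proof.
move=> v0 ma muE h f mf f0.
have ma' : measurable_fun setT (a : T -> measurableTypeR R) := ma.
have mfh : measurable_fun setT (fun x : measurableTypeR R => f (x + v * h)).
  by apply: (measurableT_comp mf); exact: measurable_funD.
have mfe : measurable_fun setT (fun x : measurableTypeR R => f x * (expR (h * x - v * h ^+ 2 / 2))%:E)%E.
  apply: emeasurable_funM => //; apply/measurable_EFinP; apply: measurableT_comp => //.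
  by apply: measurable_funB => //; exact: measurable_funM.
have fe0 x : (0 <= f x * (expR (h * x - v * h ^+ 2 / 2))%:E)%E by rewrite mule_ge0// lee_fin expR_ge0.
rewrite -(ge0_integral_push mu ma' mfh)// -(ge0_integral_push mu ma' mfe)//.
have E (nu : {measure set (measurableTypeR R) -> \bar R}) (k : R -> \bar R) :
    (forall A, measurable A -> normal0 v A = nu A) ->
    (\int[push mu ma']_x k x = \int[nu]_x k x)%E.
  move=> nuE; apply: (@eq_measure_integral _ (measurableTypeR R) R setT nu (push mu ma') k) => A mA _.
  by rewrite -nuE// /= /push muE.
have [vz|vnz] := eqVneq v 0.
  have nuE A : measurable A -> normal0 v A = (\d_(0 : measurableTypeR R) : {measure set (measurableTypeR R) -> \bar R}) A.
    by rewrite /normal0 vz eqxx.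
  rewrite (E _ _ nuE) (E _ _ nuE) vz; exact: gaussf_dirac0.
have nuE A : measurable A -> normal0 v A = (normal_prob 0 (Num.sqrt v) : {measure set (measurableTypeR R) -> \bar R}) A.
  by rewrite /normal0 (negbTE vnz).
rewrite (E _ _ nuE) (E _ _ nuE).
have s0 : Num.sqrt v != 0 by rewrite gt_eqF// sqrtr_gt0 lt_def vnz.
have g := gaussf_normal s0; rewrite sqr_sqrtr// in g; exact: g.
Qed.

End gaussf_base.

Section product_probability.
Context d1 d2 {T1 : measurableType d1} {T2 : measurableType d2} {R : realType}.
Variables (P1 : probability T1 R) (P2 : probability T2 R).

Definition prodp : set (T1 * T2) -> \bar R := (P1 \x P2)%E.

HB.instance Definition _ := Measure.on prodp.

Let prodpT : prodp setT = 1%E.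
Proof.
have -> : 1%E = (P1 setT * P2 setT)%E :> \bar R by rewrite !probability_setT mule1.
by rewrite /prodp -setXTT; exact: product_measure1E.
Qed.

HB.instance Definition _ := Measure_isProbability.Build _ _ R prodp prodpT.

Lemma ge0_integral_prodp (f : T1 * T2 -> \bar R) :
  measurable_fun setT f -> (forall z, 0 <= f z)%E ->
  (\int[prodp]_z f z = \int[P1]_x \int[P2]_y f (x, y))%E.
Proof. by move=> mf f0; exact: fubini_tonelli1. Qed.

Lemma ge0_integral_prodp_swap (f : T1 * T2 -> \bar R) :
  measurable_fun setT f -> (forall z, 0 <= f z)%E ->
  (\int[P1]_x \int[P2]_y f (x, y) = \int[P2]_y \int[P1]_x f (x, y))%E.
Proof. by move=> mf f0; exact: fubini_tonelli. Qed.

End product_probability.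

(** * Derivatives of Gaussian integrals *)

Section real_derivatives.
Context {R : realType}.
Implicit Types (f g : R -> R) (t : R).

Lemma is_derive_mulfun f g t df dg : is_derive t (1 : R) f df -> is_derive t (1 : R) g dg ->
  is_derive t (1 : R) (fun s => f s * g s) (df * g t + f t * dg).
Proof.
move=> hf hg; apply: is_derive_eq (is_deriveM hf hg) _.
by rewrite addrC; congr (_ + _); exact: mulrC.
Qed.

Lemma is_derive_cstfun (c : R) t : is_derive t (1 : R) (fun=> c) 0.
Proof. exact: is_derive_cst. Qed.

Lemma is_derive_idfun t : is_derive t (1 : R) (fun s => s) 1.
Proof. exact: is_derive_id. Qed.

Lemma is_derive_unique f t d1 d2 : is_derive t (1 : R) f d1 -> is_derive t (1 : R) f d2 -> d1 = d2.
Proof. by move=> h1 h2; rewrite -(derive_val (is_derive := h1)) -(derive_val (is_derive := h2)). Qed.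

Lemma measurable_cosR : measurable_fun setT (@cos R).
Proof. by apply: continuous_measurable_fun; exact: continuous_cos. Qed.

Lemma measurable_sinR : measurable_fun setT (@sin R).
Proof. by apply: continuous_measurable_fun; exact: continuous_sin. Qed.

End real_derivatives.

Section derivation_under_integral.
Context {R : realType} d {T : measurableType d} (mu : {measure set T -> \bar R}).

Lemma is_derive_under (f f' : R -> T -> R) (t0 : R) (D : T -> R) :
  (forall t x, is_derive t (1 : R) (f^~ x) (f' t x)) ->
  (forall t, mu.-integrable setT (EFin \o f t)) ->
  mu.-integrable setT (EFin \o D) -> (forall x, 0 <= D x) ->
  (forall t x, `|t - t0| < 1 -> `|f' t x| <= D x) ->
  is_derive t0 (1 : R) (fun t => \int[mu]_x f t x) (\int[mu]_x f' t0 x).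
Proof.
move=> df intf intD D0 fD.
have t0I : (`]t0 - 1, t0 + 1[%classic : set R) t0 by rewrite /= in_itv/=; apply/andP; split; lra.
have der t x : (`]t0 - 1, t0 + 1[%classic : set R) t -> setT x -> derivable (f^~ x) t 1.
  by move=> _ _; exact: (@ex_derive _ _ _ _ _ _ _ (df t x)).
have d1E t x : partial1of2 f t x = f' t x.
  by rewrite partial1of2E (derive_val (is_derive := df t x)).
have ub t x : (`]t0 - 1, t0 + 1[%classic : set R) t -> setT x -> `|partial1of2 f t x| <= D x.
  rewrite /= in_itv/= => /andP[? ?] _; rewrite d1E; apply: fD.
  by rewrite ltr_norml; apply/andP; split; lra.
apply: DeriveDef.
  exact: (derivable_under_integral measurableT t0I (fun t _ => intf t) der D0 intD ub).
rewrite -derive1E (differentiation_under_integral measurableT t0I (fun t _ => intf t) der D0 intD ub).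
by apply: eq_Rintegral => x _; rewrite d1E.
Qed.

End derivation_under_integral.

Section gaussian_functional.
Context {R : realType} d {T : measurableType d} (mu : probability T R).
Variables (a : T -> R) (v : R).
Hypotheses (ma : measurable_fun setT a) (ga : gaussf mu a v).

Lemma measurable_exp_gaussf h : measurable_fun setT (fun x => expR (h * a x)).
Proof. by apply: measurableT_comp => //; exact: measurable_funM. Qed.

(** The Cameron-Martin formula for the constant function 1. *)
Lemma gaussf_mgf h : (\int[mu]_x (expR (h * a x))%:E = (expR (v * h ^+ 2 / 2))%:E)%E.
Proof.
have := ga h (f := cst 1%E) (measurable_cst _) (fun _ => lee01).
have -> : (\int[mu]_x cst 1 (a x + v * h)%R = 1)%E.
  have pT : (mu : {measure set T -> \bar R}) setT = 1%E by exact: probability_setT.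
  by have := integral_cst mu (@measurableT _ T) 1; rewrite pT mule1.
under eq_integral do rewrite mul1e expRD EFinM.
rewrite ge0_integralZr//; last exact/measurable_EFinP/measurable_exp_gaussf.
move=> /(congr1 (fun z => z * (expR (v * h ^+ 2 / 2))%:E)%E).
by rewrite mul1e -muleA -EFinM -expRD addNr expR0 mule1.
Qed.

Lemma integrable_exp_gaussf h : mu.-integrable setT (EFin \o (fun x => expR (h * a x))).
Proof.
apply/integrableP; split; first exact/measurable_EFinP/measurable_exp_gaussf.
under eq_integral do rewrite /= ger0_norm ?expR_ge0//.
by rewrite gaussf_mgf ltry.
Qed.

Lemma le_exp_norm (h x : R) : expR (h * `|x|) <= expR (h * x) + expR (- h * x).
Proof. by case: (ger0P x) => _; rewrite ?mulrN ?mulNr ?lerDl ?lerDr expR_ge0. Qed.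

Lemma integrable_exp_norm h : mu.-integrable setT (EFin \o (fun x => expR (h * `|a x|))).
Proof.
apply: (@le_integrable _ _ _ mu setT _ _ ((EFin \o (fun x => expR (h * a x))) \+ (EFin \o (fun x => expR (- h * a x))))) => //.
- apply/measurable_EFinP; apply: measurableT_comp => //; apply: measurable_funM => //.
  exact: measurableT_comp.
- move=> x _; rewrite /= lee_fin ger0_norm ?expR_ge0// (le_trans (le_exp_norm _ _))//.
  exact: ler_norm.
- by apply: integrableD => //; exact: integrable_exp_gaussf.
Qed.

Lemma exp_norm_dominated (f : T -> R) K h : measurable_fun setT f ->
  (forall x, `|f x| <= K * expR (h * `|a x|)) -> mu.-integrable setT (EFin \o f).
Proof.
move=> mf fK; apply: (@le_integrable _ _ _ mu setT _ _ (fun x => K%:E * (expR (h * `|a x|))%:E)%E) => //.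
- exact/measurable_EFinP.
- move=> x _; rewrite /= lee_fin; apply: (le_trans (fK x)); exact: ler_norm.
- by apply: integrableZl => //; exact: integrable_exp_norm.
Qed.

Lemma integrable_cst_exp_norm K h : 0 <= K ->
  mu.-integrable setT (EFin \o (fun x => K * expR (h * `|a x|))).
Proof.
move=> K0; apply: (exp_norm_dominated (K := K) (h := h)) => [|x].
  apply: measurable_funM => //; apply: measurableT_comp => //; apply: measurable_funM => //.
  exact: measurableT_comp.
by rewrite ger0_norm// mulr_ge0 ?expR_ge0.
Qed.

Lemma gaussf_integral h (f : R -> \bar R) : measurable_fun setT f ->
  (\int[mu]_x f (a x + v * h)%R = \int[mu]_x (f (a x) * (expR (h * a x - v * h ^+ 2 / 2))%:E))%E.
Proof.
move=> mf; rewrite integralE [RHS]integralE; congr (_ - _)%E.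
  transitivity (\int[mu]_x (f ^\+)%E (a x + v * h)%R)%E; first by apply: eq_integral => x _; rewrite ?funeposE ?funenegE.
  rewrite ga//; last exact: measurable_funepos.
  by apply: eq_integral => x _; rewrite !funeposE maxe_pMl ?mul0e// lee_fin expR_ge0.
transitivity (\int[mu]_x (f ^\-)%E (a x + v * h)%R)%E; first by apply: eq_integral => x _; rewrite ?funeposE ?funenegE.
rewrite ga//; last exact: measurable_funeneg.
by apply: eq_integral => x _; rewrite !funenegE -mulNe maxe_pMl ?mul0e// lee_fin expR_ge0.
Qed.

Lemma gaussf_Rintegral h (f : R -> R) : measurable_fun setT f ->
  \int[mu]_x f (a x + v * h) = \int[mu]_x (f (a x) * expR (h * a x - v * h ^+ 2 / 2)).
Proof.
move=> mf; rewrite /Rintegral; have mEf : measurable_fun setT (EFin \o f) by exact/measurable_EFinP.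
rewrite (gaussf_integral h mEf).
by congr fine; apply: eq_integral => x _; rewrite -EFinM.
Qed.

(* psi1 and psi2 are the first two derivatives of psi0 in t: up to scaling, the
   Hermite polynomials times the Cameron-Martin density. *)
Definition psi0 t x := expR (t * a x - v * t ^+ 2 / 2).
Definition psi1 t x := (a x - v * t) * psi0 t x.
Definition psi2 t x := ((a x - v * t) ^+ 2 - v) * psi0 t x.

Lemma is_derive_psi0 t x : is_derive t (1 : R) (psi0^~ x) (psi1 t x).
Proof.
rewrite /psi0 /psi1 mulrC.
apply: (@is_derive1_comp _ expR (fun t => t * a x - v * t ^+ 2 / 2)).
have h1 := is_derive_mulfun (is_derive_idfun t) (is_derive_cstfun (a x) t).
have h2 := is_derive_mulfun (is_derive_cstfun (v / 2) t) (is_derive_mulfun (is_derive_idfun t) (is_derive_idfun t)).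
rewrite (_ : (fun t => _) = (fun t => t * a x) - (fun t => v / 2 * (t * t))); last first.
  by apply/funext => s /=; rewrite !fctE; field.
by apply: is_derive_eq (is_deriveB h1 h2) _; field.
Qed.

Lemma is_derive_psi1 t x : is_derive t (1 : R) (psi1^~ x) (psi2 t x).
Proof.
have h0 := is_derive_psi0 t x.
have h1 : is_derive t (1 : R) (fun t => a x - v * t) (- v).
  have h3 := is_derive_mulfun (is_derive_cstfun v t) (is_derive_idfun t).
  by apply: is_derive_eq (is_deriveB (is_derive_cstfun (a x) t) h3) _; ring.
by apply: is_derive_eq (is_derive_mulfun h1 h0) _; rewrite /psi2 /psi1; ring.
Qed.

Lemma psi0_bound t0 t x : `|t - t0| < 1 -> psi0 t x <= expR (`|v| * (`|t0| + 1) ^+ 2) * expR ((`|t0| + 1) * `|a x|).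
Proof.
move=> tt0; rewrite /psi0 -expRD ler_expR.
have t1 : `|t| <= `|t0| + 1 by rewrite -(subrK t0 t) (le_trans (ler_normD _ _))// addrC lerD2l ltW.
have h1 : t * a x <= (`|t0| + 1) * `|a x|.
  by rewrite (le_trans (ler_norm _))// normrM ler_wpM2r.
have h2 : - (v * t ^+ 2 / 2) <= `|v| * (`|t0| + 1) ^+ 2.
  rewrite (le_trans (ler_norm _))// normrN normrM [`|v * _|]normrM normrX.
  apply: (@le_trans _ _ (`|v| * `|t| ^+ 2)).
    rewrite ler_piMr ?mulr_ge0 ?sqr_ge0// normfV ger0_norm// invf_le1//; lra.
  by rewrite ler_wpM2l// lerXn2r ?nnegrE// addr_ge0.
by rewrite addrC lerD// .
Qed.

(** The polynomial factors have degree at most two in [a], and [|a| <= exp |a|]; this adds 2 to the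
    exponent [|t0| + 1] of [psi0_bound]. Bounds uniform for [t] within 1 of [t0] are what
    differentiation under the integral asks for. *)
Lemma psi12_bound t0 : exists K, 0 <= K /\ forall t x, `|t - t0| < 1 ->
  `|psi1 t x| <= K * expR ((`|t0| + 3) * `|a x|) /\
  `|psi2 t x| <= K * expR ((`|t0| + 3) * `|a x|).
Proof.
pose c := `|t0| + 1; pose m := 1 + `|v| * c.
pose K0 := expR (`|v| * c ^+ 2).
have c0 : 0 <= c by rewrite addr_ge0.
have m1 : 1 <= m by rewrite lerDl mulr_ge0.
exists ((m ^+ 2 + `|v|) * K0); split.
  by rewrite mulr_ge0 ?expR_ge0// addr_ge0// sqr_ge0.
move=> t x tt0.
have t1 : `|t| <= c by rewrite -(subrK t0 t) (le_trans (ler_normD _ _))// addrC lerD2l ltW.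
have p0 := psi0_bound x tt0; rewrite -/c -/K0 in p0.
have p00 : 0 <= psi0 t x by exact: expR_ge0.
pose E := expR `|a x|.
have E1 : 1 <= E by rewrite -expR0 ler_expR.
have aE : `|a x| <= E by apply: le_trans (expR_ge1Dx _); rewrite lerDr.
have h1 : `|a x - v * t| <= m * E.
  rewrite (le_trans (ler_normB _ _))// normrM /m mulrDl mul1r lerD//.
  apply: (@le_trans _ _ (`|v| * c)); first by rewrite ler_wpM2l.
  by rewrite ler_peMr// mulr_ge0.
have expE : expR ((`|t0| + 3) * `|a x|) = E ^+ 2 * expR (c * `|a x|).
  by rewrite -expRM_natl -expRD /c; congr expR; ring.
have b0 : psi0 t x <= K0 * expR (c * `|a x|) by [].
have W0 : 0 <= K0 * expR (c * `|a x|) by rewrite mulr_ge0 ?expR_ge0.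
have EE : E <= E ^+ 2 by rewrite expr2 ler_peMl// (le_trans ler01).
have q1 : `|a x - v * t| <= (m ^+ 2 + `|v|) * E ^+ 2.
  apply: (le_trans h1); apply: ler_pM => //; rewrite ?(le_trans ler01)//.
  by rewrite (@le_trans _ _ (m ^+ 2))// ?lerDl// expr2 ler_peMl// (le_trans ler01).
have q2 : `|(a x - v * t) ^+ 2 - v| <= (m ^+ 2 + `|v|) * E ^+ 2.
  rewrite (le_trans (ler_normB _ _))// normrX mulrDl lerD//.
    rewrite -exprMn lerXn2r ?nnegrE// mulr_ge0// (le_trans ler01)//.
  by rewrite ler_peMr// (le_trans E1).
rewrite expE; split.
  rewrite /psi1 normrM (ger0_norm p00).
  rewrite (_ : _ * K0 * _ = ((m ^+ 2 + `|v|) * E ^+ 2) * (K0 * expR (c * `|a x|))); last by ring.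
  exact: ler_pM.
rewrite /psi2 normrM (ger0_norm p00).
rewrite (_ : _ * K0 * _ = ((m ^+ 2 + `|v|) * E ^+ 2) * (K0 * expR (c * `|a x|))); last by ring.
exact: ler_pM.
Qed.

Lemma measurable_psi0 t : measurable_fun setT (psi0 t).
Proof.
apply: measurableT_comp => //; apply: measurable_funB => //.
exact: measurable_funM.
Qed.

Lemma measurable_psi1 t : measurable_fun setT (psi1 t).
Proof. by apply: measurable_funM; [exact: measurable_funB|exact: measurable_psi0]. Qed.

Variable (G : T -> R).
Hypotheses (mG : measurable_fun setT G) (G1 : forall x, `|G x| <= 1).

Lemma integrable_Gpsi0 t : mu.-integrable setT (EFin \o (fun x => G x * psi0 t x)).
Proof.
apply: (exp_norm_dominated (K := expR (`|v| * (`|t| + 1) ^+ 2)) (h := `|t| + 1)).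
  by apply: measurable_funM => //; exact: measurable_psi0.
move=> x; rewrite normrM -[leRHS]mul1r ler_pM//.
rewrite ger0_norm ?expR_ge0//; apply: psi0_bound; by rewrite subrr normr0.
Qed.

Lemma integrable_Gpsi1 t : mu.-integrable setT (EFin \o (fun x => G x * psi1 t x)).
Proof.
have [K [K0 KP]] := psi12_bound t.
apply: (exp_norm_dominated (K := K) (h := `|t| + 3)).
  by apply: measurable_funM => //; exact: measurable_psi1.
move=> x; rewrite normrM -[leRHS]mul1r ler_pM//.
by apply: (KP t x _).1; rewrite subrr normr0.
Qed.

(** [G] is merely bounded and measurable: the parameter occurs only in the Cameron-Martin density,
    and every derivative falls there. *)
Lemma is_derive_Phi0 t : is_derive t (1 : R)
  (fun t => \int[mu]_x (G x * psi0 t x)) (\int[mu]_x (G x * psi1 t x)).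
Proof.
have [K [K0 KP]] := psi12_bound t.
apply: (@is_derive_under R d T mu (fun s x => G x * psi0 s x) (fun s x => G x * psi1 s x) t (fun x => K * expR ((`|t| + 3) * `|a x|))).
- move=> s x; by apply: is_derive_eq (is_derive_mulfun (is_derive_cstfun (G x) s) (is_derive_psi0 s x)) _; ring.
- exact: integrable_Gpsi0.
- exact: integrable_cst_exp_norm.
- by move=> x; rewrite mulr_ge0 ?expR_ge0.
- move=> s x st; rewrite normrM -[leRHS]mul1r ler_pM//.
  exact: (KP s x st).1.
Qed.

Lemma is_derive_Phi1 t : is_derive t (1 : R)
  (fun t => \int[mu]_x (G x * psi1 t x)) (\int[mu]_x (G x * psi2 t x)).
Proof.
have [K [K0 KP]] := psi12_bound t.
apply: (@is_derive_under R d T mu (fun s x => G x * psi1 s x) (fun s x => G x * psi2 s x) t (fun x => K * expR ((`|t| + 3) * `|a x|))).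
- move=> s x; by apply: is_derive_eq (is_derive_mulfun (is_derive_cstfun (G x) s) (is_derive_psi1 s x)) _; ring.
- exact: integrable_Gpsi1.
- exact: integrable_cst_exp_norm.
- by move=> x; rewrite mulr_ge0 ?expR_ge0.
- move=> s x st; rewrite normrM -[leRHS]mul1r ler_pM//.
  exact: (KP s x st).2.
Qed.

End gaussian_functional.

Section gaussian_moments.
Context {R : realType} d {T : measurableType d} (mu : probability T R).
Variables (a : T -> R) (v : R).
Hypotheses (ma : measurable_fun setT a) (ga : gaussf mu a v).

Let one1 (x : T) : `|(cst 1 : T -> R) x| <= 1. Proof. by rewrite normr1. Qed.

Lemma Rintegral_psi0 t : \int[mu]_x (cst 1 x * psi0 a v t x) = 1.
Proof.
have := gaussf_Rintegral ga t (f := cst 1) (measurable_cst _).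
have pT : (mu : {measure set T -> \bar R}) setT = 1%E by exact: probability_setT.
rewrite (_ : (fun x => cst 1 (a x + v * t)) = cst 1)// Rintegral_cst// pT/= mulr1 => h.
by rewrite [RHS]h; apply: eq_Rintegral => x _.
Qed.

(** The integral of [psi0] is 1 for every [t], so its successive derivatives vanish; at [t = 0] they
    give the mean and the variance. *)
Lemma gaussf_psi1 t : \int[mu]_x (cst 1 x * psi1 a v t x) = 0.
Proof.
apply: (is_derive_unique (is_derive_Phi0 ma ga (measurable_cst (1 : R)) one1 t)).
rewrite (_ : (fun t => _) = fun=> 1); first exact: is_derive_cstfun.
by apply/funext => s; exact: Rintegral_psi0.
Qed.

Lemma gaussf_mean : \int[mu]_x a x = 0.
Proof.
rewrite -(gaussf_psi1 0); apply: eq_Rintegral => x _.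
by rewrite /psi1 /psi0 /cst mul0r !mulr0 expr0n/= mulr0 mul0r !subr0 expR0 mulr1 mul1r.
Qed.

Lemma gaussf_var_centered : \int[mu]_x (a x ^+ 2 - v) = 0.
Proof.
have h : \int[mu]_x (cst 1 x * psi2 a v 0 x) = 0.
  apply: (is_derive_unique (is_derive_Phi1 ma ga (measurable_cst (1 : R)) one1 0)).
  rewrite (_ : (fun t => _) = fun=> 0); first exact: is_derive_cstfun.
  by apply/funext => s; exact: gaussf_psi1.
rewrite -h; apply: eq_Rintegral => x _.
by rewrite /psi2 /psi0 /cst mul0r !mulr0 expr0n/= mulr0 mul0r !subr0 expR0 mulr1 mul1r.
Qed.

Lemma integrable_gaussf : mu.-integrable setT (EFin \o a).
Proof.
apply: (exp_norm_dominated ma ga (K := 1) (h := 1)) => // x.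
by rewrite !mul1r; apply: le_trans (expR_ge1Dx _); rewrite lerDr.
Qed.

Lemma integrable_gaussf_sqr : mu.-integrable setT (EFin \o (fun x => a x ^+ 2)).
Proof.
apply: (exp_norm_dominated ma ga (K := 1) (h := 2)); first exact: measurable_funX.
move=> x; rewrite mul1r normrX expRM_natl lerXn2r ?nnegrE ?expR_ge0//.
by apply: le_trans (expR_ge1Dx _); rewrite lerDr.
Qed.

Lemma gaussf_var : \int[mu]_x (a x ^+ 2) = v.
Proof.
have pT : (mu : {measure set T -> \bar R}) setT = 1%E by exact: probability_setT.
have := gaussf_var_centered; rewrite RintegralB//; last 2 first.
- exact: integrable_gaussf_sqr.
- by apply: finite_measure_integrable_cst.
by rewrite Rintegral_cst// pT/= mulr1 => /eqP; rewrite subr_eq0 => /eqP.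
Qed.

Let bounded_integrable (f : T -> R) : measurable_fun setT f -> (forall x, `|f x| <= 1) ->
  mu.-integrable setT (EFin \o f).
Proof.
move=> mf f1; apply: (exp_norm_dominated ma ga (K := 1) (h := 0)) => // x.
by rewrite mul0r expR0 mulr1.
Qed.

Let C t := \int[mu]_x cos (t * a x).
Let S t := \int[mu]_x sin (t * a x).

Let mta t : measurable_fun setT (fun x => t * a x). Proof. exact: measurable_funM. Qed.

Let mcos t : measurable_fun setT (fun x => cos (t * a x)).
Proof. by apply: (measurableT_comp (f := @cos R)) => //; exact: measurable_cosR. Qed.

Let msin t : measurable_fun setT (fun x => sin (t * a x)).
Proof. by apply: (measurableT_comp (f := @sin R)) => //; exact: measurable_sinR. Qed.

Let cos_le1 (y : R) : `|cos y| <= 1. Proof. by rewrite ler_norml cos_geN1 cos_le1. Qed.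
Let sin_le1 (y : R) : `|sin y| <= 1. Proof. by rewrite ler_norml sin_geN1 sin_le1. Qed.

Let is_derive_C0 t : is_derive t (1 : R) C (\int[mu]_x (- sin (t * a x) * a x)).
Proof.
apply: (@is_derive_under R d T mu (fun s x => cos (s * a x)) (fun s x => - sin (s * a x) * a x) t (fun x => `|a x|)) => //.
- move=> s x; apply: (@is_derive1_comp _ (@cos R) (fun s => s * a x)).
  by apply: is_derive_eq (is_derive_mulfun (is_derive_idfun s) (is_derive_cstfun (a x) s)) _; ring.
- by move=> s; apply: bounded_integrable.
- exact: integrable_norm integrable_gaussf.
- by move=> s x _; rewrite normrM normrN -[leRHS]mul1r ler_wpM2r.
Qed.

Let is_derive_S0 t : is_derive t (1 : R) S (\int[mu]_x (cos (t * a x) * a x)).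
Proof.
apply: (@is_derive_under R d T mu (fun s x => sin (s * a x)) (fun s x => cos (s * a x) * a x) t (fun x => `|a x|)) => //.
- move=> s x; apply: (@is_derive1_comp _ (@sin R) (fun s => s * a x)).
  by apply: is_derive_eq (is_derive_mulfun (is_derive_idfun s) (is_derive_cstfun (a x) s)) _; ring.
- by move=> s; apply: bounded_integrable.
- exact: integrable_norm integrable_gaussf.
- by move=> s x _; rewrite normrM -[leRHS]mul1r ler_wpM2r.
Qed.

(* Stein's identity, by differentiating the Cameron-Martin formula at h = 0. *)
Let stein (f : R -> R) (A B t : R) : measurable_fun setT f -> (forall y, `|f y| <= 1) ->
  (forall s, \int[mu]_x f (t * (a x + v * s)) = A * cos (s * (t * v)) + B * sin (s * (t * v))) ->
  \int[mu]_x (f (t * a x) * a x) = t * v * B.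
Proof.
move=> mf f1 fE.
have mft : measurable_fun setT (fun y : R => f (t * y)).
  by apply: (measurableT_comp mf); exact: measurable_funM.
have mfa : measurable_fun setT (fun x => f (t * a x)) by exact: (measurableT_comp mft).
have h := is_derive_Phi0 ma ga mfa (fun x => f1 _) 0.
have e1 : \int[mu]_x (f (t * a x) * psi1 a v 0 x) = \int[mu]_x (f (t * a x) * a x).
  apply: eq_Rintegral => x _.
  by rewrite /psi1 /psi0 mul0r !mulr0 expr0n/= mulr0 mul0r !subr0 expR0 mulr1.
rewrite -e1; apply: (is_derive_unique h).
rewrite (_ : (fun s => _) = (fun s => A * cos (s * (t * v))) + (fun s => B * sin (s * (t * v)))); last first.
  by apply/funext => s /=; rewrite !fctE -fE -(gaussf_Rintegral ga s mft).
have d1 : is_derive (0 : R) (1 : R) (fun s => s * (t * v)) (t * v).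
  by apply: is_derive_eq (is_derive_mulfun (is_derive_idfun 0) (is_derive_cstfun (t * v) 0)) _; ring.
have d2 := @is_derive1_comp _ (@cos R) _ _ _ _ (is_derive_cos _) d1.
have d3 := @is_derive1_comp _ (@sin R) _ _ _ _ (is_derive_sin _) d1.
apply: is_derive_eq (is_deriveD (is_derive_mulfun (is_derive_cstfun A 0) d2) (is_derive_mulfun (is_derive_cstfun B 0) d3)) _.
by rewrite !mul0r sin0 cos0; ring.
Qed.

Let stein_cos t : \int[mu]_x (cos (t * a x) * a x) = t * v * - S t.
Proof.
apply: (stein (A := C t)) => // [|s]; first exact: measurable_cosR.
have e : t * (v * s) = s * (t * v) by ring.
under eq_Rintegral do rewrite mulrDr cosD e.
rewrite RintegralB//; last 2 first.
- by apply: bounded_integrable => [|x]; [exact: measurable_funM|rewrite normrM -[leRHS]mulr1 ler_pM].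
- by apply: bounded_integrable => [|x]; [exact: measurable_funM|rewrite normrM -[leRHS]mulr1 ler_pM].
rewrite !RintegralZr//; [|exact: bounded_integrable..].
by rewrite mulNr.
Qed.

Let stein_sin t : \int[mu]_x (sin (t * a x) * a x) = t * v * C t.
Proof.
apply: (stein (A := S t)) => // [|s]; first exact: measurable_sinR.
have e : t * (v * s) = s * (t * v) by ring.
under eq_Rintegral do rewrite mulrDr sinD e.
rewrite RintegralD//; last 2 first.
- by apply: bounded_integrable => [|x]; [exact: measurable_funM|rewrite normrM -[leRHS]mulr1 ler_pM].
- by apply: bounded_integrable => [|x]; [exact: measurable_funM|rewrite normrM -[leRHS]mulr1 ler_pM].
by rewrite !RintegralZr//; exact: bounded_integrable.
Qed.

(** The product of [F] with [exp (v t^2 / 2)] has derivative zero. *)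
Let ode (F : R -> R) : (forall t, is_derive t (1 : R) F (- (t * v * F t))) ->
  forall t, F t = F 0 * expR (- (v * t ^+ 2 / 2)).
Proof.
move=> dF t; pose E (t : R) := expR (v / 2 * (t * t)).
have dE s : is_derive s (1 : R) E (v * s * E s).
  rewrite mulrC; apply: (@is_derive1_comp _ expR (fun s => v / 2 * (s * s))).
  apply: is_derive_eq (is_derive_mulfun (is_derive_cstfun (v / 2) s) (is_derive_mulfun (is_derive_idfun s) (is_derive_idfun s))) _.
  by field.
have h : (fun s => F s * E s) t = (fun s => F s * E s) 0.
  apply: (@is_derive_0_is_cst _ (fun s => F s * E s)) => s.
  by apply: is_derive_eq (is_derive_mulfun (dF s) (dE s)) _; ring.
move: h; rewrite /E !mulr0 expR0 mulr1 => <-; rewrite -mulrA -expRD.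
by rewrite (_ : _ + _ = 0) ?expR0 ?mulr1//; field.
Qed.

(** Differentiation produces the integral of [- sin (t a) a], which Stein's identity turns into
    [- t v] times the original integral. *)
Lemma gaussf_cos t : \int[mu]_x cos (t * a x) = expR (- (v * t ^+ 2 / 2)).
Proof.
have pT : (mu : {measure set T -> \bar R}) setT = 1%E by exact: probability_setT.
have h : forall t, is_derive t (1 : R) C (- (t * v * C t)).
  move=> s; apply: is_derive_eq (is_derive_C0 s) _.
  rewrite -stein_sin -mulN1r -RintegralZl//.
    by apply: eq_Rintegral => x _; ring.
  apply: (@le_integrable _ _ _ mu setT _ _ (EFin \o a)) => //; last exact: integrable_gaussf.
    by apply/measurable_EFinP; exact: measurable_funM.
  by move=> x _; rewrite /= lee_fin normrM -[leRHS]mul1r ler_wpM2r.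
rewrite -/(C t) (ode h) /C; under eq_Rintegral do rewrite mul0r cos0.
by rewrite Rintegral_cst// pT/= mulr1 mul1r.
Qed.

Lemma gaussf_sin t : \int[mu]_x sin (t * a x) = 0.
Proof.
have h : forall t, is_derive t (1 : R) S (- (t * v * S t)).
  by move=> s; apply: is_derive_eq (is_derive_S0 s) _; rewrite stein_cos mulrN.
rewrite -/(S t) (ode h) /S; under eq_Rintegral do rewrite mul0r sin0.
by rewrite Rintegral_cst// mul0r mul0r.
Qed.

End gaussian_moments.

(** * The standard Gaussian law and the Cramer-Wold theorem *)

Section parametric_integrals.
Context d1 d2 {T1 : measurableType d1} {T2 : measurableType d2} {R : realType}.
Variable (P : probability T2 R).

Lemma ge0_measurable_integral_param (f : T1 -> T2 -> \bar R) :
  measurable_fun setT (fun z => f z.1 z.2) -> (forall x y, 0 <= f x y)%E ->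
  measurable_fun setT (fun x => \int[P]_y f x y)%E.
Proof.
move=> mf f0.
exact: (@measurable_fun_fubini_tonelli_F _ _ T1 T2 R P (fun z => f z.1 z.2) mf (fun z => f0 _ _)).
Qed.

Lemma measurable_Rintegral_param (f : T1 -> T2 -> R) :
  measurable_fun setT (fun z => f z.1 z.2) ->
  measurable_fun setT (fun x => \int[P]_y f x y).
Proof.
move=> mf; rewrite /Rintegral; apply: (measurableT_comp (fine_measurable measurableT)).
have mE : measurable_fun setT (fun z : T1 * T2 => (f z.1 z.2)%:E) by exact/measurable_EFinP.
under eq_fun do rewrite integralE.
apply: emeasurable_funB.
  apply: (ge0_measurable_integral_param (f := fun x y => (fun y => (f x y)%:E)^\+ y)%E) => //=.
  have := measurable_funepos mE; apply: eq_measurable_fun => z _.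
  by rewrite !funeposE.
apply: (ge0_measurable_integral_param (f := fun x y => (fun y => (f x y)%:E)^\- y)%E) => //=.
have := measurable_funeneg mE; apply: eq_measurable_fun => z _.
by rewrite !funenegE.
Qed.

End parametric_integrals.

Section gaussf_operations.
Context {R : realType}.

Lemma gaussf_push d1 d2 {T1 : measurableType d1} {T2 : measurableType d2}
  (P : probability T1 R) (g : T1 -> T2) (mg : measurable_fun setT g) (a : T2 -> R) v :
  measurable_fun setT a ->
  gaussf P (a \o g) v -> gaussf (push P mg) a v.
Proof.
move=> ma ga h f mf f0; have := ga h f mf f0.
rewrite (ge0_integral_push P mg (k := fun x => f (a x + v * h))); last 2 first.
- by apply: (measurableT_comp mf); exact: measurable_funD.
- by [].
rewrite (ge0_integral_push P mg) //.
- apply: emeasurable_funM; first exact: (measurableT_comp mf).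
  apply/measurable_EFinP; apply: measurableT_comp => //.
  by apply: measurable_funB => //; exact: measurable_funM.
- by move=> x; rewrite mule_ge0// lee_fin expR_ge0.
Qed.

(** The formula is applied in the second variable with the first fixed, then in the first after an
    exchange by Tonelli; the two exponential weights multiply to the one for [v1 + v2]. *)
Lemma gaussf_prodp d1 d2 {T1 : measurableType d1} {T2 : measurableType d2}
  (P1 : probability T1 R) (P2 : probability T2 R) (a : T1 -> R) (b : T2 -> R) v1 v2 :
  measurable_fun setT a -> measurable_fun setT b ->
  gaussf P1 a v1 -> gaussf P2 b v2 ->
  gaussf (prodp P1 P2) (fun z => a z.1 + b z.2) (v1 + v2).
Proof.
move=> ma mb ga gb h f mf f0.
have ma1 : measurable_fun setT (fun z : T1 * T2 => a z.1) by exact: measurableT_comp.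
have mb1 : measurable_fun setT (fun z : T1 * T2 => b z.2) by exact: measurableT_comp.
have mab : measurable_fun setT (fun z : T1 * T2 => a z.1 + b z.2) by exact: measurable_funD.
have me (c w : R) : measurable_fun setT (fun y : R => expR (h * y - c * w / 2)).
  by apply: measurableT_comp => //; apply: measurable_funB => //; exact: measurable_funM.
have mfD (c : R) : measurable_fun setT (fun y : R => f (y + c)).
  by apply: (measurableT_comp mf); exact: measurable_funD.
have mfD' (c : R) : measurable_fun setT (fun y : R => f (c + y)).
  by apply: (measurableT_comp mf); exact: measurable_funD.
have e2 (y : T2) : (\int[P1]_x f (a x + b y + v1 * h)%R = \int[P1]_x (f (a x + b y)%R * (expR (h * a x - v1 * h ^+ 2 / 2))%:E))%E.
  rewrite -(ga h (fun t => f (t + b y)%R))//.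
  by apply: eq_integral => x _; congr f; ring.
have e1 (x : T1) : (\int[P2]_y f (a x + b y + (v1 + v2) * h)%R = \int[P2]_y (f (a x + b y + v1 * h)%R * (expR (h * b y - v2 * h ^+ 2 / 2))%:E))%E.
  have m : measurable_fun setT (fun t : R => f (a x + t + v1 * h)).
    by apply: (measurableT_comp mf); apply: measurable_funD => //; exact: measurable_funD.
  rewrite -(gb h (fun t => f (a x + t + v1 * h)%R))//.
  by apply: eq_integral => y _; congr f; ring.
rewrite ge0_integral_prodp//; last exact: (measurableT_comp (mfD _)).
rewrite ge0_integral_prodp//; last 2 first.
- apply: emeasurable_funM; first exact: (measurableT_comp mf).
  by apply/measurable_EFinP; exact: (measurableT_comp (me (v1 + v2) _)).
- by move=> z; rewrite mule_ge0// lee_fin expR_ge0.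
under eq_integral do rewrite e1.
rewrite (ge0_integral_prodp_swap P1 P2 (f := fun z => (f (a z.1 + b z.2 + v1 * h)%R * (expR (h * b z.2 - v2 * h ^+ 2 / 2))%:E)%E)); last 2 first.
- apply: emeasurable_funM; first exact: (measurableT_comp (mfD _)).
  by apply/measurable_EFinP; exact: (measurableT_comp (me v2 _)).
- by move=> z; rewrite mule_ge0// lee_fin expR_ge0.
rewrite (ge0_integral_prodp_swap P1 P2 (f := fun z => (f (a z.1 + b z.2)%R * (expR (h * (a z.1 + b z.2) - (v1 + v2) * h ^+ 2 / 2))%:E)%E)); last 2 first.
- apply: emeasurable_funM; first exact: (measurableT_comp mf).
  by apply/measurable_EFinP; exact: (measurableT_comp (me (v1 + v2) _)).
- by move=> z; rewrite mule_ge0// lee_fin expR_ge0.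
apply: eq_integral => y _ /=.
have mfa c : measurable_fun setT (fun x => f (a x + b y + c)%R).
  by apply: (measurableT_comp (mfD _)); exact: measurable_funD.
have mfa0 : measurable_fun setT (fun x => f (a x + b y)%R).
  by apply: (measurableT_comp (mfD _)).
rewrite ge0_integralZr//.
rewrite e2 -ge0_integralZr//; last first.
- by move=> x _; rewrite mule_ge0// lee_fin expR_ge0.
- by apply: emeasurable_funM => //; apply/measurable_EFinP; exact: (measurableT_comp (me v1 _)).
apply: eq_integral => x _; rewrite -muleA -EFinM -expRD; congr (_ * (expR _)%:E)%E; ring.
Qed.

End gaussf_operations.

Section standard_gaussian.
Context {R : realType}.

(* The Cameron-Martin formula, which characterises N(0, I). *)
Definition cameron_martin d (mu : {measure set (mxBorel R d 1) -> \bar R}) : Prop :=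
  forall (s : 'cV[R]_d) (f : 'cV[R]_d -> \bar R),
    measurable_fun setT (f : mxBorel R d 1 -> \bar R) -> (forall x, 0 <= f x)%E ->
  (\int[mu]_x f (x + s)%R = \int[mu]_x (f x * (expR (dotv s x - dotv s s / 2))%:E))%E.

Lemma measurable_dotv d (s : 'cV[R]_d) : measurable_fun setT (dotv s : mxBorel R d 1 -> R).
Proof.
rewrite (_ : dotv s = fun x => \sum_i s i 0 * x i 0); last by apply/funext => x; rewrite dotvE.
by apply: measurable_sum => i; apply: measurable_funM => //; exact: measurable_coord.
Qed.

Lemma measurable_cm_density d (s : 'cV[R]_d) :
  measurable_fun setT (fun x : mxBorel R d 1 => (expR (dotv s x - dotv s s / 2))%:E).
Proof.
apply/measurable_EFinP; apply: measurableT_comp => //.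
by apply: measurable_funB => //; exact: measurable_dotv.
Qed.

Lemma measurable_addv d (s : 'cV[R]_d) :
  measurable_fun setT ((fun x => (x : 'cV[R]_d) + s) : mxBorel R d 1 -> mxBorel R d 1).
Proof. by apply: measurable_addmx; [exact: measurable_id|exact: measurable_cst]. Qed.

Let consv d (z : measurableTypeR R * mxBorel R d 1) : mxBorel R d.+1 1 :=
  \col_i (if unlift ord0 i is Some j then (z.2 : 'cV[R]_d) j 0 else z.1).

Let measurable_consv d : measurable_fun setT (@consv d).
Proof.
apply: measurable_mxP => i j; rewrite !ord1 /consv; under eq_fun do rewrite mxE.
case: (unlift ord0 i) => [k|]; last exact: measurable_fst.
exact: (measurableT_comp (@measurable_coord R d 1 k 0) (@measurable_snd _ _ (measurableTypeR R) (mxBorel R d 1))).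
Qed.

Let dotv_consv d (s : 'cV[R]_d.+1) z : dotv s (consv z) =
  s ord0 0 * z.1 + dotv (\col_j s (lift ord0 j) 0) z.2.
Proof.
rewrite !dotvE big_ord_recl /consv mxE unlift_none; congr (_ + _).
by apply: eq_bigr => i _; rewrite !mxE liftK.
Qed.

(** By induction on the dimension: the product of N(0, 1) with the law in dimension [d] is carried
    to columns of length [d + 1], and the shift splits into its first entry and the rest. In
    dimension 0 the law is a point mass. *)
Lemma cameron_martin_ex d : exists mu : probability (mxBorel R d 1) R, cameron_martin mu.
Proof.
elim: d => [|d [mu cm]].
  exists (\d_(0 : mxBorel R 0 1) : probability _ _) => s f mf f0.
  rewrite !integral_dirac//; last 2 first.
  - by apply: emeasurable_funM => //; exact: measurable_cm_density.
  - by apply: (measurableT_comp mf); exact: measurable_addv.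
  rewrite !dotvE !big_ord0 mul0r subr0 expR0 mule1; congr (_ * f _)%E.
  by apply/matrixP => -[].
exists (push (prodp (normal_prob 0 1 : probability (measurableTypeR R) R) mu) (@measurable_consv d)).
move=> s f mf f0.
pose s0 := s ord0 0; pose s1 : 'cV[R]_d := \col_j s (lift ord0 j) 0.
have cD x y : consv (x, y) + s = consv (x + s0, (y : 'cV[R]_d) + s1).
  apply/matrixP => i j; rewrite ord1 !mxE; case: unliftP => [k ->|->] //=.
  by rewrite !mxE.
have ss : dotv s s = s0 ^+ 2 + dotv s1 s1.
  by rewrite !dotvE big_ord_recl; congr (_ + _); apply: eq_bigr => i _; rewrite !mxE.
have mfs : measurable_fun setT (fun x : mxBorel R d.+1 1 => f ((x : 'cV[R]_d.+1) + s)).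
  by apply: (measurableT_comp mf); exact: measurable_addv.
have mfe : measurable_fun setT (fun x : mxBorel R d.+1 1 => (f x * (expR (dotv s x - dotv s s / 2))%:E)%E).
  by apply: emeasurable_funM => //; exact: measurable_cm_density.
have mfc : measurable_fun setT (fun z => f (consv z)).
  by apply: (measurableT_comp mf); exact: measurable_consv.
rewrite ge0_integral_push// ge0_integral_push//; last first.
  by move=> x; rewrite mule_ge0// lee_fin expR_ge0.
rewrite ge0_integral_prodp//; last by apply: (measurableT_comp mfs); exact: measurable_consv.
rewrite ge0_integral_prodp//; last 2 first.
- by apply: (measurableT_comp mfe); exact: measurable_consv.
- by move=> x; rewrite mule_ge0// lee_fin expR_ge0.
pose k (x : R) := (\int[mu]_y (f (consv (x, y)) * (expR (dotv s1 y - dotv s1 s1 / 2))%:E))%E.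
have mk : measurable_fun setT k.
  apply: (ge0_measurable_integral_param (T1 := measurableTypeR R) mu
    (f := fun x y => (f (consv (x, y)) * (expR (dotv s1 y - dotv s1 s1 / 2))%:E)%E)).
    apply: emeasurable_funM.
      by apply: (eq_measurable_fun _ _ mfc) => -[].
    exact: (measurableT_comp (measurable_cm_density s1) (@measurable_snd _ _ (measurableTypeR R) (mxBorel R d 1))).
  by move=> x y; rewrite mule_ge0// lee_fin expR_ge0.
have k0 x : (0 <= k x)%E by apply: integral_ge0 => y _; rewrite mule_ge0// lee_fin expR_ge0.
have := gaussf_normal (oner_neq0 R) s0 mk k0.
have mfx x : measurable_fun setT (fun y : mxBorel R d 1 => f (consv (x, y))).
  by apply: (measurableT_comp mfc); exact: pair1_measurable.
rewrite expr1n [X in X = _ -> _](_ : _ = (\int[normal_prob 0 1]_x \int[mu]_y f ((consv (x, y) : 'cV[R]_d.+1) + s)%R)%E); last first.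
  apply: eq_integral => x _; rewrite /k mul1r.
  rewrite -(cm s1 (fun y => f (consv (x + s0, y))))//.
  by apply: eq_integral => y _; rewrite cD.
move=> ->; apply: eq_integral => x _.
rewrite /k -ge0_integralZr//; last 2 first.
- by apply: emeasurable_funM => //; exact: measurable_cm_density.
- by move=> y _; rewrite mule_ge0// lee_fin expR_ge0.
apply: eq_integral => y _; rewrite -muleA -EFinM -expRD; congr (_ * (expR _)%:E)%E.
by rewrite ss dotv_consv /= -/s0 -/s1; ring.
Qed.

Definition stdgauss d : probability (mxBorel R d 1) R := projT1 (cid (cameron_martin_ex d)).

Lemma stdgaussP d : cameron_martin (stdgauss d).
Proof. exact: (projT2 (cid (cameron_martin_ex d))). Qed.

Lemma stdgauss_cm_integral d (s : 'cV[R]_d) (f : 'cV[R]_d -> R) :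
    measurable_fun setT (f : mxBorel R d 1 -> R) ->
  \int[stdgauss d]_x f (x + s) = \int[stdgauss d]_x (f x * expR (dotv s x - dotv s s / 2)).
Proof.
move=> mf; rewrite /Rintegral; congr fine.
have mEf : measurable_fun setT (EFin \o f : mxBorel R d 1 -> \bar R) by exact/measurable_EFinP.
rewrite integralE [RHS]integralE; congr (_ - _)%E.
  transitivity (\int[stdgauss d]_x (EFin \o f)^\+%E (x + s)%R)%E.
    by apply: eq_integral => x _; rewrite !funeposE.
  rewrite (@stdgaussP d)//; last exact: measurable_funepos.
  by apply: eq_integral => x _; rewrite !funeposE maxe_pMl ?mul0e -?EFinM// lee_fin expR_ge0.
transitivity (\int[stdgauss d]_x (EFin \o f)^\-%E (x + s)%R)%E.
  by apply: eq_integral => x _; rewrite !funenegE.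
rewrite (@stdgaussP d)//; last exact: measurable_funeneg.
by apply: eq_integral => x _; rewrite !funenegE maxe_pMl ?mul0e ?mulNe -?EFinM// lee_fin expR_ge0.
Qed.

(** The vector formula for the shift [h *: u], which [dotv u] sees as a translation by
    [dotv u u * h]. *)
Lemma gaussf_stdgauss d (u : 'cV[R]_d) : gaussf (stdgauss d) (dotv u) (dotv u u).
Proof.
move=> h f mf f0.
have mfu : measurable_fun setT (f \o dotv u : mxBorel R d 1 -> \bar R).
  by apply: (measurableT_comp mf); exact: measurable_dotv.
have := @stdgaussP d (h *: u) _ mfu (fun x => f0 _).
rewrite [X in X = _ -> _](_ : _ = (\int[stdgauss d]_x f (dotv u x + dotv u u * h)%R)%E); last first.
  by apply: eq_integral => x _ /=; rewrite dotvDr dotvZr mulrC.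
move=> ->; apply: eq_integral => x _ /=; congr (_ * (expR _)%:E)%E.
by rewrite !dotvZl dotvZr; ring.
Qed.

End standard_gaussian.

Section probability_integrals.
Context d {T : measurableType d} {R : realType} (P : probability T R).
Implicit Types f g : T -> R.

Let PT : (P : {measure set T -> \bar R}) setT = 1%E.
Proof. exact: probability_setT. Qed.

Lemma Rintegral_cstP (c : R) : \int[P]_x c = c.
Proof. by rewrite Rintegral_cst// PT mulr1. Qed.

Lemma le_abs_integrable f g : measurable_fun setT f -> P.-integrable setT (EFin \o g) ->
  (forall x, `|f x| <= g x) -> P.-integrable setT (EFin \o f).
Proof.
move=> mf ig fg; apply: le_integrable ig => //; first exact/measurable_EFinP.
by move=> x _ /=; rewrite lee_fin (le_trans (fg x))// ler_norm.
Qed.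

Lemma bounded_integrable f (c : R) : measurable_fun setT f -> (forall x, `|f x| <= c) ->
  P.-integrable setT (EFin \o f).
Proof.
by move=> mf fc; apply: (le_abs_integrable mf _ fc); exact: finite_measure_integrable_cst.
Qed.

Lemma EFin_Rintegral f : P.-integrable setT (EFin \o f) ->
  (\int[P]_x (f x)%:E = (\int[P]_x f x)%:E)%E.
Proof. by move=> fi; rewrite /Rintegral fineK//; exact: integrable_fin_num. Qed.

Lemma ler_Rintegral f g : P.-integrable setT (EFin \o f) -> P.-integrable setT (EFin \o g) ->
  (forall x, f x <= g x) -> \int[P]_x f x <= \int[P]_x g x.
Proof. by move=> fi gi fg; apply: le_Rintegral. Qed.

Lemma Rintegral_dist_le f g h : P.-integrable setT (EFin \o f) -> P.-integrable setT (EFin \o g) ->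
  P.-integrable setT (EFin \o h) -> (forall x, `|f x - g x| <= h x) ->
  `|\int[P]_x f x - \int[P]_x g x| <= \int[P]_x h x.
Proof.
move=> fi gi hi fgh; rewrite -RintegralB//.
have fgi : P.-integrable setT (EFin \o (fun x => f x - g x)).
  by apply: eq_integrable (integrableB measurableT fi gi).
apply: (le_trans (le_normr_Rintegral measurableT fgi)); apply: ler_Rintegral => //.
by apply: eq_integrable (integrable_norm fgi).
Qed.

Lemma Rintegral_bounds f a b : measurable_fun setT f -> (forall x, a <= f x <= b) ->
  a <= \int[P]_x f x <= b.
Proof.
move=> mf fab.
have fi : P.-integrable setT (EFin \o f).
  apply: (bounded_integrable (c := `|a| + `|b|)) => // x; have /andP[ax xb] := fab x.
  have := ler_norm b; have := ler_norm (- a); rewrite normrN => ha hb.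
  have := normr_ge0 a; have := normr_ge0 b => hb0 ha0.
  rewrite ler_norml; apply/andP; split; lra.
apply/andP; split.
  rewrite -[leLHS]Rintegral_cstP; apply: ler_Rintegral => // [|x]; last by case/andP: (fab x).
  exact: finite_measure_integrable_cst.
rewrite -[leRHS]Rintegral_cstP; apply: ler_Rintegral => // [|x]; last by case/andP: (fab x).
exact: finite_measure_integrable_cst.
Qed.

Lemma integrable_mulc (c : R) f : P.-integrable setT (EFin \o f) ->
  P.-integrable setT (EFin \o (fun x => c * f x)).
Proof.
by move=> fi; under [X in _.-integrable _ X]eq_fun do rewrite /= EFinM; exact: integrableZl.
Qed.

Lemma integrable_sumr (I : Type) (r : seq I) (f : I -> T -> R) :
  (forall i, P.-integrable setT (EFin \o f i)) ->
  P.-integrable setT (EFin \o (fun x => \sum_(i <- r) f i x)).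
Proof.
move=> fi; have := @integrable_sum _ _ _ P setT measurableT _ r xpredT (fun i x => (f i x)%:E) (fun i _ => fi i).
by apply: eq_integrable => // x _; rewrite /= sumEFin.
Qed.

Lemma Rintegral_sum (I : Type) (r : seq I) (f : I -> T -> R) :
  (forall i, P.-integrable setT (EFin \o f i)) ->
  \int[P]_x (\sum_(i <- r) f i x) = \sum_(i <- r) \int[P]_x f i x.
Proof.
move=> fi; elim: r => [|i r ih].
  by rewrite big_nil; under eq_Rintegral do rewrite big_nil; rewrite Rintegral_cstP.
rewrite big_cons -ih; under eq_Rintegral do rewrite big_cons.
by rewrite RintegralD//; exact: integrable_sumr.
Qed.

Lemma integrable_bounded_mul f g (c : R) : measurable_fun setT f -> (forall x, `|f x| <= c) ->
  P.-integrable setT (EFin \o g) -> P.-integrable setT (EFin \o (fun x => f x * g x)).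
Proof.
move=> mf fc ig; apply: (le_abs_integrable (g := fun x => c * `|g x|)).
- by apply: measurable_funM => //; apply/measurable_EFinP; case/integrableP: ig.
- by apply: integrable_mulc; have := integrable_norm ig; apply: eq_integrable.
- by move=> x; rewrite normrM ler_wpM2r.
Qed.

Lemma indic_le1 (A : set T) x : `|\1_A x : R| <= 1.
Proof. by rewrite indicE; case: (_ \in _); rewrite ?normr1 ?normr0. Qed.

End probability_integrals.
Arguments bounded_integrable {d T R P f} c.
Arguments integrable_bounded_mul {d T R P f g} c.
Arguments indic_le1 {d T R} A.

Section lp_moments.
Context {R : realType} {d : nat} (p : \bar R) (p1 : (1 <= p)%E).

Lemma lpnorm_le_sum (x : 'cV[R]_d) : lpnorm p x <= Num.sqrt (dimpow p d) * \sum_i `|x i 0|.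
Proof.
apply: lpnorm_le_max => // [|i]; first exact: sumr_ge0.
by rewrite (bigD1 i)//= lerDl sumr_ge0.
Qed.

Lemma integrable_coord_stdgauss i :
  (stdgauss d).-integrable setT (EFin \o (fun x : mxBorel R d 1 => `|(x : 'cV[R]_d) i 0|)).
Proof.
have g := gaussf_stdgauss (delta_mx i 0 : 'cV[R]_d).
have := integrable_gaussf (@measurable_dotv R d _) g.
move=> /integrable_norm; apply: eq_integrable => // x _ /=; by rewrite dotv_delta.
Qed.

Lemma integrable_lpnorm_stdgauss :
  (stdgauss d).-integrable setT (EFin \o (lpnorm p : mxBorel R d 1 -> R)).
Proof.
have h : (stdgauss d).-integrable setT (EFin \o (fun x : mxBorel R d 1 => Num.sqrt (dimpow p d) * \sum_i `|(x : 'cV[R]_d) i 0|)).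
  under [X in _.-integrable _ X]eq_fun do rewrite /= EFinM -sumEFin.
  apply: integrableZl => //.
  by apply: (@integrable_sum _ _ _ _ setT measurableT _ _ xpredT (fun i (x : mxBorel R d 1) => `|(x : 'cV[R]_d) i 0|%:E)) => i _; exact: integrable_coord_stdgauss.
apply: (le_abs_integrable _ h) => [|x]; first exact: measurable_lpnorm.
by rewrite ger0_norm ?lpnorm_ge0// lpnorm_le_sum.
Qed.

End lp_moments.

Section cramer_wold.
Context {R : realType} {d : nat}.
Notation B1 := (mxBorel R d 1).
Notation gamma := (stdgauss d).

(** The added 1 keeps the integrand nonnegative, so that Tonelli's theorem applies where this
    identity is integrated. *)
Lemma stdgauss_cos (w : 'cV[R]_d) :
  (\int[gamma]_u (1 + cos (dotv w u))%:E = (1 + expR (- (dotv w w / 2)))%:E)%E.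
Proof.
have mc : measurable_fun setT (fun u : B1 => cos (dotv w u)).
  by apply: (measurableT_comp measurable_cosR); exact: measurable_dotv.
have ic : gamma.-integrable setT (EFin \o (fun u : B1 => cos (dotv w u))).
  by apply: (bounded_integrable 1) => // u; exact: cos_max.
have ic1 : gamma.-integrable setT (EFin \o (fun u : B1 => 1 : R)).
  exact: finite_measure_integrable_cst.
rewrite (EFin_Rintegral (f := fun u : B1 => 1 + cos (dotv w u))); last first.
  by apply: eq_integrable (integrableD measurableT ic1 ic).
rewrite RintegralD// Rintegral_cstP; congr (_ + _)%:E.
have := gaussf_cos (@measurable_dotv R d w) (gaussf_stdgauss w) 1.
by rewrite expr1n mulr1 => <-; apply: eq_Rintegral => u _; rewrite mul1r.
Qed.

Lemma measurable_smooth (f : 'cV[R]_d -> R) s : measurable_fun setT (f : B1 -> R) ->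
  measurable_fun setT (fun z : B1 * B1 => f ((z.1 : 'cV[R]_d) + s *: (z.2 : 'cV[R]_d))).
Proof.
move=> mf; apply: (measurableT_comp mf); apply: measurable_addmx; first exact: measurable_fst.
by apply: measurable_scalemx; [exact: measurable_cst|exact: measurable_snd].
Qed.

Variables (mu nu : probability B1 R) (q : 'cV[R]_d -> R).
Hypotheses (gmu : forall u, gaussf mu (dotv u) (q u)) (gnu : forall u, gaussf nu (dotv u) (q u)).

Section one_measure.
Variable (m : probability B1 R).
Hypothesis gm : forall u, gaussf m (dotv u) (q u).

Lemma gaussv_cos_shift (u : 'cV[R]_d) (t c : R) :
  (\int[m]_x (1 + cos (t * dotv u x - c))%:E = (1 + expR (- (q u * t ^+ 2 / 2)) * cos c)%:E)%E.
Proof.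
have mt : measurable_fun setT (fun x : B1 => t * dotv u x).
  by apply: measurable_funM => //; exact: measurable_dotv.
have mc : measurable_fun setT (fun x : B1 => cos (t * dotv u x)).
  exact: (measurableT_comp measurable_cosR).
have ms : measurable_fun setT (fun x : B1 => sin (t * dotv u x)).
  exact: (measurableT_comp measurable_sinR).
have ic : m.-integrable setT (EFin \o (fun x : B1 => cos (t * dotv u x) * cos c)).
  apply: (bounded_integrable 1) => [|x]; first exact: measurable_funM.
  by rewrite normrM -[leRHS]mulr1 ler_pM ?cos_max.
have is_ : m.-integrable setT (EFin \o (fun x : B1 => sin (t * dotv u x) * sin c)).
  apply: (bounded_integrable 1) => [|x]; first exact: measurable_funM.
  by rewrite normrM -[leRHS]mulr1 ler_pM ?sin_max.
have ic0 : m.-integrable setT (EFin \o (fun x : B1 => cos (t * dotv u x))).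
  by apply: (bounded_integrable 1) => // x; exact: cos_max.
have is0 : m.-integrable setT (EFin \o (fun x : B1 => sin (t * dotv u x))).
  by apply: (bounded_integrable 1) => // x; exact: sin_max.
have ics : m.-integrable setT (EFin \o (fun x : B1 => cos (t * dotv u x) * cos c + sin (t * dotv u x) * sin c)).
  by apply: eq_integrable (integrableD measurableT ic is_).
have i1 : m.-integrable setT (EFin \o (fun u : B1 => 1 : R)).
  exact: finite_measure_integrable_cst.
under eq_integral do rewrite cosB.
rewrite (EFin_Rintegral (f := fun x : B1 => 1 + (cos (t * dotv u x) * cos c + sin (t * dotv u x) * sin c))); last first.
  by apply: eq_integrable (integrableD measurableT i1 ics).
rewrite RintegralD// Rintegral_cstP RintegralD// !RintegralZr//.
by rewrite (gaussf_cos (@measurable_dotv R d u) (gm u)) (gaussf_sin (@measurable_dotv R d u) (gm u)) mul0r addr0.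
Qed.

(** The function [exp (- |y|^2 / 2)] is the mean of [cos (dotv y u)] for [u] standard Gaussian.
    After the exchange of integrals, [m] enters only through its characteristic function, that is,
    through [q]. *)
Lemma gaussv_exp_sqr (r : R) (z : 'cV[R]_d) :
  (\int[m]_x (1 + expR (- (dotv (r *: x - z) (r *: x - z) / 2)))%:E =
   \int[gamma]_u (1 + expR (- (q u * r ^+ 2 / 2)) * cos (dotv u z))%:E)%E.
Proof.
have mD : measurable_fun setT (fun xu : B1 * B1 => (1 + cos (dotv (r *: (xu.1 : 'cV[R]_d) - z) xu.2))%:E).
  apply/measurable_EFinP; apply: measurable_funD => //; apply: (measurableT_comp measurable_cosR).
  under eq_fun do rewrite dotvE; apply: measurable_sum => i; apply: measurable_funM.
    under eq_fun do rewrite !mxE; apply: measurable_funB => //; apply: measurable_funM => //.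
    exact: (measurableT_comp (@measurable_coord R d 1 i 0) (@measurable_fst _ _ B1 B1)).
  exact: (measurableT_comp (@measurable_coord R d 1 i 0) (@measurable_snd _ _ B1 B1)).
under eq_integral do rewrite -stdgauss_cos.
rewrite (ge0_integral_prodp_swap m gamma mD); last first.
  by move=> xu; rewrite lee_fin -lerBlDl sub0r; have := cos_max (dotv (r *: (xu.1 : 'cV[R]_d) - z) xu.2); rewrite ler_norml => /andP[].
apply: eq_integral => u _ /=; rewrite -gaussv_cos_shift; apply: eq_integral => x _.
by rewrite dotvDl dotvNl dotvZl (dotvC x) (dotvC z).
Qed.

(** The formula with shift [x / s] frees the argument of [f] from [x]. Completing the square turns
    the weight into [exp (|z|^2 / 2) exp (- |x / s - z|^2 / 2)], so [m] is involved only through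
    integrals determined by [q]. *)
Lemma smoothed_integral (s : R) (f : 'cV[R]_d -> R) : 0 < s ->
  measurable_fun setT (f : B1 -> R) -> (forall x, 0 <= f x) ->
  (\int[m]_x \int[gamma]_z (f (x + s *: z))%:E =
   \int[gamma]_z ((f (s *: z) * expR (dotv z z / 2))%:E *
     \int[m]_x (expR (- (dotv (s^-1 *: x - z) (s^-1 *: x - z) / 2)))%:E))%E.
Proof.
move=> s0 mf f0.
have msc : measurable_fun setT ((fun z => s *: (z : 'cV[R]_d)) : B1 -> B1).
  by apply: measurable_scalemx; [exact: measurable_cst|exact: measurable_id].
have mfs : measurable_fun setT (fun z : B1 => (f (s *: (z : 'cV[R]_d)))%:E).
  by apply/measurable_EFinP; exact: (measurableT_comp mf).
have m1 (A : B1 * B1 -> B1) i : measurable_fun setT A -> measurable_fun setT (fun xz => (A xz : 'cV[R]_d) i 0).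
  by move=> mA; exact: (measurableT_comp (@measurable_coord R d 1 i 0) mA).
have mdot (A B : B1 * B1 -> B1) : measurable_fun setT A -> measurable_fun setT B ->
    measurable_fun setT (fun xz => dotv (A xz) (B xz)).
  move=> mA mB; under eq_fun do rewrite dotvE; apply: measurable_sum => i.
  by apply: measurable_funM; exact: m1.
have mx1 : measurable_fun setT ((fun xz : B1 * B1 => s^-1 *: (xz.1 : 'cV[R]_d)) : _ -> B1).
  by apply: measurable_scalemx; [exact: measurable_cst|exact: measurable_fst].
transitivity (\int[m]_x \int[gamma]_z (f (s *: z) * expR (dotv (s^-1 *: x) z - dotv (s^-1 *: x) (s^-1 *: x) / 2))%:E)%E.
  apply: eq_integral => x _.
  have := @stdgaussP R d (s^-1 *: x) _ mfs (fun z => f0 _).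
  rewrite [X in X = _ -> _](_ : _ = \int[gamma]_z (f (x + s *: z))%:E)%E; last first.
    by apply: eq_integral => z _; rewrite scalerDr scalerA mulfV ?gt_eqF// scale1r addrC.
  by move=> ->; apply: eq_integral => z _; rewrite EFinM.
rewrite (ge0_integral_prodp_swap m gamma (f := fun xz => (f (s *: xz.2) * expR (dotv (s^-1 *: xz.1) xz.2 - dotv (s^-1 *: xz.1) (s^-1 *: xz.1) / 2))%:E)); last 2 first.
- apply/measurable_EFinP; apply: measurable_funM.
    apply: (measurableT_comp mf); apply: measurable_scalemx; [exact: measurable_cst|exact: measurable_snd].
  apply: measurableT_comp => //; apply: measurable_funB; first by apply: mdot => //; exact: measurable_snd.
  by apply: measurable_funM => //; exact: mdot.
- by move=> xz; rewrite lee_fin mulr_ge0 ?expR_ge0.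
apply: eq_integral => z _ /=.
rewrite -ge0_integralZl//; last 2 first.
- apply/measurable_EFinP; apply: measurableT_comp => //; apply: measurableT_comp => //.
  apply: measurable_funM => //; under eq_fun do rewrite dotvE.
  have mm : measurable_fun setT ((fun x => s^-1 *: (x : 'cV[R]_d) - z) : B1 -> B1).
    apply: measurable_addmx; last exact: measurable_cst.
    by apply: measurable_scalemx; [exact: measurable_cst|exact: measurable_id].
  by apply: measurable_sum => i; apply: measurable_funM; exact: (measurable_fun_coord i 0 mm).
- by rewrite lee_fin mulr_ge0 ?expR_ge0.
apply: eq_integral => x _; rewrite -EFinM -mulrA -expRD; congr (_ * expR _)%:E.
by rewrite !(dotvDl, dotvDr, dotvNl, dotvNr) (dotvC z (s^-1 *: x)); field.
Qed.

End one_measure.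

Lemma gaussv_exp_sqr_eq (r : R) (z : 'cV[R]_d) :
  (\int[mu]_x (expR (- (dotv (r *: x - z) (r *: x - z) / 2)))%:E =
   \int[nu]_x (expR (- (dotv (r *: x - z) (r *: x - z) / 2)))%:E)%E.
Proof.
have mm : measurable_fun setT ((fun x => r *: (x : 'cV[R]_d) - z) : B1 -> B1).
  apply: measurable_addmx; last exact: measurable_cst.
  by apply: measurable_scalemx; [exact: measurable_cst|exact: measurable_id].
have me : measurable_fun setT (fun x : B1 => expR (- (dotv (r *: (x : 'cV[R]_d) - z) (r *: (x : 'cV[R]_d) - z) / 2))).
  apply: measurableT_comp => //; apply: measurableT_comp => //.
  apply: measurable_funM => //; under eq_fun do rewrite dotvE.
  by apply: measurable_sum => i; apply: measurable_funM; exact: (measurable_fun_coord i 0 mm).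
have h (m : probability B1 R) : (\int[m]_x (1 + expR (- (dotv (r *: x - z) (r *: x - z) / 2)))%:E
   = 1 + \int[m]_x (expR (- (dotv (r *: x - z) (r *: x - z) / 2)))%:E)%E.
  under eq_integral do rewrite EFinD.
  rewrite ge0_integralD//; last first.
  - exact/measurable_EFinP.
  by rewrite integral_cst// mul1e; congr (_ + _)%E; exact: probability_setT.
have e : (1 + \int[mu]_x (expR (- (dotv (r *: x - z) (r *: x - z) / 2)))%:E =
    1 + \int[nu]_x (expR (- (dotv (r *: x - z) (r *: x - z) / 2)))%:E)%E.
  by rewrite -!h (gaussv_exp_sqr gmu) (gaussv_exp_sqr gnu).
by have := congr1 (fun t => (t - 1)%E) e; rewrite ![(1 + _)%E]addeC !addeK.
Qed.

(** The two laws agree on the smoothed function [G s], and smoothing moves [f] by at most [L s M],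
    with [M] the mean p-norm of a standard Gaussian vector; [s] is then made small. *)
Lemma cramer_wold_lipschitz (p : \bar R) (L : R) (f : 'cV[R]_d -> R) : (1 <= p)%E -> 0 <= L ->
  (forall x, 0 <= f x <= 1) -> (forall x y, `|f x - f y| <= L * lpnorm p (x - y)) ->
  \int[mu]_x f x = \int[nu]_x f x.
Proof.
move=> p1 L0 f01 fL.
have mf : measurable_fun setT (f : B1 -> R) := lipschitz_measurable p1 fL.
have fi (m : probability B1 R) : m.-integrable setT (EFin \o (f : B1 -> R)).
  by apply: (bounded_integrable 1) => // x; rewrite ger0_norm; case/andP: (f01 x).
pose M := \int[gamma]_z lpnorm p z.
pose G s (x : 'cV[R]_d) := \int[gamma]_z f (x + s *: z).
have mG s : measurable_fun setT (G s : B1 -> R).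
  exact: (measurable_Rintegral_param (T1 := B1) gamma (f := fun x z => f (x + s *: z)) (measurable_smooth s mf)).
have mfx s x : measurable_fun setT (fun z : B1 => f (x + s *: (z : 'cV[R]_d))).
  exact: (measurableT_comp (measurable_smooth s mf) (@pair1_measurable _ _ B1 B1 x)).
have G01 s x : 0 <= G s x <= 1 by apply: Rintegral_bounds.
have Gi s (m : probability B1 R) : m.-integrable setT (EFin \o (G s : B1 -> R)).
  by apply: (bounded_integrable 1) => // x; rewrite ger0_norm; case/andP: (G01 s x).
have fxi s x : gamma.-integrable setT (EFin \o (fun z : B1 => f (x + s *: (z : 'cV[R]_d)))).
  by apply: (bounded_integrable 1) => // z; rewrite ger0_norm; case/andP: (f01 (x + s *: z)).
have iM := @integrable_lpnorm_stdgauss R d p p1.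
have fG s x : 0 < s -> `|f x - G s x| <= L * s * M.
  move=> s0; rewrite -[X in `|X - _|](Rintegral_cstP gamma) /M -RintegralZl//.
  apply: Rintegral_dist_le => //.
  - exact: finite_measure_integrable_cst.
  - by under [X in _.-integrable _ X]eq_fun do rewrite /= EFinM; exact: integrableZl.
  - move=> z; have := fL x (x + s *: (z : 'cV[R]_d)).
    by rewrite opprD addrA subrr sub0r lpnormN lpnormZ ?(ltW s0)// mulrA.
have GG s : 0 < s -> \int[mu]_x G s x = \int[nu]_x G s x.
  move=> s0; rewrite /Rintegral; congr fine.
  have e (m : probability B1 R) : (\int[m]_x (G s x)%:E = \int[m]_x \int[gamma]_z (f (x + s *: z))%:E :> \bar R)%E.
    apply: eq_integral => x _.
    by rewrite (EFin_Rintegral (f := fun z : B1 => f (x + s *: (z : 'cV[R]_d)))).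
  have f0 x : 0 <= f x by case/andP: (f01 x).
  rewrite !e !smoothed_integral//; apply: eq_integral => z _; congr (_ * _)%E.
  exact: gaussv_exp_sqr_eq.
have M0 : 0 <= M by apply: Rintegral_ge0 => z _; exact: lpnorm_ge0.
have key s : 0 < s -> `|\int[mu]_x f x - \int[nu]_x f x| <= s * (2 * (L * M)).
  move=> s0; have h (m : probability B1 R) : `|\int[m]_x f x - \int[m]_x G s x| <= L * s * M.
    rewrite -[leRHS](Rintegral_cstP m); apply: Rintegral_dist_le => //.
    - exact: finite_measure_integrable_cst.
    - by move=> x; exact: fG.
  have hmu := h mu; have hnu := h nu; rewrite GG// in hmu.
  rewrite (le_trans (ler_distD (\int[nu]_x G s x) _ _))//.
  by rewrite (distrC (\int[nu]_x G s x)); lra.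
apply/eqP; rewrite -subr_eq0 -normr_le0; apply/ler_addgt0Pl => e e0; rewrite addr0.
have LM0 : 0 <= 2 * (L * M) by rewrite mulr_ge0// mulr_ge0.
pose s := e / (2 * (L * M) + 1).
have s0 : 0 < s by rewrite divr_gt0// ltr_wpDl.
rewrite (le_trans (key s s0))// /s mulrAC -mulrA ler_piMr ?ltW//.
by rewrite ltr_pdivrMr ?mul1r ?ltrDl// ltr_wpDl.
Qed.

(* The Cramer-Wold device for Gaussian marginals. *)
Lemma gaussv_unique (B : set B1) : measurable B -> mu B = nu B.
Proof.
move: B; pose G : set (set B1) := @open 'M[R]_(d, 1).
have Gm : G `<=` measurable by exact: sub_gen_smallest.
apply: (@g_sigma_algebra_measure_unique _ R B1 G Gm (fun=> setT) _ _ mu nu) => //.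
- by move=> _; exact: openT.
- by rewrite bigcup_const.
- by move=> U V; exact: openI.
- move=> U oU; have [UT|/set0P U0] := eqVneq (~` U) set0.
    have -> : U = setT by rewrite -[U]setCK UT setC0.
    by rewrite [LHS]probability_setT; symmetry; exact: probability_setT.
  (* Lipschitz functions converging pointwise to the indicator of the open set [U]: they vanish on
     the complement and equal 1 beyond distance [1 / (k + 1)] from it. Open sets are stable under
     intersection and generate the Borel sets. *)
  pose f k x : R := 1 - ramp +oo%E (~` U) 0 (k.+1%:R^-1) x.
  have f01 k x : 0 <= f k x <= 1 by rewrite /f subr_ge0 ramp_le1 lerBlDr lerDl ramp_ge0.
  have mf k : measurable_fun setT (f k : B1 -> R).
    rewrite /f; apply: measurable_funB => //.
    by apply: (@measurable_ramp R d +oo%E (leey _) (~` U) U0); rewrite invr_gt0.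
  have cf x : f k x @[k --> \oo] --> (\1_U x : R).
    have [Ux|Ux] := pselect (U x).
      have /nbhs_ballP[e /= e0 eU] := open_nbhs_nbhs (conj oU Ux).
      have re : e <= rdist +oo%E (~` U) x.
        apply: lb_le_inf; first by case: (rdist_has_inf +oo%E U0 x).
        move=> _ [y Uy <-]; rewrite leNgt; apply/negP => h; apply: Uy; apply: eU.
        split => // i j; rewrite ord1 /ball /=.
        apply: le_lt_trans h; have := @normr_le_lpnorm R d +oo%E (x - y) i (leey _).
        by rewrite !mxE.
      rewrite indicE mem_set//; apply: cvg_near_cst.
      have := near_infty_natSinv_lt (PosNum e0); apply: filterS => k /= ke.
      by rewrite /f ramp_zero ?subr0//= add0r ltW// (lt_le_trans ke).
    rewrite indicE memNset//; apply: (cvg_trans _ (@cvg_cst _ _ _ \oo _)).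
    rewrite (_ : (fun k => f k x) = fun=> 0)//; apply/funext => k.
    rewrite /f (_ : ramp _ _ _ _ _ = 1) ?subrr//; apply: ramp_one => //.
    by rewrite (@rdist_in R d +oo%E (leey _) _ U0).
  have cm (m : probability B1 R) : (\int[m]_x (f k x)%:E @[k --> \oo] --> m U)%E.
    have mU : measurable (U : set B1) by exact: sub_gen_smallest.
    have -> : m U = (\int[m]_x (\1_U x)%:E)%E by rewrite integral_indic// setIT.
    apply: (@dominated_cvg _ _ _ m setT measurableT (fun k x => (f k x)%:E) _ (cst 1%E)) => //.
    - by move=> k; exact/measurable_EFinP.
    - by move=> x _; apply/fine_cvgP; split; [exact: nearW|exact: cf].
    - exact: finite_measure_integrable_cst.
    - by move=> k x _; rewrite lee_fin ger0_norm; case/andP: (f01 k x).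
  have e : (fun k => \int[mu]_x (f k x)%:E)%E = (fun k => \int[nu]_x (f k x)%:E)%E.
    apply/funext => k; rewrite !EFin_Rintegral; last 2 first.
    - by apply: (bounded_integrable 1) => // x; rewrite ger0_norm; case/andP: (f01 k x).
    - by apply: (bounded_integrable 1) => // x; rewrite ger0_norm; case/andP: (f01 k x).
    congr EFin; apply: (@cramer_wold_lipschitz +oo%E (k.+1%:R^-1)^-1 _ (leey _)) => // x y.
    rewrite /f (_ : _ - _ = - (ramp +oo%E (~` U) 0 k.+1%:R^-1 x - ramp +oo%E (~` U) 0 k.+1%:R^-1 y)); last by ring.
    by rewrite normrN (@ramp_lip R d +oo%E (leey _) _ U0)// invr_gt0.
  by have := cm mu; rewrite e => h; exact: (cvg_unique _ h (cm nu)).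
- by rewrite [X in (X < _)%E]probability_setT ltry.
Qed.

End cramer_wold.

(** * Gaussian vectors and smoothing *)

Section iterated_integrals.
Context d1 d2 {T1 : measurableType d1} {T2 : measurableType d2} {R : realType}.
Variables (P1 : probability T1 R) (P2 : probability T2 R).

Lemma Rintegral_swap (f : T1 -> T2 -> R) c : measurable_fun setT (fun z => f z.1 z.2) ->
  (forall x y, 0 <= f x y <= c) ->
  \int[P1]_x \int[P2]_y f x y = \int[P2]_y \int[P1]_x f x y.
Proof.
move=> mf f01.
have m1 x : measurable_fun setT (f x) by exact: (measurableT_comp mf (pair1_measurable x)).
have m2 y : measurable_fun setT (f^~ y) by exact: (measurableT_comp mf (pair2_measurable y)).
have n x y : `|f x y| <= c by have /andP[h0 h1] := f01 x y; rewrite ger0_norm.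
have e1 : (\int[P1]_x \int[P2]_y (f x y)%:E = \int[P1]_x (\int[P2]_y f x y)%:E)%E.
  by apply: eq_integral => x _; rewrite EFin_Rintegral//; exact: (bounded_integrable c).
have e2 : (\int[P2]_y \int[P1]_x (f x y)%:E = \int[P2]_y (\int[P1]_x f x y)%:E)%E.
  by apply: eq_integral => y _; rewrite EFin_Rintegral//; exact: (bounded_integrable c).
rewrite /Rintegral in e1 e2 *; rewrite -e1 -e2; congr fine.
apply: (ge0_integral_prodp_swap P1 P2 (f := fun z => (f z.1 z.2)%:E)).
  exact/measurable_EFinP.
by move=> z; rewrite lee_fin; have /andP[] := f01 z.1 z.2.
Qed.

End iterated_integrals.

Section taylor.
Context {R : realType}.

Lemma mean_value (F F1 : R -> R) t : (forall s, is_derive s (1 : R) F (F1 s)) -> 0 <= t ->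
  exists2 c, 0 <= c <= t & F t - F 0 = F1 c * t.
Proof.
move=> dF t0; have [|c cI ->] := MVT_segment t0 (fun s _ => dF s).
  apply: derivable_within_continuous => s _.
  exact: ex_derive.
by exists c; rewrite ?subr0//; move: cI; rewrite in_itv.
Qed.

(** The remainder is [K 1 - K 0]. Two uses of the mean value theorem, for [K] and for its derivative
    [K1], reduce it to an oscillation of [F2], which is the only regularity available later. *)
Lemma taylor2 (F F1 F2 : R -> R) C : (forall t, is_derive t (1 : R) F (F1 t)) ->
  (forall t, is_derive t (1 : R) F1 (F2 t)) ->
  (forall t, 0 <= t <= 1 -> `|F2 t - F2 0| <= C) ->
  `|F 1 - F 0 - F1 0 - F2 0 / 2| <= C.
Proof.
move=> dF dF1 F2C.
pose K1 t := F1 t - F1 0 - t * F2 0.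
pose K t := F t - (t * F1 0 + t * t * (F2 0 / 2)).
have dK1 t : is_derive t (1 : R) K1 (F2 t - F2 0).
  rewrite (_ : K1 = (fun t => F1 t - (F1 0 + t * F2 0))); last by apply/funext => s; rewrite /K1; ring.
  have h := is_derive_mulfun (is_derive_idfun t) (is_derive_cstfun (F2 0) t).
  by apply: is_derive_eq (is_deriveB (dF1 t) (is_deriveD (is_derive_cstfun (F1 0) t) h)) _; ring.
have dK t : is_derive t (1 : R) K (K1 t).
  have h := is_derive_mulfun (is_derive_idfun t) (is_derive_cstfun (F1 0) t).
  have h2 := is_derive_mulfun (is_derive_mulfun (is_derive_idfun t) (is_derive_idfun t)) (is_derive_cstfun (F2 0 / 2) t).
  apply: is_derive_eq (is_deriveB (dF t) (is_deriveD h h2)) _; by rewrite /K1; field.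
have [c c01 eK] := mean_value dK ler01.
have /andP[c0 c1] := c01; have [c' /andP[c'0 c'c] eK1] := mean_value dK1 c0.
have -> : F 1 - F 0 - F1 0 - F2 0 / 2 = K1 c.
  move: eK; rewrite mulr1 => <-; rewrite /K; ring.
have -> : K1 c = (F2 c' - F2 0) * c.
  by rewrite -eK1 /K1; ring.
rewrite normrM (ger0_norm c0) (@le_trans _ _ `|F2 c' - F2 0|)// ?ler_piMr//.
by apply: F2C; rewrite c'0 (le_trans c'c).
Qed.

End taylor.

Section gaussian_vectors.
Context {R : realType} {d : nat}.
Notation B1 := (mxBorel R d 1).
Notation gamma := (stdgauss d).
Implicit Types (Q V : 'M[R]_d).

Definition gaussv Q (mu : {measure set B1 -> \bar R}) : Prop :=
  forall u : 'cV[R]_d, gaussf mu (dotv u) (dotv u (Q *m u)).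

Lemma measurable_mulv (B : 'M[R]_d) : measurable_fun setT ((fun y => B *m (y : 'cV[R]_d)) : B1 -> B1).
Proof.
apply: (@measurable_mulmx _ _ _ d d 1 (fun=> B)); [exact: measurable_cst|exact: measurable_id].
Qed.

Definition normv Q : probability B1 R := push gamma (measurable_mulv (mxsqrt Q)).

Lemma gaussv_mulv (B : 'M[R]_d) : gaussv (B *m B^T) (push gamma (measurable_mulv B)).
Proof.
move=> u; apply: gaussf_push; first exact: measurable_dotv.
rewrite (_ : dotv u \o _ = dotv (B^T *m u)); last first.
  by apply/funext => y /=; rewrite dotv_mulmx.
have -> : dotv u (B *m B^T *m u) = dotv (B^T *m u) (B^T *m u).
  by rewrite -dotv_mulmx mulmxA.
exact: gaussf_stdgauss.
Qed.

Lemma gaussv_normv Q : psd Q -> gaussv Q (normv Q).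
Proof. by move=> /mxsqrt_gram QE; rewrite -[X in gaussv X _]QE; exact: gaussv_mulv. Qed.

Lemma gaussv_mvnormal0 Q (mu : probability B1 R) : psd Q -> mvnormal0 Q mu -> gaussv Q mu.
Proof.
move=> /psdP[_ pQ] mQ u; apply: gaussf_normal0 => //; first exact: measurable_dotv.
by move=> B mB; rewrite dotv_qf; exact: mQ.
Qed.

Lemma gaussv_eq_normv Q (mu : probability B1 R) B : psd Q -> gaussv Q mu -> measurable B ->
  mu B = normv Q B.
Proof. by move=> pQ gmu; exact: (gaussv_unique gmu (gaussv_normv pQ)). Qed.

Lemma measurable_addpair : measurable_fun setT ((fun z => (z.1 : 'cV[R]_d) + (z.2 : 'cV[R]_d)) : B1 * B1 -> B1).
Proof. by apply: measurable_addmx; [exact: measurable_fst|exact: measurable_snd]. Qed.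

Lemma gaussvD Q V (mu nu : probability B1 R) : gaussv Q mu -> gaussv V nu ->
  gaussv (Q + V) (push (prodp mu nu) measurable_addpair).
Proof.
move=> gmu gnu u; apply: gaussf_push; first exact: measurable_dotv.
rewrite mulmxDl dotvDr (_ : _ \o _ = fun z : B1 * B1 => dotv u z.1 + dotv u z.2); last first.
  by apply/funext => z /=; rewrite dotvDr.
by apply: gaussf_prodp => //; exact: measurable_dotv.
Qed.

(** The semigroup property of Gaussian laws: both sides integrate [k] against laws whose marginals
    are Gaussian with covariance [Q + V], and such a law is unique. *)
Lemma normvD Q V (k : 'cV[R]_d -> R) c : psd Q -> psd V -> measurable_fun setT (k : B1 -> R) ->
  (forall x, 0 <= k x <= c) ->
  \int[gamma]_y \int[gamma]_y' k (mxsqrt V *m y + mxsqrt Q *m y') =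
  \int[gamma]_y k (mxsqrt (Q + V) *m y).
Proof.
move=> pQ pV mk k01.
have mEk : measurable_fun setT (EFin \o (k : B1 -> R)) by exact/measurable_EFinP.
have k0 x : (0 <= (k x)%:E)%E by rewrite lee_fin; case/andP: (k01 x).
have n x : `|k x| <= c by have /andP[h0 h1] := k01 x; rewrite ger0_norm.
have mk2 : measurable_fun setT (fun z : B1 * B1 => k ((z.1 : 'cV[R]_d) + z.2)).
  by apply: (measurableT_comp mk); exact: measurable_addpair.
have msv W : measurable_fun setT (fun y : B1 => k (mxsqrt W *m y)).
  by apply: (measurableT_comp mk); exact: measurable_mulv.
have h : (\int[push (prodp (normv V) (normv Q)) measurable_addpair]_x (k x)%:E =
          \int[normv (Q + V)]_x (k x)%:E)%E.
  apply: eq_measure_integral => B mB _.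
  apply: gaussv_eq_normv => //; first exact: psdD.
  by rewrite addrC; apply: gaussvD; exact: gaussv_normv.
have mx1 (x : 'cV[R]_d) : measurable_fun setT (fun y : B1 => k (x + y)).
  exact: (measurableT_comp mk2 (@pair1_measurable _ _ B1 B1 x)).
have mI : measurable_fun setT (fun x : B1 => \int[normv Q]_y k (x + (y : 'cV[R]_d))).
  exact: (measurable_Rintegral_param (T1 := B1) (normv Q) (f := fun x y => k (x + y))).
have RE W f : measurable_fun setT (f : B1 -> R) -> (forall x, 0 <= f x) ->
   (\int[normv W]_x (f x)%:E = \int[gamma]_y (f (mxsqrt W *m y))%:E)%E.
  move=> mf f0; rewrite ge0_integral_push//; first exact/measurable_EFinP.
move: h; rewrite ge0_integral_push// ge0_integral_prodp//; last exact/measurable_EFinP.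
under eq_integral => x _.
  rewrite (RE _ (fun y => k (x + y)))//; last by move=> y; rewrite -lee_fin.
  rewrite EFin_Rintegral; last first.
    by apply: (bounded_integrable c) => // ; apply: (measurableT_comp (mx1 x)); exact: measurable_mulv.
  over.
have mJ : measurable_fun setT (fun x : B1 => \int[gamma]_y k (x + mxsqrt Q *m y)).
  apply: (measurable_Rintegral_param (T1 := B1) gamma (f := fun x y => k (x + mxsqrt Q *m y))).
  apply: (measurableT_comp mk); apply: measurable_addmx; first exact: measurable_fst.
  exact: (measurableT_comp (measurable_mulv _) (@measurable_snd _ _ B1 B1)).
rewrite (RE _ (fun x => \int[gamma]_y k (x + mxsqrt Q *m y)))//; last first.
  by move=> x; apply: Rintegral_ge0 => y _; rewrite -lee_fin.
rewrite RE//.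
by rewrite /Rintegral => ->.
Qed.

(** Polarisation of the variances along [e_j + e_k], [e_j] and [e_k]. *)
Lemma stdgauss_cov (j k : 'I_d) : \int[gamma]_y ((y : 'cV[R]_d) j 0 * (y : 'cV[R]_d) k 0) = (j == k)%:R.
Proof.
have mc i : measurable_fun setT (fun y : B1 => (y : 'cV[R]_d) i 0) by exact: measurable_coord.
pose e i : 'cV[R]_d := delta_mx i 0.
have sq (u : 'cV[R]_d) := gaussf_var (@measurable_dotv R d u) (gaussf_stdgauss u).
have isq (u : 'cV[R]_d) := integrable_gaussf_sqr (@measurable_dotv R d u) (gaussf_stdgauss u).
have h : \int[gamma]_y (dotv (e j + e k) y ^+ 2 - (dotv (e j) y ^+ 2 + dotv (e k) y ^+ 2)) =
    2 * (j == k)%:R.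
  rewrite RintegralB//; last by apply: eq_integrable (integrableD measurableT (isq _) (isq _)).
  rewrite RintegralD// !sq !(dotvDl, dotvDr) !dotv_delta !mxE !eqxx !andbT (eq_sym k j); ring.
have e2 : \int[gamma]_y ((y : 'cV[R]_d) j 0 * (y : 'cV[R]_d) k 0) = 2^-1 * \int[gamma]_y (dotv (e j + e k) y ^+ 2 - (dotv (e j) y ^+ 2 + dotv (e k) y ^+ 2)).
  rewrite -RintegralZl//; last first.
    apply: eq_integrable (integrableB measurableT (isq (e j + e k)) (integrableD measurableT (isq (e j)) (isq (e k)))) => //.
  by apply: eq_Rintegral => y _; rewrite dotvDl !dotv_delta; field.
by rewrite e2 h mulKf.
Qed.

Lemma integrable_coordM_stdgauss (j k : 'I_d) :
  gamma.-integrable setT (EFin \o (fun y : B1 => (y : 'cV[R]_d) j 0 * (y : 'cV[R]_d) k 0)).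
Proof.
have mc i : measurable_fun setT (fun y : B1 => (y : 'cV[R]_d) i 0) by exact: measurable_coord.
pose e i : 'cV[R]_d := delta_mx i 0.
have isq (u : 'cV[R]_d) := integrable_gaussf_sqr (@measurable_dotv R d u) (gaussf_stdgauss u).
apply: (le_abs_integrable _ (g := fun y : B1 => dotv (e j) y ^+ 2 + dotv (e k) y ^+ 2)).
- exact: measurable_funM.
- by apply: eq_integrable (integrableD measurableT (isq _) (isq _)).
- move=> y; rewrite !dotv_delta ler_norml.
  set a := _ j 0; set b := _ k 0.
  by apply/andP; split; nra.
Qed.

End gaussian_vectors.

(** * Taylor expansion of a function smoothed by N(0, s^2 I) *)

Section gaussian_smoothing.
Context {R : realType} {d : nat}.
Notation B1 := (mxBorel R d 1).
Notation gamma := (stdgauss d).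
Variables (p : \bar R) (L s : R) (f : 'cV[R]_d -> R).
Hypotheses (p1 : (1 <= p)%E) (L0 : 0 <= L) (s0 : 0 < s).
Hypotheses (f01 : forall x, 0 <= f x <= 1) (fL : forall x y, `|f x - f y| <= L * lpnorm p (x - y)).

Definition gsmooth x : R := \int[gamma]_z f (x + s *: z).

(** The gradient, and below it the Hessian, of [gsmooth], in the form where the derivatives have
    fallen on the Gaussian density: the weights are Hermite polynomials and [f] itself is not
    differentiated. *)
Definition gsmooth1 x j : R := s^-1 * \int[gamma]_z (f (x + s *: z) * (z : 'cV[R]_d) j 0).

Definition gsmooth2 x j k : R := s^-1 * (s^-1 * \int[gamma]_z (f (x + s *: z) *
  ((z : 'cV[R]_d) j 0 * (z : 'cV[R]_d) k 0 - (j == k)%:R))).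

Let mf : measurable_fun setT (f : B1 -> R). Proof. exact: (lipschitz_measurable p1 fL). Qed.

Let fn x : `|f x| <= 1. Proof. by have /andP[h0 h1] := f01 x; rewrite ger0_norm. Qed.

Let mfx x : measurable_fun setT (fun z : B1 => f (x + s *: (z : 'cV[R]_d))).
Proof. exact: (measurableT_comp (measurable_smooth s mf) (@pair1_measurable _ _ B1 B1 x)). Qed.

Let mc i : measurable_fun setT (fun y : B1 => (y : 'cV[R]_d) i 0). Proof. exact: measurable_coord. Qed.

Let le1_integrable (g : B1 -> R) x : gamma.-integrable setT (EFin \o g) ->
  gamma.-integrable setT (EFin \o (fun z : B1 => f (x + s *: (z : 'cV[R]_d)) * g z)).
Proof. exact: (integrable_bounded_mul 1). Qed.

Let imul1 x j : gamma.-integrable setT (EFin \o (fun z : B1 => f (x + s *: (z : 'cV[R]_d)) * (z : 'cV[R]_d) j 0)).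
Proof.
apply: le1_integrable; exact: (le_abs_integrable (mc j) (@integrable_coord_stdgauss R d j)).
Qed.

Let imul2 x j k : gamma.-integrable setT (EFin \o (fun z : B1 => f (x + s *: (z : 'cV[R]_d)) *
  ((z : 'cV[R]_d) j 0 * (z : 'cV[R]_d) k 0 - (j == k)%:R))).
Proof.
apply: le1_integrable; have h := integrable_coordM_stdgauss (R := R) j k.
by apply: eq_integrable (integrableB measurableT h (finite_measure_integrable_cst gamma (j == k)%:R measurableT)).
Qed.

Section along_a_line.
Variables (x h : 'cV[R]_d).
Let u := s^-1 *: h.
Let a : B1 -> R := dotv u.
Let b := dotv u u.
Let G0 (z : B1) : R := f (x + s *: (z : 'cV[R]_d)).

Let su : s *: u = h. Proof. by rewrite /u scalerA mulfV ?gt_eqF// scale1r. Qed.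

(** Moving the argument by [t h] amounts to moving the Gaussian vector by [t u] with [u = h / s];
    the Cameron-Martin formula then leaves [t] in the density only. *)
Lemma gsmooth_line t : gsmooth (x + t *: h) = \int[gamma]_z (G0 z * psi0 a b t z).
Proof.
have := stdgauss_cm_integral (t *: u) (mfx x).
rewrite [X in X = _ -> _](_ : _ = gsmooth (x + t *: h)); last first.
  apply: eq_Rintegral => z _; rewrite scalerDr scalerA mulrC -scalerA su.
  by rewrite -addrA (addrC (t *: h)).
move=> ->; apply: eq_Rintegral => z _; congr (_ * expR _).
rewrite /a /b (dotvZl z u t) (dotvZl (t *: u) u t) (dotvZr u u t); by field.
Qed.

Let second t (z : B1) : R := f (x + t *: h + s *: (z : 'cV[R]_d)) * (a z ^+ 2 - b).

(** The reverse shift: once the two derivatives are taken, [t] returns to the argument of [f], under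
    a weight free of [t], where the Lipschitz bound can act. *)
Lemma gsmooth_line2 t :
  \int[gamma]_z (G0 z * psi2 a b t z) = \int[gamma]_z second t z.
Proof.
have mk : measurable_fun setT (fun z : B1 => G0 z * ((a z - b * t) ^+ 2 - b)).
  apply: measurable_funM; first exact: mfx.
  apply: measurable_funB => //; apply: measurable_funX.
  by apply: measurable_funB => //; exact: measurable_dotv.
have := stdgauss_cm_integral (t *: u) mk.
rewrite [X in X = _ -> _](_ : _ = \int[gamma]_z second t z); last first.
  apply: eq_Rintegral => z _; rewrite /G0 /second scalerDr scalerA (mulrC s) -scalerA su.
  rewrite -addrA (addrC (t *: h)); congr (_ * (_ ^+ 2 - _)).
  by rewrite /a dotvDr dotvZr -/b; ring.
move=> ->; apply: eq_Rintegral => z _; rewrite -mulrA /psi2 /psi0; congr (_ * (_ * expR _)).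
rewrite /a /b (dotvZl z u t) (dotvZl (t *: u) u t) (dotvZr u u t); by field.
Qed.

Let isq := integrable_gaussf_sqr (@measurable_dotv R d u) (gaussf_stdgauss u).
Let ib : gamma.-integrable setT (EFin \o (fun=> b) : B1 -> \bar R).
Proof. exact: finite_measure_integrable_cst. Qed.

Let isec t : gamma.-integrable setT (EFin \o (second t : B1 -> R)).
Proof.
apply: (le_abs_integrable (g := fun z : B1 => a z ^+ 2 + b)).
- apply: measurable_funM => //; apply: measurable_funB => //; apply: measurable_funX.
  exact: measurable_dotv.
- by apply: eq_integrable (integrableD measurableT isq ib).
- move=> z; rewrite normrM -[leRHS]mul1r ler_pM// (le_trans (ler_normB _ _))//.
  by rewrite !ger0_norm ?sqr_ge0// dotv_ge0.
Qed.

(** The value of [f] moves by at most [L] times the p-norm of [h], and the weight [a^2 - b] has mean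
    absolute value at most [2 b], since [a^2] has mean [b]. *)
Lemma second_lipschitz t : 0 <= t <= 1 ->
  `|\int[gamma]_z second t z - \int[gamma]_z second 0 z| <= 2 * L * lpnorm p h * b.
Proof.
move=> /andP[t0 t1]; have b0 : 0 <= b by exact: dotv_ge0.
have c0 : 0 <= L * lpnorm p h by rewrite mulr_ge0// lpnorm_ge0.
have iab : gamma.-integrable setT (EFin \o (fun z : B1 => a z ^+ 2 + b)).
  by apply: eq_integrable (integrableD measurableT isq ib).
have -> : 2 * L * lpnorm p h * b = \int[gamma]_z (L * lpnorm p h * (a z ^+ 2 + b)).
  rewrite RintegralZl// RintegralD// Rintegral_cstP.
  by rewrite (gaussf_var (@measurable_dotv R d u) (gaussf_stdgauss u)) -/b; ring.
apply: Rintegral_dist_le => //; first exact: integrable_mulc.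
move=> z; rewrite /second -mulrBl normrM ler_pM//.
  rewrite (le_trans (fL _ _))// ler_wpM2l// scale0r addr0.
  rewrite (_ : _ - _ = t *: h); last by rewrite opprD addrACA subrr addr0 addrAC subrr add0r.
  by rewrite lpnormZ// ler_piMl// lpnorm_ge0.
by rewrite (le_trans (ler_normB _ _))// !ger0_norm ?sqr_ge0.
Qed.

Lemma gsmooth1_line : \int[gamma]_z (G0 z * psi1 a b 0 z) = \sum_j h j 0 * gsmooth1 x j.
Proof.
transitivity (\int[gamma]_z \sum_j (h j 0 * s^-1 * (f (x + s *: z) * (z : 'cV[R]_d) j 0))).
  apply: eq_Rintegral => z _; rewrite /psi1 /psi0 mul0r !mulr0 subr0 expr0n/= mulr0 mul0r subrr expR0 mulr1.
  rewrite /a dotvE mulr_sumr; apply: eq_bigr => j _; rewrite /G0 /u mxE; ring.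
rewrite Rintegral_sum; last first.
  by move=> j; exact: integrable_mulc.
by apply: eq_bigr => j _; rewrite RintegralZl// /gsmooth1 mulrA.
Qed.

Lemma gsmooth2_line : \int[gamma]_z second 0 z = \sum_j \sum_k h j 0 * h k 0 * gsmooth2 x j k.
Proof.
transitivity (\int[gamma]_z \sum_j \sum_k (h j 0 * h k 0 * (s^-1 * s^-1) * (f (x + s *: z) *
  ((z : 'cV[R]_d) j 0 * (z : 'cV[R]_d) k 0 - (j == k)%:R)))).
  apply: eq_Rintegral => z _; rewrite /second scale0r addr0.
  transitivity (\sum_j \sum_k f (x + s *: z) * (u j 0 * u k 0 * ((z : 'cV[R]_d) j 0 * (z : 'cV[R]_d) k 0 - (j == k)%:R))).
    under eq_bigr do rewrite -mulr_sumr; rewrite -mulr_sumr; congr (_ * _).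
    rewrite expr2 /a dotvE big_distrlr/= /b dotvE -sumrB; apply: eq_bigr => j _.
    rewrite [X in _ - X](_ : _ = \sum_k u j 0 * u k 0 * (j == k)%:R); last first.
      rewrite (bigD1 j)//= eqxx mulr1 big1 ?addr0// => k kj.
      by rewrite eq_sym (negbTE kj) mulr0.
    by rewrite -sumrB; apply: eq_bigr => k _; ring.
  by apply: eq_bigr => j _; apply: eq_bigr => k _; rewrite /u !mxE; ring.
have i2 j k : gamma.-integrable setT (EFin \o (fun z : B1 => h j 0 * h k 0 * (s^-1 * s^-1) * (f (x + s *: (z : 'cV[R]_d)) *
  ((z : 'cV[R]_d) j 0 * (z : 'cV[R]_d) k 0 - (j == k)%:R)))).
  exact: integrable_mulc.
rewrite Rintegral_sum; last first.
  by move=> j; apply: integrable_sumr => k; exact: i2.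
apply: eq_bigr => j _; rewrite Rintegral_sum//; apply: eq_bigr => k _.
by rewrite RintegralZl// /gsmooth2; ring.
Qed.

Lemma gsmooth_taylor : `|gsmooth (x + h) - gsmooth x - \sum_j h j 0 * gsmooth1 x j
    - (\sum_j \sum_k h j 0 * h k 0 * gsmooth2 x j k) / 2|
  <= 2 * L / s ^+ 2 * (dotv h h * lpnorm p h).
Proof.
have ma : measurable_fun setT (a : B1 -> R) by exact: measurable_dotv.
have ga := gaussf_stdgauss u.
have d0 t := is_derive_Phi0 ma ga (mfx x) (fun z => fn _) t.
have d1 t := is_derive_Phi1 ma ga (mfx x) (fun z => fn _) t.
have := taylor2 d0 d1 (C := 2 * L * lpnorm p h * b).
rewrite -/G0 -!gsmooth_line !gsmooth_line2 scale1r scale0r addr0 -gsmooth1_line -gsmooth2_line.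
move=> H; apply: le_trans (H _) _.
  by move=> t t01; rewrite !gsmooth_line2; exact: second_lipschitz.
by rewrite le_eqVlt; apply/orP; left; apply/eqP; rewrite /b /u dotvZl dotvZr; field; rewrite gt_eqF.
Qed.

End along_a_line.

Lemma gsmooth_bounds x : 0 <= gsmooth x <= 1.
Proof. exact: Rintegral_bounds. Qed.

Let gsmoothM_le (g : B1 -> R) x : gamma.-integrable setT (EFin \o g) ->
  `|\int[gamma]_z (f (x + s *: z) * g z)| <= \int[gamma]_z `|g z|.
Proof.
move=> ig; apply: le_trans (le_normr_Rintegral measurableT (le1_integrable x ig)) _.
apply: ler_Rintegral.
- by have := integrable_norm (le1_integrable x ig); apply: eq_integrable.
- by have := integrable_norm ig; apply: eq_integrable.
- by move=> z; rewrite normrM ler_piMl.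
Qed.

(** The right-hand side involves neither [f] nor [x], so the bound remains available at a random
    covariance and a random position. *)
Lemma gsmooth1_bound x j : `|gsmooth1 x j| <= s^-1 * \int[gamma]_z `|(z : 'cV[R]_d) j 0|.
Proof.
rewrite normrM normfV (gtr0_norm s0) ler_wpM2l ?invr_ge0 ?(ltW s0)//.
apply: gsmoothM_le; exact: (le_abs_integrable (mc j) (@integrable_coord_stdgauss R d j)).
Qed.

Lemma gsmooth2_bound x j k : `|gsmooth2 x j k| <=
  s^-1 * (s^-1 * \int[gamma]_z `|(z : 'cV[R]_d) j 0 * (z : 'cV[R]_d) k 0 - (j == k)%:R|).
Proof.
have si0 : 0 <= s^-1 by rewrite invr_ge0 (ltW s0).
rewrite normrM normfV (gtr0_norm s0) ler_wpM2l// normrM normfV (gtr0_norm s0) ler_wpM2l//.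
apply: gsmoothM_le; have h := integrable_coordM_stdgauss (R := R) j k.
by apply: eq_integrable (integrableB measurableT h (finite_measure_integrable_cst gamma (j == k)%:R measurableT)).
Qed.

End gaussian_smoothing.

Section gaussian_mixture.
Context {R : realType} {d : nat}.
Notation B1 := (mxBorel R d 1).
Notation Bd := (mxBorel R d d).
Notation gamma := (stdgauss d).
Variables (p : \bar R) (L s : R) (g : 'cV[R]_d -> R).
Hypotheses (p1 : (1 <= p)%E) (L0 : 0 < L) (s0 : 0 < s).
Hypotheses (g01 : forall x, 0 <= g x <= 1) (gL : forall x y, `|g x - g y| <= L * lpnorm p (x - y)).

Definition gmix (B : 'M[R]_d) x : R := \int[gamma]_y g (x + B *m y).

Let mg : measurable_fun setT (g : B1 -> R). Proof. exact: (lipschitz_measurable p1 gL). Qed.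

Lemma measurable_mulmxpair : measurable_fun setT
  ((fun z => (z.1.2 : 'cV[R]_d) + (z.1.1 : 'M[R]_d) *m (z.2 : 'cV[R]_d)) : (Bd * B1) * B1 -> B1).
Proof.
apply: measurable_addmx.
  exact: (measurableT_comp (@measurable_snd _ _ Bd B1) (@measurable_fst _ _ _ B1)).
apply: measurable_mulmx; last exact: measurable_snd.
exact: (measurableT_comp (@measurable_fst _ _ Bd B1) (@measurable_fst _ _ _ B1)).
Qed.

Lemma measurable_gmix2 : measurable_fun setT (fun Bx : Bd * B1 => gmix Bx.1 Bx.2).
Proof.
apply: (measurable_Rintegral_param (T1 := (Bd * B1)%type) gamma
  (f := fun Bx y => g ((Bx.2 : 'cV[R]_d) + (Bx.1 : 'M[R]_d) *m y))).
exact: (measurableT_comp mg measurable_mulmxpair).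
Qed.

Let mgB B x : measurable_fun setT (fun y : B1 => g (x + B *m (y : 'cV[R]_d))).
Proof.
exact: (measurableT_comp (measurableT_comp mg measurable_mulmxpair) (@pair1_measurable _ _ (Bd * B1)%type B1 (B, x))).
Qed.

Let gB_integrable B x : gamma.-integrable setT (EFin \o (fun y : B1 => g (x + B *m (y : 'cV[R]_d)))).
Proof. by apply: (bounded_integrable 1) => // y; have /andP[h0 h1] := g01 (x + B *m y); rewrite ger0_norm. Qed.

Lemma gmix01 B x : 0 <= gmix B x <= 1.
Proof. exact: Rintegral_bounds. Qed.

Lemma gmix_lip B x y : `|gmix B x - gmix B y| <= L * lpnorm p (x - y).
Proof.
rewrite -[leRHS](Rintegral_cstP gamma); apply: Rintegral_dist_le => //.
  exact: finite_measure_integrable_cst.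
move=> z; apply: le_trans (gL _ _) _.
by rewrite opprD addrACA subrr addr0.
Qed.

(* smix Q x is the expectation of g (x + N(0, Q + s^2)); the component N(0, s^2)
   carries the derivatives, bounded uniformly in Q. *)
Definition smix Q x : R := gsmooth s (gmix (mxsqrt Q)) x.
Definition smix1 Q x j : R := gsmooth1 s (gmix (mxsqrt Q)) x j.
Definition smix2 Q x j k : R := gsmooth2 s (gmix (mxsqrt Q)) x j k.

Definition cubic (h : 'cV[R]_d) : R := dotv h h * lpnorm p h.

Lemma cubic_ge0 h : 0 <= cubic h.
Proof. by rewrite mulr_ge0 ?dotv_ge0// lpnorm_ge0. Qed.

Lemma measurable_cubic : measurable_fun setT (cubic : B1 -> R).
Proof.
apply: measurable_funM; last exact: measurable_lpnorm.
under eq_fun do rewrite dotvE.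
by apply: measurable_sum => i; apply: measurable_funM; exact: measurable_coord.
Qed.

Let measurable_gmix_shift : measurable_fun setT
  (fun z : (Bd * B1) * B1 => gmix (mxsqrt (z.1.1 : 'M[R]_d)) ((z.1.2 : 'cV[R]_d) + s *: (z.2 : 'cV[R]_d))).
Proof.
have mp : measurable_fun setT ((fun z => (mxsqrt (z.1.1 : 'M[R]_d), (z.1.2 : 'cV[R]_d) + s *: (z.2 : 'cV[R]_d))) : (Bd * B1) * B1 -> Bd * B1).
  apply: measurable_fun_pair.
    apply: (measurableT_comp (@measurable_mxsqrt R d)).
    exact: (measurableT_comp (@measurable_fst _ _ Bd B1) (@measurable_fst _ _ _ B1)).
  apply: measurable_addmx.
    exact: (measurableT_comp (@measurable_snd _ _ Bd B1) (@measurable_fst _ _ _ B1)).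
  by apply: measurable_scalemx; [exact: measurable_cst|exact: measurable_snd].
exact: (measurableT_comp measurable_gmix2 mp).
Qed.

Lemma measurable_smix : measurable_fun setT (fun Qx : Bd * B1 => smix Qx.1 Qx.2).
Proof.
exact: (measurable_Rintegral_param (T1 := (Bd * B1)%type) gamma
  (f := fun Qx z => gmix (mxsqrt (Qx.1 : 'M[R]_d)) ((Qx.2 : 'cV[R]_d) + s *: (z : 'cV[R]_d)))).
Qed.

Let mcoord2 j : measurable_fun setT (fun z : (Bd * B1) * B1 => (z.2 : 'cV[R]_d) j 0).
Proof. exact: (measurableT_comp (@measurable_coord R d 1 j 0) (@measurable_snd _ _ _ B1)). Qed.

Lemma measurable_smix1 j : measurable_fun setT (fun Qx : Bd * B1 => smix1 Qx.1 Qx.2 j).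
Proof.
apply: measurable_funM => //; apply: (measurable_Rintegral_param (T1 := (Bd * B1)%type) gamma
  (f := fun Qx z => gmix (mxsqrt (Qx.1 : 'M[R]_d)) ((Qx.2 : 'cV[R]_d) + s *: (z : 'cV[R]_d)) * (z : 'cV[R]_d) j 0)).
exact: (measurable_funM measurable_gmix_shift (mcoord2 j)).
Qed.

Lemma measurable_smix2 j k : measurable_fun setT (fun Qx : Bd * B1 => smix2 Qx.1 Qx.2 j k).
Proof.
apply: measurable_funM => //; apply: measurable_funM => //.
apply: (measurable_Rintegral_param (T1 := (Bd * B1)%type) gamma
  (f := fun Qx z => gmix (mxsqrt (Qx.1 : 'M[R]_d)) ((Qx.2 : 'cV[R]_d) + s *: (z : 'cV[R]_d)) *
   ((z : 'cV[R]_d) j 0 * (z : 'cV[R]_d) k 0 - (j == k)%:R))).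
apply: (measurable_funM measurable_gmix_shift); apply: measurable_funB => //.
exact: (measurable_funM (mcoord2 j) (mcoord2 k)).
Qed.

Section measurable_composition.
Context d0 {T0 : measurableType d0} (fQ : T0 -> Bd) (fx : T0 -> B1).
Hypotheses (mfQ : measurable_fun setT fQ) (mfx : measurable_fun setT fx).

Let mQx : measurable_fun setT (fun w => (fQ w, fx w)). Proof. exact: measurable_fun_pair. Qed.

Lemma measurable_smix_comp : measurable_fun setT (fun w => smix (fQ w) (fx w)).
Proof. exact: (measurableT_comp measurable_smix mQx). Qed.

Lemma measurable_smix1_comp j : measurable_fun setT (fun w => smix1 (fQ w) (fx w) j).
Proof. exact: (measurableT_comp (measurable_smix1 j) mQx). Qed.

Lemma measurable_smix2_comp j k : measurable_fun setT (fun w => smix2 (fQ w) (fx w) j k).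
Proof. exact: (measurableT_comp (measurable_smix2 j k) mQx). Qed.

End measurable_composition.

Lemma smix_bounds Q x : 0 <= smix Q x <= 1.
Proof. by apply: (gsmooth_bounds s p1); [exact: gmix01|exact: gmix_lip]. Qed.

Lemma smix1_bound j : exists c, forall Q x, `|smix1 Q x j| <= c.
Proof.
eexists => Q x; apply: (gsmooth1_bound p1 s0); [exact: gmix01|exact: gmix_lip].
Qed.

Lemma smix2_bound j k : exists c, forall Q x, `|smix2 Q x j k| <= c.
Proof.
eexists => Q x; apply: (gsmooth2_bound p1 s0); [exact: gmix01|exact: gmix_lip].
Qed.

Lemma smix_taylor Q x h : `|smix Q (x + h) - smix Q x - \sum_j h j 0 * smix1 Q x j
    - (\sum_j \sum_k h j 0 * h k 0 * smix2 Q x j k) / 2| <= 2 * L / s ^+ 2 * cubic h.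
Proof. by apply: (gsmooth_taylor p1 (ltW L0) s0); [exact: gmix01|exact: gmix_lip]. Qed.

Lemma smixE Q x : smix Q x = \int[gamma]_y gsmooth s g (x + mxsqrt Q *m y).
Proof.
rewrite /smix /gsmooth /gmix.
rewrite (Rintegral_swap gamma gamma (f := fun z y => g (x + s *: (z : 'cV[R]_d) + mxsqrt Q *m (y : 'cV[R]_d))) (c := 1)).
- by apply: eq_Rintegral => y _; apply: eq_Rintegral => z _; rewrite addrAC.
- apply: (measurableT_comp mg); apply: measurable_addmx.
    apply: measurable_addmx; first exact: measurable_cst.
    by apply: measurable_scalemx; [exact: measurable_cst|exact: measurable_fst].
  exact: (measurableT_comp (measurable_mulv _) (@measurable_snd _ _ B1 B1)).
- by move=> z y; exact: g01.
Qed.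

Lemma measurable_gsmooth : measurable_fun setT (gsmooth s g : B1 -> R).
Proof.
exact: (measurable_Rintegral_param (T1 := B1) gamma (f := fun x z => g (x + s *: z)) (measurable_smooth s mg)).
Qed.

Lemma smixD Q V x : psd Q -> psd V ->
  \int[gamma]_y smix Q (x + mxsqrt V *m y) = smix (Q + V) x.
Proof.
move=> pQ pV; rewrite smixE.
rewrite -(normvD (k := fun v => gsmooth s g (x + v)) (c := 1) pQ pV).
- by apply: eq_Rintegral => y _; rewrite smixE; apply: eq_Rintegral => y' _; rewrite addrA.
- apply: (measurableT_comp measurable_gsmooth); apply: measurable_addmx; first exact: measurable_cst.
  exact: measurable_id.
- by move=> v; exact: (gsmooth_bounds s p1 g01 gL).
Qed.

Section quadratic_forms.
Variables (B : 'M[R]_d).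

Let coordE (c : 'I_d -> 'I_d -> R) (y : 'cV[R]_d) j k : (B *m y) j 0 * (B *m y) k 0 * c j k =
  \sum_l \sum_m (B j l * B k m * c j k) * (y l 0 * y m 0).
Proof.
rewrite !mxE big_distrlr/= mulr_suml; apply: eq_bigr => l _.
by rewrite mulr_suml; apply: eq_bigr => m _; ring.
Qed.

Let integrable_coordM (c : 'I_d -> 'I_d -> R) j k : gamma.-integrable setT
  (EFin \o (fun y : B1 => (B *m (y : 'cV[R]_d)) j 0 * (B *m (y : 'cV[R]_d)) k 0 * c j k)).
Proof.
rewrite (_ : (fun y => _) = (fun y : B1 => \sum_l \sum_m (B j l * B k m * c j k) * ((y : 'cV[R]_d) l 0 * (y : 'cV[R]_d) m 0))).
  do 2!(apply: integrable_sumr => ?); apply: integrable_mulc; exact: integrable_coordM_stdgauss.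
by apply/funext => y; rewrite coordE.
Qed.

Lemma integrable_quadratic (c : 'I_d -> 'I_d -> R) : gamma.-integrable setT
  (EFin \o (fun y : B1 => \sum_j \sum_k (B *m (y : 'cV[R]_d)) j 0 * (B *m (y : 'cV[R]_d)) k 0 * c j k)).
Proof. by apply: integrable_sumr => j; apply: integrable_sumr => k. Qed.

Lemma Rintegral_quadratic (c : 'I_d -> 'I_d -> R) :
  \int[gamma]_y (\sum_j \sum_k (B *m y) j 0 * (B *m y) k 0 * c j k) =
  \sum_j \sum_k (B *m B^T) j k * c j k.
Proof.
have icM := @integrable_coordM_stdgauss R d.
rewrite Rintegral_sum; last by move=> j; apply: integrable_sumr => k.
apply: eq_bigr => j _; rewrite Rintegral_sum//; apply: eq_bigr => k _.
under eq_Rintegral do rewrite coordE.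
rewrite Rintegral_sum; last by move=> l; apply: integrable_sumr => m; exact: integrable_mulc.
rewrite mxE mulr_suml; apply: eq_bigr => l _; rewrite mxE.
rewrite Rintegral_sum; last by move=> m; exact: integrable_mulc.
rewrite (eq_bigr (fun m => B j l * B k m * c j k * (l == m)%:R)); last first.
  by move=> m _; rewrite RintegralZl// stdgauss_cov.
rewrite (bigD1 l)//= eqxx mulr1 big1 ?addr0// => m ml.
by rewrite eq_sym (negbTE ml) mulr0.
Qed.

Let linearE (c : 'I_d -> R) y : \sum_j (B *m y) j 0 * c j = dotv (B^T *m \col_j c j) y.
Proof.
rewrite -dotv_mulmx dotvC dotvE.
by apply: eq_bigr => j _; rewrite [in RHS]mxE.
Qed.

Lemma integrable_linear (c : 'I_d -> R) : gamma.-integrable setT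
  (EFin \o (fun y : B1 => \sum_j (B *m (y : 'cV[R]_d)) j 0 * c j)).
Proof.
under eq_fun do rewrite linearE.
exact: (integrable_gaussf (@measurable_dotv R d _) (gaussf_stdgauss _)).
Qed.

Lemma Rintegral_linear (c : 'I_d -> R) : \int[gamma]_y (\sum_j (B *m y) j 0 * c j) = 0.
Proof.
under eq_Rintegral do rewrite linearE.
exact: (gaussf_mean (@measurable_dotv R d _) (gaussf_stdgauss _)).
Qed.

End quadratic_forms.

(** The lower Taylor bound at [h = V^(1/2) y], averaged over standard Gaussian [y]: the linear term
    has mean zero, the quadratic one has covariance [V], and the average of [smix Q] is
    [smix (Q + V)]. An infinite cubic moment makes the claim trivial. *)
Lemma smixD_ge Q V x : psd Q -> psd V ->
  ((smix Q x + (\sum_j \sum_k V j k * smix2 Q x j k) / 2)%:E <=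
   (smix (Q + V) x)%:E + (2 * L / s ^+ 2)%:E * \int[gamma]_y (cubic (mxsqrt V *m y))%:E)%E.
Proof.
move=> pQ pV; set c := 2 * L / s ^+ 2.
have c0 : 0 < c by rewrite divr_gt0 ?exprn_gt0// mulr_gt0.
have mk : measurable_fun setT (fun y : B1 => cubic (mxsqrt V *m (y : 'cV[R]_d))).
  by apply: (measurableT_comp measurable_cubic); exact: measurable_mulv.
have k0 y : (0 <= (cubic (mxsqrt V *m y))%:E)%E by rewrite lee_fin cubic_ge0.
have I0 : (0 <= \int[gamma]_y (cubic (mxsqrt V *m y))%:E)%E by apply: integral_ge0.
have [Ioo|Ioo] := eqVneq (\int[gamma]_y (cubic (mxsqrt V *m y))%:E)%E +oo%E.
  by rewrite Ioo mulry gtr0_sg// mul1e addey// leey.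
have ik : gamma.-integrable setT (EFin \o (fun y : B1 => cubic (mxsqrt V *m (y : 'cV[R]_d)))).
  apply/integrableP; split; first exact/measurable_EFinP.
  rewrite (_ : (\int[gamma]_x _)%E = (\int[gamma]_y (cubic (mxsqrt V *m y))%:E)%E) ?ltey//.
  by apply: eq_integral => y _; exact: (gee0_abs (k0 y)).
rewrite EFin_Rintegral// -EFinM -EFinD lee_fin -smixD// -RintegralZl//.
have is_ : gamma.-integrable setT (EFin \o (fun y : B1 => smix Q (x + mxsqrt V *m (y : 'cV[R]_d)))).
  apply: (bounded_integrable 1).
    apply: (measurable_smix_comp (measurable_cst _)); apply: measurable_addmx; first exact: measurable_cst.
    exact: measurable_mulv.
  by move=> y; have /andP[h0 h1] := smix_bounds Q (x + mxsqrt V *m y); rewrite ger0_norm.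
rewrite -[leRHS](RintegralD measurableT is_ (integrable_mulc c ik)).
have ic : gamma.-integrable setT (EFin \o (fun=> smix Q x) : B1 -> \bar R) by exact: finite_measure_integrable_cst.
have il := integrable_linear (mxsqrt V) (smix1 Q x).
have iq := integrable_mulc 2^-1 (integrable_quadratic (mxsqrt V) (smix2 Q x)).
have icl : gamma.-integrable setT (EFin \o (fun y : B1 => smix Q x + \sum_j (mxsqrt V *m (y : 'cV[R]_d)) j 0 * smix1 Q x j)).
  by apply: eq_integrable (integrableD measurableT ic il).
have e : smix Q x + (\sum_j \sum_k V j k * smix2 Q x j k) / 2 =
  \int[gamma]_y (smix Q x + (\sum_j (mxsqrt V *m (y : 'cV[R]_d)) j 0 * smix1 Q x j) +
    2^-1 * (\sum_j \sum_k (mxsqrt V *m (y : 'cV[R]_d)) j 0 * (mxsqrt V *m (y : 'cV[R]_d)) k 0 * smix2 Q x j k)).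
  rewrite (RintegralD measurableT icl iq) (RintegralD measurableT ic il).
  rewrite (RintegralZl 2^-1 measurableT (integrable_quadratic (mxsqrt V) (smix2 Q x))).
  by rewrite Rintegral_cstP Rintegral_linear addr0 Rintegral_quadratic (mxsqrt_gram pV) mulrC.
rewrite [leLHS]e; apply: ler_Rintegral.
- by apply: eq_integrable (integrableD measurableT icl iq).
- by apply: eq_integrable (integrableD measurableT is_ (integrable_mulc c ik)).
- move=> y; have := smix_taylor Q x (mxsqrt V *m y); rewrite ler_norml => /andP[h _].
  rewrite -/c in h; move: h; set A := \sum_j _; set B := \sum_j _; set S := smix _ _; set S' := smix _ _.
  set k := cubic _; move=> h; lra.
Qed.

End gaussian_mixture.

(** * Conditional expectations *)

Section sub_sigma_algebras.
Context d d' {T : measurableType d} {U : measurableType d'}.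
Implicit Types G : set (set T).

Lemma sub_measurableP G (f : T -> U) : sigma_algebra setT G ->
  sub_measurable G f <-> measurable_fun setT (f : g_sigma_algebraType G -> U).
Proof.
move=> sG; have GE (A : set (g_sigma_algebraType G)) : measurable A = G A.
  by rewrite /measurable/= sigma_algebra_id.
split=> [mf _ B mB|mf B mB]; first by rewrite setTI GE; exact: mf.
by have := mf measurableT B mB; rewrite setTI GE.
Qed.

Lemma measurable_fun_widen d1 (T' : measurableType d1) (G : set (set T')) (f : T' -> U) :
  G `<=` measurable ->
  measurable_fun setT (f : g_sigma_algebraType G -> U) -> measurable_fun setT f.
Proof.
move=> Gm mf _ B mB; have := mf measurableT B mB; rewrite setTI.
apply: smallest_sub => //; exact: sigma_algebra_measurable.
Qed.

End sub_sigma_algebras.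

Lemma measurable_fun_widen2 d d' {T : measurableType d} {U : measurableType d'} (G G' : set (set T)) (f : T -> U) :
  G `<=` G' -> measurable_fun setT (f : g_sigma_algebraType G -> U) ->
  measurable_fun setT (f : g_sigma_algebraType G' -> U).
Proof.
move=> GG' mf _ B mB; have := mf measurableT B mB; rewrite setTI.
by apply: sub_smallest2r => //; exact: smallest_sigma_algebra.
Qed.

Section layers.
Context {R : realType}.

(* The sum is the integer part of t. *)
Lemma layer_sum_bounds m (t : R) : 0 <= t <= m%:R ->
  t - 1 <= \sum_(k < m) ((k.+1%:R <= t)%R)%:R <= t.
Proof.
elim: m => [|m ih] /andP[t0 tm].
  by rewrite mulr0n in tm; rewrite big_ord0; apply/andP; split; lra.
rewrite big_ord_recr/=; have [tm'|mt] := leP t m%:R.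
  have := ih _; rewrite t0 tm' => /(_ isT).
  rewrite (_ : (m.+1%:R <= t) = false) ?addr0//; apply/negbTE; rewrite -ltNge.
  by rewrite (le_lt_trans tm')// ltr_nat.
rewrite (eq_bigr (fun=> 1)) => [|k _]; last first.
  by rewrite (_ : (k.+1%:R <= t) = true)// (le_trans _ (ltW mt))// ler_nat.
rewrite sumr_const card_ord -[1 *+ m]/(m%:R); case: (leP m.+1%:R t) => [mt1|_] /=.
  by rewrite -natr1 in mt1 tm *; apply/andP; split; lra.
by rewrite -natr1 in tm *; apply/andP; split; lra.
Qed.

End layers.

Section conditional_expectation.
Context {R : realType} d {T : measurableType d} (P : probability T R).
Variables (G : set (set T)) (sG : sigma_algebra setT G) (GT : G `<=` measurable).
Notation TG := (g_sigma_algebraType G).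

Let G_of (A : set TG) : measurable A -> G A.
Proof. by rewrite /measurable/= sigma_algebra_id. Qed.

Section orthogonal.
Variables (h : T -> R) (ih : P.-integrable setT (EFin \o h)).
Hypothesis h0 : forall A, G A -> (\int[P]_(w in A) (h w)%:E = 0)%E.

Let h0_indic A : G A -> \int[P]_w (\1_A w * h w) = 0.
Proof.
move=> GA; rewrite /Rintegral -[RHS]/(fine 0) -(h0 GA) [in RHS]integral_mkcond; congr fine.
apply: eq_integral => w _; rewrite patchE indicE.
by case: ifPn => _; rewrite ?mul1r ?mul0r.
Qed.

Let mh : measurable_fun setT h. Proof. by apply/measurable_EFinP; case/integrableP: ih. Qed.

(** Up to an error [1 / (m + 1)], [phi] is the average of the indicators of its upper level sets
    [E k]. These belong to [G], hence each indicator is orthogonal to [h]. *)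
Let orthogonal01 (phi : T -> R) : measurable_fun setT (phi : TG -> R) ->
  (forall w, 0 <= phi w <= 1) -> \int[P]_w (phi w * h w) = 0.
Proof.
move=> mphi phi01.
have mphiT : measurable_fun setT phi by exact: (measurable_fun_widen GT mphi).
pose I := \int[P]_w `|h w|.
have ihn : P.-integrable setT (EFin \o (fun w => `|h w|)).
  by have := integrable_norm ih; apply: eq_integrable.
have iph : P.-integrable setT (EFin \o (fun w => phi w * h w)).
  apply: (integrable_bounded_mul 1) => // w.
  by have /andP[p0 p1] := phi01 w; rewrite ger0_norm.
have key m : `|\int[P]_w (phi w * h w)| <= m.+1%:R^-1 * I.
  have m0 : 0 < m.+1%:R :> R by rewrite ltr0n.
  pose E (k : 'I_m.+1) : set T := [set w | k.+1%:R <= m.+1%:R * phi w].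
  have GE k : G (E k).
    apply: G_of; rewrite -[X in measurable X]setTI.
    apply: (@measurable_fun_ler _ TG _ _ (cst k.+1%:R) (fun w => m.+1%:R * phi w)) => //.
    exact: measurable_funM.
  have mE k : measurable (E k) by exact/GT/GE.
  have iE k : P.-integrable setT (EFin \o (fun w => \1_(E k) w * h w)).
    by apply: (integrable_bounded_mul 1) => //; exact: indic_le1.
  have iS : P.-integrable setT (EFin \o (fun w => m.+1%:R^-1 * \sum_(k < m.+1) \1_(E k) w * h w)).
    by apply: integrable_mulc; exact: integrable_sumr.
  have S0 : \int[P]_w (m.+1%:R^-1 * \sum_(k < m.+1) \1_(E k) w * h w) = 0.
    rewrite RintegralZl//; last exact: integrable_sumr.
    by rewrite Rintegral_sum// big1 ?mulr0// => k _; exact: h0_indic.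
  rewrite -[X in `|X|]subr0 -S0 /I -RintegralZl//.
  apply: Rintegral_dist_le => //; first exact: integrable_mulc.
  move=> w; rewrite -mulr_suml mulrA -mulrBl normrM ler_wpM2r//.
  have /andP[p0 p1] := phi01 w.
  have := @layer_sum_bounds R m.+1 (m.+1%:R * phi w).
  rewrite mulr_ge0// ler_piMr// => /(_ isT).
  rewrite [X in _ <= X <= _](_ : _ = \sum_(k < m.+1) \1_(E k) w); last first.
    apply: eq_bigr => k _; rewrite indicE /E; congr ((nat_of_bool _)%:R).
    by apply/idP/idP => [?|/set_mem//]; exact/mem_set.
  move=> /andP[a1 a2]; rewrite -(ler_pM2l m0) mulfV ?gt_eqF//.
  rewrite -[X in X * _](gtr0_norm m0) -normrM mulrBr mulrA mulfV ?gt_eqF// mul1r.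
  by rewrite ger0_norm; lra.
have I0 : 0 <= I by exact: Rintegral_ge0.
apply/eqP; rewrite -normr_le0; apply/ler_addgt0Pl => e e0; rewrite addr0.
have eI : 0 < e / (I + 1) by rewrite divr_gt0// ltr_wpDl.
have [N _ /(_ N (leqnn N)) /= NN] := near_infty_natSinv_lt (PosNum eI).
apply: le_trans (key N) _; apply: (@le_trans _ _ (e / (I + 1) * I)).
  by rewrite ler_wpM2r// ltW.
by rewrite mulrAC -mulrA ler_piMr ?(ltW e0)// ler_pdivrMr ?mul1r ?lerDl// ltr_wpDl.
Qed.

Lemma orthogonal_bounded (phi : T -> R) c : measurable_fun setT (phi : TG -> R) ->
  (forall w, `|phi w| <= c) -> \int[P]_w (phi w * h w) = 0.
Proof.
move=> mphi phic.
have c0 : 0 <= c by exact: le_trans (phic point).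
(* [psi] is an affine image of [phi] with values in [0, 1]; taking [c + 1] in place of [c] keeps [k]
   positive when [c] is 0. *)
pose k := 2 * (c + 1); have k0 : 0 < k by rewrite mulr_gt0// ltr_wpDl.
pose psi w := (phi w + (c + 1)) / k.
have mpsi : measurable_fun setT (psi : TG -> R).
  by apply: measurable_funM => //; exact: measurable_funD.
have psi01 w : 0 <= psi w <= 1.
  have := phic w; rewrite ler_norml => /andP[h1 h2].
  rewrite /psi divr_ge0 ?(ltW k0) ?ler_pdivrMr// ?mul1r /k; last lra.
  by lra.
have psi_h : \int[P]_w (psi w * h w) = 0 by exact: orthogonal01.
have one_h : \int[P]_w (1 * h w) = 0.
  by apply: (orthogonal01 (phi := fun=> 1)) => // w; rewrite ler01 lexx.
have i1 : P.-integrable setT (EFin \o (fun w => 1 * h w)).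
  exact: integrable_mulc.
have ipsi : P.-integrable setT (EFin \o (fun w => psi w * h w)).
  apply: (integrable_bounded_mul 1) => // [|w]; first exact: (measurable_fun_widen GT mpsi).
  by have /andP[p0 p1] := psi01 w; rewrite ger0_norm.
transitivity (\int[P]_w (k * (psi w * h w) - (c + 1) * (1 * h w))).
  by apply: eq_Rintegral => w _; rewrite /psi; field; rewrite gt_eqF.
rewrite RintegralB//; last 2 first.
- exact: integrable_mulc.
- exact: integrable_mulc.
by rewrite (RintegralZl k measurableT ipsi) (RintegralZl (c + 1) measurableT i1) psi_h one_h !mulr0 subrr.
Qed.

End orthogonal.

(** The difference [f - g] integrates to zero over every set of [G], hence is orthogonal to all
    bounded [G]-measurable functions. *)
Lemma cond_exp_mul (f g phi : T -> R) c : cond_exp P G f g ->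
  measurable_fun setT (phi : TG -> R) -> (forall w, `|phi w| <= c) ->
  \int[P]_w (phi w * f w) = \int[P]_w (phi w * g w).
Proof.
move=> [fi gi _ fg] mphi phic.
have hi : P.-integrable setT (EFin \o (fun w => f w - g w)).
  by apply: eq_integrable (integrableB measurableT fi gi).
have imul (k : T -> R) : P.-integrable setT (EFin \o k) -> P.-integrable setT (EFin \o (fun w => phi w * k w)).
  by apply: (integrable_bounded_mul c) => //; exact: (measurable_fun_widen GT mphi).
apply/eqP; rewrite -subr_eq0 -RintegralB//; [|exact: imul|exact: imul].
under eq_Rintegral do rewrite -mulrBr.
apply/eqP; apply: (orthogonal_bounded hi _ mphi phic) => A GA.
have mA := GT GA.
transitivity (\int[P]_(w in A) ((f w)%:E - (g w)%:E))%E; first by apply: eq_integral.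
have fA := integrableS measurableT mA (@subsetT _ _) fi.
have gA := integrableS measurableT mA (@subsetT _ _) gi.
rewrite (integralB mA fA gA) fg// subee//; exact: (integrable_fin_num mA fA).
Qed.

End conditional_expectation.

(** * Lindeberg's method *)

Section lindeberg.
Context {R : realType} {d : nat} {disp : measure_display} {W : measurableType disp}.
Notation B1 := (mxBorel R d 1).
Notation Bd := (mxBorel R d d).
Notation gamma := (stdgauss d).
Variables (P : probability W R) (n : nat) (H : nat -> set (set W)).
Notation WH k := (g_sigma_algebraType (H k)).
Hypotheses (H_measurable : forall k, (k <= n)%N -> H k `<=` measurable)
  (H_nondecreasing : forall k, (k < n)%N -> H k `<=` H k.+1).
Variables (X : nat -> W -> 'cV[R]_d) (V : nat -> W -> 'M[R]_d).
Hypotheses (mX : forall k, (k < n)%N -> measurable_fun setT (X k : WH k.+1 -> B1))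
  (mV : forall k, (k < n)%N -> measurable_fun setT (V k : WH k -> Bd)).
Hypotheses (iX : forall k j, (k < n)%N -> P.-integrable setT (EFin \o (fun w => X k w j 0)))
  (iXX : forall k j l, (k < n)%N -> P.-integrable setT (EFin \o (fun w => X k w j 0 * X k w l 0)))
  (iV : forall k j l, (k < n)%N -> P.-integrable setT (EFin \o (fun w => V k w j l))).
Hypothesis X_centered : forall k j (phi : W -> R) c, (k < n)%N ->
  measurable_fun setT (phi : WH k -> R) -> (forall w, `|phi w| <= c) ->
  \int[P]_w (phi w * X k w j 0) = 0.
Hypothesis X_cov : forall k j l (phi : W -> R) c, (k < n)%N ->
  measurable_fun setT (phi : WH k -> R) -> (forall w, `|phi w| <= c) ->
  \int[P]_w (phi w * (X k w j 0 * X k w l 0)) = \int[P]_w (phi w * V k w j l).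
Variable (Sigma : 'M[R]_d).
Hypothesis (Sigma_psd : psd Sigma).

(* The remaining covariance: the increment V k is removed only where both it and
   what would be left are positive semi-definite. *)
Fixpoint remcov k : W -> 'M[R]_d := match k with
  | 0%N => fun=> Sigma
  | k'.+1 => fun w => remcov k' w -
     \1_[set w | psd (V k' w) /\ psd (remcov k' w - V k' w)] w *: V k' w
  end.

Definition admissible k : set W := [set w | psd (V k w) /\ psd (remcov k w - V k w)].

(** A step whose covariance is not removed must not contribute its increment either: the same
    indicator governs both, so that the first two moments keep matching. *)
Definition stopped_sum k w : 'cV[R]_d := \sum_(j < k) \1_(admissible j) w *: X j w.

Lemma remcovS k w : remcov k.+1 w = remcov k w - \1_(admissible k) w *: V k w.
Proof. by []. Qed.

Lemma remcov_psd k w : psd (remcov k w).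
Proof.
elim: k => // k ih; rewrite remcovS indicE.
case: (pselect (admissible k w)) => h; last by rewrite memNset// scale0r subr0.
by rewrite mem_set// scale1r; case: h.
Qed.

Lemma admissible_psd k w : psd (\1_(admissible k) w *: V k w).
Proof.
rewrite indicE; case: (pselect (admissible k w)) => h.
  by rewrite mem_set// scale1r; case: h.
by rewrite memNset// scale0r; exact: psd0.
Qed.

(** Adding positive semi-definite increments back to the final covariance shows that every
    intermediate one is positive semi-definite too; hence no step was skipped. *)
Lemma remcov_sum k w : (forall j, (j < k)%N -> psd (V j w)) ->
  psd (Sigma - \sum_(j < k) V j w) ->
  remcov k w = Sigma - \sum_(j < k) V j w /\ stopped_sum k w = \sum_(j < k) X j w.
Proof.
rewrite /stopped_sum; elim: k => [|k ih] pV pS; first by rewrite !big_ord0 subr0.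
have pk : psd (V k w) by exact: pV.
have [|eQ eS] := ih (fun j jk => pV j (ltnW jk)).
  rewrite (_ : _ - _ = Sigma - \sum_(j < k.+1) V j w + V k w); first exact: psdD.
  by rewrite big_ord_recr/= opprD addrA subrK.
have ak : admissible k w.
  by split=> //; rewrite eQ -addrA -opprD; rewrite big_ord_recr/= in pS.
rewrite remcovS !big_ord_recr/= eQ eS indicE mem_set// !scale1r opprD addrA.
by split.
Qed.

Let measurable_step k : (k < n)%N -> measurable_fun setT (remcov k : WH k -> Bd) ->
  measurable_fun setT (\1_(admissible k) : WH k -> R) /\
  measurable_fun setT (remcov k.+1 : WH k -> Bd).
Proof.
move=> kn mQ; have mVk := mV kn.
have mA : measurable (admissible k : set (WH k)).
  have mD : measurable_fun setT ((fun w => remcov k w - V k w) : WH k -> Bd).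
    by apply: measurable_addmx => //; exact: measurable_oppmx.
  have -> : admissible k = (V k @^-1` [set M | psd M]) `&`
    ((fun w => remcov k w - V k w) @^-1` [set M | psd M]) by [].
  apply: measurableI; rewrite -[X in measurable X]setTI.
    exact: (mVk measurableT _ (@measurable_psd R d)).
  exact: (mD measurableT _ (@measurable_psd R d)).
have m1 : measurable_fun setT (\1_(admissible k) : WH k -> R) by exact: measurable_indic.
split=> //; rewrite (_ : remcov k.+1 = fun w => remcov k w - \1_(admissible k) w *: V k w)//.
by apply: measurable_addmx => //; apply: measurable_oppmx; exact: measurable_scalemx.
Qed.

Lemma measurable_remcov k : (k <= n)%N -> measurable_fun setT (remcov k : WH k -> Bd).
Proof.
elim: k => [|k ih] kn; first exact: measurable_cst.
have [_ m] := measurable_step kn (ih (ltnW kn)).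
exact: (measurable_fun_widen2 (H_nondecreasing kn) m).
Qed.

Lemma measurable_admissible k : (k < n)%N -> measurable_fun setT (\1_(admissible k) : WH k -> R).
Proof. by move=> kn; case: (measurable_step kn (measurable_remcov (ltnW kn))). Qed.

(** Predictability: the covariance after step [k] is already known at time [k], before [X k] is
    revealed. *)
Lemma measurable_remcovS k : (k < n)%N -> measurable_fun setT (remcov k.+1 : WH k -> Bd).
Proof. by move=> kn; case: (measurable_step kn (measurable_remcov (ltnW kn))). Qed.

Lemma measurable_stopped_sum k : (k <= n)%N -> measurable_fun setT (stopped_sum k : WH k -> B1).
Proof.
elim: k => [|k ih] kn.
  rewrite (_ : stopped_sum 0 = fun=> 0); first exact: measurable_cst.
  by apply/funext => w; rewrite /stopped_sum big_ord0.
rewrite (_ : stopped_sum k.+1 = fun w => stopped_sum k w + \1_(admissible k) w *: X k w); last first.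
  by apply/funext => w; rewrite /stopped_sum big_ord_recr.
apply: measurable_addmx.
  exact: (measurable_fun_widen2 (H_nondecreasing kn) (ih (ltnW kn))).
apply: measurable_scalemx; last exact: mX.
exact: (measurable_fun_widen2 (H_nondecreasing kn) (measurable_admissible kn)).
Qed.

Variables (p : \bar R) (L s : R) (g : 'cV[R]_d -> R).
Hypotheses (p1 : (1 <= p)%E) (L0 : 0 < L) (s0 : 0 < s).
Hypotheses (g01 : forall x, 0 <= g x <= 1) (gL : forall x y, `|g x - g y| <= L * lpnorm p (x - y)).

(** One summand of [beta2], with the Gaussian vector integrated out for a fixed value of [V k]. *)
Definition cubic_moment k : \bar R := (\int[P]_w (cubic p (X k w))%:E +
  \int[P]_w \int[gamma]_y (cubic p (mxsqrt (V k w) *m y))%:E)%E.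

Let F k w := smix s g (remcov k w) (stopped_sum k w).
Let c := 2 * L / s ^+ 2.

Let c0 : 0 < c. Proof. by rewrite divr_gt0 ?exprn_gt0// mulr_gt0. Qed.

Lemma measurable_lindeberg k : (k <= n)%N -> measurable_fun setT (F k).
Proof.
move=> kn; apply: (measurable_fun_widen (H_measurable kn)).
apply: (measurable_smix_comp s p1 gL); [exact: measurable_remcov|exact: measurable_stopped_sum].
Qed.

Lemma lindeberg_bounds k w : 0 <= F k w <= 1.
Proof. exact: (smix_bounds s p1 g01 gL). Qed.

Let F_integrable k : (k <= n)%N -> P.-integrable setT (EFin \o F k).
Proof.
move=> kn; apply: (bounded_integrable 1); first exact: measurable_lindeberg.
by move=> w; have /andP[f0 f1] := lindeberg_bounds k w; rewrite ger0_norm.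
Qed.

Section one_step.
Variables (k : nat) (kn : (k < n)%N).
Hypothesis (moment_fin : (cubic_moment k < +oo)%E).
Let J := \1_(admissible k) : W -> R.
Let Q := remcov k.+1.
Let x := stopped_sum k.
(** The common base point of the step. The state after it is reached by adding [J X] to the
    argument, the state before it by adding [J V] to the covariance, with [J] the indicator of an
    admissible step. *)
Let T0 w := smix s g (Q w) (x w).
Let D w j := smix1 s g (Q w) (x w) j.
Let HH w j l := smix2 s g (Q w) (x w) j l.
Let K w : \bar R := (\int[gamma]_y (cubic p (mxsqrt (V k w) *m y))%:E)%E.

Let WT (f : W -> R) : measurable_fun setT (f : WH k -> R) -> measurable_fun setT f.
Proof. by move=> mf; exact: (measurable_fun_widen (H_measurable (ltnW kn)) mf). Qed.

Let J01 w : J w = 0 \/ J w = 1.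
Proof. by rewrite /J indicE; case: (_ \in _); [right|left]. Qed.

Let J_le1 w : `|J w| <= 1.
Proof. by case: (J01 w) => ->; rewrite ?normr0 ?normr1. Qed.

Let mQ : measurable_fun setT (Q : WH k -> Bd). Proof. exact: measurable_remcovS. Qed.
Let mx : measurable_fun setT (x : WH k -> B1). Proof. exact: (measurable_stopped_sum (ltnW kn)). Qed.
Let mJ : measurable_fun setT (J : WH k -> R). Proof. exact: measurable_admissible. Qed.

Let mT0 : measurable_fun setT T0. Proof. by apply: WT; exact: (measurable_smix_comp s p1 gL). Qed.
Let mJD j : measurable_fun setT ((fun w => J w * D w j) : WH k -> R).
Proof. by apply: measurable_funM => //; exact: (measurable_smix1_comp s p1 gL). Qed.
Let mJH j l : measurable_fun setT ((fun w => J w * HH w j l) : WH k -> R).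
Proof. by apply: measurable_funM => //; exact: (measurable_smix2_comp s p1 gL). Qed.

Let T0_integrable : P.-integrable setT (EFin \o T0).
Proof.
apply: (bounded_integrable 1) => // w.
by have /andP[f0 f1] := smix_bounds s p1 g01 gL (Q w) (x w); rewrite ger0_norm.
Qed.

Let D_bound j : exists b, forall w, `|J w * D w j| <= b.
Proof.
have [b hb] := smix1_bound p1 s0 g01 gL j; exists b => w.
by rewrite normrM (le_trans (ler_piMl _ (J_le1 w)))//; exact: hb.
Qed.

Let H_bound j l : exists b, forall w, `|J w * HH w j l| <= b.
Proof.
have [b hb] := smix2_bound p1 s0 g01 gL j l; exists b => w.
by rewrite normrM (le_trans (ler_piMl _ (J_le1 w)))//; exact: hb.
Qed.

Let linear w := \sum_j (J w * D w j) * X k w j 0.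
Let quadX w := \sum_j \sum_l (J w * HH w j l) * (X k w j 0 * X k w l 0).
Let quadV w := \sum_j \sum_l (J w * HH w j l) * V k w j l.

Let iDX j : P.-integrable setT (EFin \o (fun w => (J w * D w j) * X k w j 0)).
Proof. by have [b hb] := D_bound j; apply: (integrable_bounded_mul b (WT (mJD j)) hb); exact: iX. Qed.
Let iHX j l : P.-integrable setT (EFin \o (fun w => (J w * HH w j l) * (X k w j 0 * X k w l 0))).
Proof. by have [b hb] := H_bound j l; apply: (integrable_bounded_mul b (WT (mJH j l)) hb); exact: iXX. Qed.
Let iHV j l : P.-integrable setT (EFin \o (fun w => (J w * HH w j l) * V k w j l)).
Proof. by have [b hb] := H_bound j l; apply: (integrable_bounded_mul b (WT (mJH j l)) hb); exact: iV. Qed.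

Let linear_integrable : P.-integrable setT (EFin \o linear).
Proof. exact: integrable_sumr. Qed.
Let quadX_integrable : P.-integrable setT (EFin \o quadX).
Proof. by apply: integrable_sumr => j; exact: integrable_sumr. Qed.
Let quadV_integrable : P.-integrable setT (EFin \o quadV).
Proof. by apply: integrable_sumr => j; exact: integrable_sumr. Qed.

Let linear0 : \int[P]_w linear w = 0.
Proof.
rewrite Rintegral_sum// big1// => j _.
by have [b hb] := D_bound j; exact: (X_centered j kn (mJD j) hb).
Qed.

Let quadXV : \int[P]_w quadX w = \int[P]_w quadV w.
Proof.
rewrite Rintegral_sum; last by move=> j; exact: integrable_sumr.
rewrite [RHS]Rintegral_sum; last by move=> j; exact: integrable_sumr.
apply: eq_bigr => j _; rewrite Rintegral_sum// [RHS]Rintegral_sum//; apply: eq_bigr => l _.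
by have [b hb] := H_bound j l; exact: (X_cov j l kn (mJH j l) hb).
Qed.

Let mXW : measurable_fun setT (X k : W -> B1).
Proof. exact: (measurable_fun_widen (H_measurable kn) (mX kn)). Qed.

Let mcX : measurable_fun setT (fun w => cubic p (X k w)).
Proof. exact: (measurableT_comp (measurable_cubic p) mXW). Qed.

Let mK : measurable_fun setT K.
Proof.
have mVW : measurable_fun setT (V k : W -> Bd) by exact: (measurable_fun_widen (H_measurable (ltnW kn)) (mV kn)).
apply: (ge0_measurable_integral_param gamma (f := fun w y => (cubic p (mxsqrt (V k w) *m y))%:E)).
  apply/measurable_EFinP; apply: (measurableT_comp (measurable_cubic p)).
  apply: measurable_mulmx; last exact: measurable_snd.
  apply: (measurableT_comp (@measurable_mxsqrt R d)).
  exact: (measurableT_comp mVW (@measurable_fst _ _ W B1)).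
by move=> w y; rewrite lee_fin cubic_ge0.
Qed.

Let K0 w : (0 <= K w)%E.
Proof. by apply: integral_ge0 => y _; rewrite lee_fin cubic_ge0. Qed.

Let cX0 : (0 <= \int[P]_w (cubic p (X k w))%:E)%E.
Proof. by apply: integral_ge0 => w _; rewrite lee_fin cubic_ge0. Qed.

Let IK0 : (0 <= \int[P]_w K w)%E. Proof. exact: integral_ge0. Qed.

Let cX_integrable : P.-integrable setT (EFin \o (fun w => cubic p (X k w))).
Proof.
apply/integrableP; split; first exact/measurable_EFinP.
rewrite (_ : (\int[P]_w _)%E = (\int[P]_w (cubic p (X k w))%:E)%E).
  by apply: le_lt_trans moment_fin; rewrite /cubic_moment leeDl.
by apply: eq_integral => w _ /=; rewrite ger0_norm// cubic_ge0.
Qed.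

Let K_integrable : P.-integrable setT K.
Proof.
apply/integrableP; split => //.
rewrite (_ : (\int[P]_w _)%E = (\int[P]_w K w)%E).
  by apply: le_lt_trans moment_fin; rewrite /cubic_moment leeDr.
by apply: eq_integral => w _; rewrite gee0_abs.
Qed.

Let step_upper w : F k.+1 w <= T0 w + linear w + quadX w / 2 + c * cubic p (X k w).
Proof.
have -> : F k.+1 w = smix s g (Q w) (x w + J w *: X k w).
  by rewrite /F /stopped_sum big_ord_recr.
have := smix_taylor p1 L0 s0 g01 gL (Q w) (x w) (J w *: X k w).
rewrite ler_norml => /andP[_]; rewrite -/c -/(T0 w).
rewrite (_ : \sum_j (J w *: X k w) j 0 * _ = linear w); last first.
  by apply: eq_bigr => j _; rewrite mxE mulrAC.
rewrite (_ : \sum_j \sum_l _ = quadX w); last first.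
  apply: eq_bigr => j _; apply: eq_bigr => l _; rewrite !mxE -/(HH w j l).
  have JJ : J w * J w = J w by case: (J01 w) => ->; rewrite ?mulr0 ?mulr1.
  by rewrite -[in RHS]JJ; ring.
have cJ : cubic p (J w *: X k w) <= cubic p (X k w).
  case: (J01 w) => ->; rewrite ?scale1r// scale0r /cubic.
  by rewrite (_ : dotv 0 0 = 0) ?mul0r ?cubic_ge0// /dotv mulmx0 mxE.
have : c * cubic p (J w *: X k w) <= c * cubic p (X k w) by rewrite ler_pM2l.
set a := smix _ _ _ _; set b := c * cubic _ _; set b' := c * cubic _ _.
set l := linear _; set q := quadX _; move=> h1 h2; lra.
Qed.

(** The covariance before the step is [Q + J V], so the averaged Taylor bound applies with the
    increment [J V], which vanishes when the step is skipped. *)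
Let step_lower w : ((T0 w + quadV w / 2)%:E <= (F k w)%:E + c%:E * K w)%E.
Proof.
have := smixD_ge p1 L0 s0 g01 gL (x w) (remcov_psd k.+1 w) (admissible_psd k w).
rewrite -/c (_ : \sum_j \sum_l _ = quadV w); last first.
  by apply: eq_bigr => j _; apply: eq_bigr => l _; rewrite mxE -/(HH w j l) -/(J w); ring.
move=> h; apply: le_trans h _.
rewrite remcovS subrK leeD2l// lee_pmul2l// -/(J w).
case: (J01 w) => ->; last by rewrite scale1r.
rewrite scale0r mxsqrt0 (_ : (\int[gamma]_y _)%E = 0%E)//.
rewrite (_ : (fun y => _) = (fun=> 0%E)); first by rewrite integral0.
by apply/funext => y; rewrite mul0mx /cubic /dotv mulmx0 mxE mul0r.
Qed.

(** Both estimates meet at the integral of [T0 + quadV / 2]: in the upper one the linear term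
    integrates to zero and [quadX] may be replaced by [quadV], all their coefficients being bounded
    and known at time [k]. *)
Lemma lindeberg_step : (\int[P]_w (F k.+1 w)%:E <= \int[P]_w (F k w)%:E + c%:E * cubic_moment k)%E.
Proof.
have i1 : P.-integrable setT (EFin \o (fun w => T0 w + linear w)).
  by apply: eq_integrable (integrableD measurableT T0_integrable linear_integrable).
have iq : P.-integrable setT (EFin \o (fun w => 2^-1 * quadX w)) by exact: integrable_mulc.
have iqV : P.-integrable setT (EFin \o (fun w => 2^-1 * quadV w)) by exact: integrable_mulc.
have i2 : P.-integrable setT (EFin \o (fun w => T0 w + linear w + 2^-1 * quadX w)).
  by apply: eq_integrable (integrableD measurableT i1 iq).
have ic : P.-integrable setT (EFin \o (fun w => c * cubic p (X k w))) by exact: integrable_mulc.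
have iT : P.-integrable setT (EFin \o (fun w => T0 w + 2^-1 * quadV w)).
  by apply: eq_integrable (integrableD measurableT T0_integrable iqV).
have up : \int[P]_w F k.+1 w <= \int[P]_w (T0 w + 2^-1 * quadV w) + c * \int[P]_w cubic p (X k w).
  apply: (@le_trans _ _ (\int[P]_w (T0 w + linear w + 2^-1 * quadX w + c * cubic p (X k w)))).
    apply: ler_Rintegral; first exact: F_integrable.
    - by apply: eq_integrable (integrableD measurableT i2 ic).
    - by move=> w; rewrite (mulrC 2^-1); exact: step_upper.
  rewrite (RintegralD measurableT i2 ic) (RintegralD measurableT i1 iq).
  rewrite (RintegralD measurableT T0_integrable linear_integrable) linear0 addr0.
  rewrite (RintegralD measurableT T0_integrable iqV).
  rewrite (RintegralZl 2^-1 measurableT quadX_integrable) (RintegralZl 2^-1 measurableT quadV_integrable).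
  by rewrite quadXV (RintegralZl c measurableT cX_integrable).
have low : (\int[P]_w (T0 w + 2^-1 * quadV w)%:E <= \int[P]_w (F k w)%:E + c%:E * \int[P]_w K w)%E.
  have iFK : P.-integrable setT (fun w => (F k w)%:E + c%:E * K w)%E.
    exact: (integrableD measurableT (F_integrable (ltnW kn)) (integrableZl measurableT c K_integrable)).
  rewrite -(integralZl measurableT K_integrable) -(integralD measurableT (F_integrable (ltnW kn)) (integrableZl measurableT c K_integrable)).
  apply: (le_integral measurableT iT iFK) => w _.
  by rewrite /= (mulrC 2^-1); exact: step_lower.
rewrite [X in (X <= _)%E](EFin_Rintegral (F_integrable kn)).
apply: (@le_trans _ _ ((\int[P]_w (T0 w + 2^-1 * quadV w))%:E + c%:E * \int[P]_w (cubic p (X k w))%:E)%E).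
  by rewrite (EFin_Rintegral cX_integrable) -EFinM -EFinD lee_fin.
have -> : (c%:E * cubic_moment k = c%:E * \int[P]_w (cubic p (X k w))%:E + c%:E * \int[P]_w K w)%E.
  exact: (@ge0_muleDr _ c%:E _ _ cX0 IK0).
by rewrite -(EFin_Rintegral iT) addeCA (addeC (_ * _)%E) leeD2r.
Qed.

End one_step.

Lemma lindeberg_bound : (\sum_(k < n) cubic_moment k < +oo)%E ->
  (\int[P]_w (smix s g (remcov n w) (stopped_sum n w))%:E <=
   (smix s g Sigma 0)%:E + c%:E * \sum_(k < n) cubic_moment k)%E.
Proof.
have cm0 k : (0 <= cubic_moment k)%E.
  apply: adde_ge0; apply: integral_ge0 => w _; first by rewrite lee_fin cubic_ge0.
  by apply: integral_ge0 => y _; rewrite lee_fin cubic_ge0.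
move=> fin; rewrite -/(F n).
have finj j : (j < n)%N -> (cubic_moment j < +oo)%E.
  move=> jn; apply: le_lt_trans fin; rewrite (bigD1 (Ordinal jn))//= leeDl//.
  exact: sume_ge0.
suff : forall m, (m <= n)%N -> (\int[P]_w (F m w)%:E <=
   (smix s g Sigma 0)%:E + c%:E * \sum_(k < m) cubic_moment k)%E by apply.
elim=> [_|m ih mn].
  rewrite big_ord0 mule0 adde0 (_ : (fun w => (F 0 w)%:E) = cst (smix s g Sigma 0)%:E); last first.
    by apply/funext => w; rewrite /F /stopped_sum big_ord0.
  rewrite integral_cst// (_ : (P : {measure set W -> \bar R}) setT = 1%E) ?mule1//.
  exact: probability_setT.
apply: le_trans (lindeberg_step mn (finj _ mn)) _.
have h0 : (0 <= \sum_(k < m) cubic_moment k)%E by exact: sume_ge0.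
rewrite big_ord_recr/= (@ge0_muleDr _ c%:E _ _ h0 (cm0 m)).
by rewrite addeA leeD2r// ih// ltnW.
Qed.

End lindeberg.

(** * Conditional covariances *)

Lemma ae_forall_countable {R : realType} d {T : measurableType d} (mu : {measure set T -> \bar R})
    (I : countType) (Q : I -> T -> Prop) :
  (forall i, {ae mu, forall x, Q i x}) -> {ae mu, forall x, forall i, Q i x}.
Proof.
move=> h; have : {ae mu, forall x, forall n, if @unpickle I n is Some i then Q i x else True}.
  apply: ae_foralln => n; case: (unpickle n) => [i|]; first exact: h.
  exact: aeW.
by apply: filterS => x hx i; have := hx (pickle i); rewrite pickleK.
Qed.

(** If the form were negative somewhere, it would be negative on a nonempty open set, which contains
    a rational vector. This leaves countably many conditions, as almost sure statements require. *)
Lemma rational_psd {R : realType} d (M : 'M[R]_d) : M^T = M ->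
  (forall q : 'cV[rat]_d, 0 <= dotv (map_mx ratr q) (M *m map_mx ratr q)) -> psd M.
Proof.
move=> sM hq; apply/psdP; split=> // x; rewrite leNgt; apply/negP => x0.
have cq : continuous (fun x : 'cV[R]_d => dotv x (M *m x)).
  have e : (fun x : 'cV[R]_d => dotv x (M *m x)) = (fun x => \sum_i \sum_j x i 0 * (M i j * x j 0)).
    apply/funext => y; rewrite dotvE; apply: eq_bigr => i _.
    by rewrite mxE mulr_sumr.
  rewrite e => y; rewrite /continuous_at.
  apply: (cvg_sumr (F := nbhs y)) => i; apply: (cvg_sumr (F := nbhs y)) => j.
  by apply: cvgM; [exact: coord_continuous|apply: cvgM; [exact: cvg_cst|exact: coord_continuous]].
have oU : open [set x : 'cV[R]_d | dotv x (M *m x) < 0].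
  by move/continuousP: cq => /(_ [set t | t < 0]); apply; exact: open_lt.
have Ux : [set x : 'cV[R]_d | dotv x (M *m x) < 0] x by [].
rewrite (mxBorel_openP oU) in Ux; case: Ux => -[q N] /= qU _.
have : dotv (map_mx ratr q) (M *m map_mx ratr q) < 0.
  by apply: qU => i j; rewrite mxE subrr normr0 invr_gt0.
by rewrite ltNge hq.
Qed.

Section conditional_facts.
Context {R : realType} {disp : measure_display} {W : measurableType disp}.
Variable (P : probability W R).
Variables (G : set (set W)) (sG : sigma_algebra setT G) (GW : G `<=` measurable).
Notation WG := (g_sigma_algebraType G).

(** Take for [A] the set where [h] is negative: the integral of [h] over it is at once nonnegative
    and nonpositive. *)
Lemma ae_ge0_sub (h : W -> R) : P.-integrable setT (EFin \o h) ->
  measurable_fun setT (h : WG -> R) ->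
  (forall A : set WG, measurable A -> 0 <= \int[P]_w (\1_A w * h w)) ->
  {ae P, forall w, 0 <= h w}.
Proof.
move=> ih mh hA; pose A : set WG := [set w | h w < 0].
have mA : measurable A.
  rewrite -[X in measurable X]setTI.
  exact: (@measurable_fun_ltr _ WG _ _ h (cst 0)).
have mAh : measurable_fun setT (fun w : W => \1_A w * h w).
  apply: (measurable_fun_widen GW (G := G)).
  by apply: measurable_funM => //; exact: measurable_indic.
have le0 w : \1_A w * h w <= 0.
  by rewrite indicE; case: (boolP (w \in A)) => [/set_mem hw|_]; rewrite ?mul1r ?mul0r// ltW.
have iAh : P.-integrable setT (EFin \o (fun w => \1_A w * h w)).
  apply: (integrable_bounded_mul 1) => //; last exact: indic_le1.
  exact: (measurable_fun_widen GW (measurable_indic mA)).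
have e0 : (\int[P]_w `|(\1_A w * h w)%:E| = 0)%E.
  have : \int[P]_w (-1 * (\1_A w * h w)) = 0.
    apply/eqP; rewrite eq_le; apply/andP; split.
      by rewrite (RintegralZl (-1) measurableT iAh) mulN1r oppr_le0; exact: hA.
    by apply: Rintegral_ge0 => w _; rewrite mulN1r oppr_ge0.
  move=> e; rewrite (_ : (fun w => _) = (fun w => (-1 * (\1_A w * h w))%:E)); last first.
    by apply/funext => w /=; rewrite ler0_norm// mulN1r.
  by rewrite (EFin_Rintegral (integrable_mulc (-1) iAh)) e.
have mE : measurable_fun setT (fun w : W => (\1_A w * h w)%:E) by exact/measurable_EFinP.
have := (ae_eq_integral_abs P measurableT mE).1 e0.
apply: filterS => w /(_ I) [hw]; rewrite leNgt; apply/negP => hw0.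
by move: hw; rewrite indicE mem_set// mul1r => h0; rewrite h0 ltxx in hw0.
Qed.

Lemma cond_exp_measurable (f g : W -> R) : cond_exp P G f g -> measurable_fun setT (g : WG -> R).
Proof. by case=> _ _ mg _; apply/(sub_measurableP g sG). Qed.

Lemma cond_exp_unique (f g1 g2 : W -> R) : cond_exp P G f g1 -> cond_exp P G f g2 ->
  {ae P, forall w, g1 w = g2 w}.
Proof.
move=> fg1 fg2.
have mg1 := cond_exp_measurable fg1; have mg2 := cond_exp_measurable fg2.
have i1 : P.-integrable setT (EFin \o g1) by case: fg1.
have i2 : P.-integrable setT (EFin \o g2) by case: fg2.
have h (a b : W -> R) : cond_exp P G f a -> cond_exp P G f b ->
    measurable_fun setT (a : WG -> R) -> measurable_fun setT (b : WG -> R) ->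
    P.-integrable setT (EFin \o a) -> P.-integrable setT (EFin \o b) ->
    {ae P, forall w, 0 <= a w - b w}.
  move=> fa fb ma mb ia ib; apply: ae_ge0_sub.
  - by apply: eq_integrable (integrableB measurableT ia ib).
  - exact: measurable_funB.
  move=> A mA; have mA1 : measurable_fun setT (\1_A : WG -> R) by exact: measurable_indic.
  have iA (k : W -> R) : P.-integrable setT (EFin \o k) -> P.-integrable setT (EFin \o (fun w => \1_A w * k w)).
    move=> ik; apply: (integrable_bounded_mul 1) => //; last exact: indic_le1.
    exact: (measurable_fun_widen GW mA1).
  under eq_Rintegral do rewrite mulrBr.
  rewrite (RintegralB measurableT (iA _ ia) (iA _ ib)).
  by rewrite -(cond_exp_mul sG GW fa mA1 (indic_le1 A)) -(cond_exp_mul sG GW fb mA1 (indic_le1 A)) subrr.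
have h1 := h _ _ fg1 fg2 mg1 mg2 i1 i2; have h2 := h _ _ fg2 fg1 mg2 mg1 i2 i1.
apply: filterS2 h1 h2 => w w1 w2; apply/eqP; rewrite eq_le.
by rewrite -subr_ge0 w2 -subr_ge0 w1.
Qed.

Context {d : nat}.
Variables (Y : W -> 'cV[R]_d) (V : W -> 'M[R]_d).
Hypotheses (mY : measurable_fun setT (Y : W -> mxBorel R d 1)).
Hypotheses (iYY : forall j k, P.-integrable setT (EFin \o (fun w => Y w j 0 * Y w k 0))).
Hypotheses (Y_mean : cond_mean P G Y (fun=> 0)) (V_var : cond_var P G Y V).

Lemma cond_mean0_mul j (phi : W -> R) c : measurable_fun setT (phi : WG -> R) ->
  (forall w, `|phi w| <= c) -> \int[P]_w (phi w * Y w j 0) = 0.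
Proof.
move=> mphi phic; rewrite (cond_exp_mul sG GW (Y_mean j) mphi phic).
rewrite -[RHS](Rintegral_cstP P); apply: eq_Rintegral => w _.
by rewrite mxE mulr0.
Qed.

Lemma cond_var_measurable : measurable_fun setT (V : WG -> mxBorel R d d).
Proof.
case: V_var => M [_ VM]; apply: measurable_mxP => j k.
exact: (cond_exp_measurable (VM j k)).
Qed.

Lemma cond_var_integrable j k : P.-integrable setT (EFin \o (fun w => V w j k)).
Proof. by case: V_var => M [_ VM]; case: (VM j k). Qed.

Lemma cond_var0 j k : cond_exp P G (fun w => Y w j 0 * Y w k 0) (fun w => V w j k).
Proof.
case: V_var => M [YM VM]; have [ci vi sv e] := VM j k; split=> // A GA.
rewrite e//; have M0 l : {ae P, forall w, M w l 0 = 0}.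
  have := cond_exp_unique (YM l) (Y_mean l); apply: filterS => w ->.
  by rewrite mxE.
have mYl l : measurable_fun setT (fun w => Y w l 0) by exact: (measurable_fun_coord l 0 mY).
have mMl l : measurable_fun setT (fun w => M w l 0).
  exact: (measurable_fun_widen GW (cond_exp_measurable (YM l))).
apply: ae_eq_integral; first exact: GW.
- apply/measurable_EFinP; apply: measurable_funTS.
  under eq_fun do rewrite !mxE.
  by apply: measurable_funM; exact: measurable_funB.
- by apply/measurable_EFinP; apply: measurable_funTS; exact: measurable_funM.
- apply: filterS2 (M0 j) (M0 k) => w wj wk _.
  by rewrite !mxE wj wk !subr0.
Qed.

(** The form of [V] at a fixed vector [u] is a conditional expectation of [(dotv u Y)^2], hence is
    almost surely nonnegative; symmetry holds almost surely by uniqueness. Rational vectors leave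
    countably many exceptional sets. *)
Lemma cond_var_psd : {ae P, forall w, psd (V w)}.
Proof.
have h1 j k : {ae P, forall w, V w j k = V w k j}.
  apply: (cond_exp_unique (cond_var0 j k)).
  have [a b c e] := cond_var0 k j; split; [|exact: b|exact: c|].
    by have := a; apply: eq_integrable => // w _ /=; rewrite mulrC.
  by move=> A GA; rewrite e//; apply: eq_integral => w _; rewrite mulrC.
have h2 (q : 'cV[rat]_d) : {ae P, forall w, 0 <= dotv (map_mx ratr q) (V w *m map_mx ratr q)}.
  pose u : 'cV[R]_d := map_mx ratr q.
  have quadE (M : 'M[R]_d) : dotv u (M *m u) = \sum_j \sum_k (u j 0 * u k 0) * M j k.
    rewrite dotvE; apply: eq_bigr => j _; rewrite [X in _ * X]mxE mulr_sumr.
    by apply: eq_bigr => k _; ring.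
  have iq : P.-integrable setT (EFin \o (fun w => \sum_j \sum_k (u j 0 * u k 0) * V w j k)).
    apply: integrable_sumr => j; apply: integrable_sumr => k; apply: integrable_mulc.
    exact: cond_var_integrable.
  have mV := cond_var_measurable.
  suff : {ae P, forall w, 0 <= \sum_j \sum_k (u j 0 * u k 0) * V w j k}.
    by apply: filterS => w; rewrite -/u quadE.
  apply: ae_ge0_sub => //.
    apply: measurable_sum => j; apply: measurable_sum => k; apply: measurable_funM => //.
    exact: (measurable_fun_coord j k mV).
  move=> A mA; have mA1 : measurable_fun setT (\1_A : WG -> R) by exact: measurable_indic.
  have iA (k : W -> R) : P.-integrable setT (EFin \o k) -> P.-integrable setT (EFin \o (fun w => \1_A w * k w)).
    move=> ik; apply: (integrable_bounded_mul 1) => //; last exact: indic_le1.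
    exact: (measurable_fun_widen GW mA1).
  have expand (f : W -> 'I_d -> 'I_d -> R) : (forall j k, P.-integrable setT (EFin \o (fun w => f w j k))) ->
      \int[P]_w (\1_A w * \sum_j \sum_k (u j 0 * u k 0) * f w j k) =
      \sum_j \sum_k (u j 0 * u k 0) * \int[P]_w (\1_A w * f w j k).
    move=> fi; transitivity (\int[P]_w \sum_j \sum_k (u j 0 * u k 0) * (\1_A w * f w j k)).
      apply: eq_Rintegral => w _; rewrite mulr_sumr; apply: eq_bigr => j _.
      by rewrite mulr_sumr; apply: eq_bigr => k _; ring.
    have ii j k : P.-integrable setT (EFin \o (fun w => (u j 0 * u k 0) * (\1_A w * f w j k))).
      by apply: integrable_mulc; exact: iA.
    rewrite Rintegral_sum; last by move=> j; exact: integrable_sumr.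
    apply: eq_bigr => j _; rewrite Rintegral_sum//; apply: eq_bigr => k _.
    by rewrite RintegralZl//; exact: iA.
  rewrite (expand (fun w j k => V w j k)) => [|j k]; last exact: cond_var_integrable.
  rewrite (_ : \sum_j _ = \int[P]_w (\1_A w * \sum_j \sum_k (u j 0 * u k 0) * (Y w j 0 * Y w k 0))); last first.
    rewrite (expand (fun w j k => Y w j 0 * Y w k 0))//; apply: eq_bigr => j _; apply: eq_bigr => k _.
    by congr (_ * _); rewrite (cond_exp_mul sG GW (cond_var0 j k) mA1 (indic_le1 A)).
  apply: Rintegral_ge0 => w _; apply: mulr_ge0 => //.
  rewrite (_ : \sum_j _ = dotv u (Y w) ^+ 2) ?sqr_ge0//.
  rewrite dotvE expr2 big_distrlr/=; apply: eq_bigr => j _; apply: eq_bigr => k _; ring.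
have h1' : {ae P, forall w, forall jk : 'I_d * 'I_d, V w jk.1 jk.2 = V w jk.2 jk.1}.
  by apply: ae_forall_countable => jk; exact: h1.
have h2' := ae_forall_countable h2.
apply: filterS2 h1' h2' => w sV qV; apply: rational_psd => //.
by apply/matrixP => j k; rewrite mxE; exact: (sV (k, j)).
Qed.

End conditional_facts.

Section independence.
Context {R : realType} d d1 d2 {W : measurableType d} {T1 : measurableType d1} {T2 : measurableType d2}.
Variables (P : probability W R) (U : W -> T1) (Y : W -> T2).
Hypotheses (mU : measurable_fun setT U) (mY : measurable_fun setT Y).
Hypothesis UY : forall A B, measurable A -> measurable B ->
  P ((U @^-1` A) `&` (Y @^-1` B)) = (P (U @^-1` A) * P (Y @^-1` B))%E.

(** The joint law agrees with the product law on rectangles, hence everywhere; Tonelli then allows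
    [U] to be frozen. *)
Lemma ge0_integral_indep (f : T1 -> T2 -> \bar R) : measurable_fun setT (fun z => f z.1 z.2) ->
  (forall x y, 0 <= f x y)%E ->
  (\int[P]_w f (U w) (Y w) = \int[P]_w \int[push P mY]_y f (U w) y)%E.
Proof.
move=> mf f0; have mUY : measurable_fun setT (fun w => (U w, Y w)) by exact: measurable_fun_pair.
have := ge0_integral_push P mUY mf (fun z => f0 _ _) => /= <-.
rewrite (@eq_measure_integral _ _ _ _ (prodp (push P mU) (push P mY))); last first.
  by move=> A mA _; symmetry; apply: product_measure_unique => // B C mB mC; exact: UY.
rewrite ge0_integral_prodp//=.
rewrite ge0_integral_push//.
- exact: ge0_measurable_integral_param.
- by move=> x; exact: integral_ge0.
Qed.

End independence.

(** * The one-sided bound *)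

Section gaussian_tails.
Context {R : realType} {d : nat}.
Notation B1 := (mxBorel R d 1).
Notation gamma := (stdgauss d).
Implicit Types (Q : 'M[R]_d) (p : \bar R).

Lemma subgauss_gaussv Q (mu : probability B1 R) s : gaussv Q mu ->
  (forall j, Q j j <= s ^+ 2) -> subgauss mu s.
Proof.
move=> gmu Qs j l; have := gaussf_mgf (@measurable_dotv R d (delta_mx j 0)) (gmu (delta_mx j 0)) l.
under eq_integral do rewrite dotv_delta; move=> ->.
rewrite dotv_delta mulmx_delta lee_fin ler_expR; apply: ler_wpM2r => //.
by rewrite mulrC; apply: ler_wpM2l; [exact: sqr_ge0|exact: Qs].
Qed.

Lemma psd_scalar (c : R) : 0 <= c -> psd (c%:M : 'M[R]_d).
Proof. by move=> c0; rewrite -scalemx1; apply: psdZ => //; exact: psd1. Qed.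

Lemma mxsqrt_scalar (c : R) : 0 <= c -> mxsqrt (c ^+ 2)%:M = c%:M :> 'M[R]_d.
Proof. by move=> c0; apply: mxsqrt_unique; [exact: psd_scalar|rewrite -scalar_mxM expr2]. Qed.

Lemma phi_gt0 p : (0 < d)%N -> (1 <= p)%E -> 0 < phi p d.
Proof.
move=> d0 /lp_exponentP[[r r1 ->]|->] /=; rewrite sqrtr_gt0.
  by apply: mulr_gt0; [exact: lt_le_trans ltr01 r1|rewrite powR_gt0// ltr0n].
by rewrite mulr_gt0// ln_gt0// -natrM ltr1n; case: (d) d0 => // k _; rewrite mulnS.
Qed.

Lemma Rintegral_indic_comp d' (T : measurableType d') (mu : probability T R) (f : T -> B1) (E : set B1) :
  measurable_fun setT f -> measurable E ->
  \int[mu]_y (\1_E (f y)) = fine (mu (f @^-1` E)).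
Proof.
move=> mf mE; have mfE : measurable (f @^-1` E) by rewrite -[X in measurable X]setTI; exact: mf.
rewrite /Rintegral -[X in fine (mu X)]setIT -integral_indic//.
Qed.

Lemma fine_normv Q (E : set B1) : measurable E -> fine (normv Q E) = \int[gamma]_y (\1_E (mxsqrt Q *m y)).
Proof. by move=> mE; rewrite (Rintegral_indic_comp gamma (measurable_mulv (mxsqrt Q)) mE). Qed.

Lemma indic_comp_integrable d' (T : measurableType d') (mu : probability T R) (f : T -> B1) (E : set B1) :
  measurable_fun setT f -> measurable E ->
  mu.-integrable setT (EFin \o (fun y => \1_E (f y) : R)).
Proof.
move=> mf mE; apply: (bounded_integrable 1).
  by apply: (measurableT_comp (measurable_indic mE) mf).
by move=> y; exact: indic_le1.
Qed.

Lemma normv_tail p Q t a : (0 < d)%N -> (1 <= p)%E -> psd Q -> 0 < t -> 0 < a ->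
  (forall j, Q j j <= t ^+ 2) ->
  fine (normv Q [set v | a < lpnorm p v]) <= 2 * phi p d * t / a.
Proof.
move=> d0 p1 pQ t0 a0 Qt.
have h := subgauss_tail_lp d0 p1 (subgauss_gaussv (gaussv_normv pQ) Qt) t0 a0.
by rewrite -lee_fin fineK; [exact: h|exact: (fin_num_measure (normv Q) _ (measurable_lpnorm_gt p a))].
Qed.

Variables (p : \bar R) (p1 : (1 <= p)%E) (d0 : (0 < d)%N) (B : set 'cV[R]_d) (B0 : B !=set0).
Variables (s a b : R) (s0 : 0 < s) (a0 : 0 < a) (b0 : 0 < b).
Let g := ramp p B a b.

Let g01 x : 0 <= g x <= 1. Proof. by rewrite ramp_ge0 ramp_le1. Qed.
Let gL x y : `|g x - g y| <= b^-1 * lpnorm p (x - y). Proof. exact: ramp_lip. Qed.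
Let mg : measurable_fun setT (g : B1 -> R). Proof. exact: measurable_ramp. Qed.

Lemma smix_normv Q x : psd Q -> smix s g Q x = \int[gamma]_y g (x + mxsqrt (Q + (s ^+ 2)%:M) *m y).
Proof.
move=> pQ; rewrite -(normvD (k := fun v => g (x + v)) (c := 1) pQ (psd_scalar (sqr_ge0 s))).
- apply: eq_Rintegral => z _; apply: eq_Rintegral => y _.
  by rewrite (mxsqrt_scalar (ltW s0)) mul_scalar_mx addrA.
- by apply: (measurableT_comp mg); apply: measurable_addmx; [exact: measurable_cst|exact: measurable_id].
- by move=> v; exact: g01.
Qed.

Let g_integrable (f : B1 -> B1) : measurable_fun setT f -> gamma.-integrable setT (EFin \o (fun y => g (f y))).
Proof.
move=> mf; apply: (bounded_integrable 1); first exact: (measurableT_comp mg mf).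
by move=> y; have /andP[h0 h1] := g01 (f y); rewrite ger0_norm.
Qed.

(** From a point of [B], noise of p-norm at most [a] stays in the [a]-enlargement, where the ramp is
    1. *)
Lemma smix_lower Q x t : B x -> psd Q -> 0 < t -> (forall j, Q j j + s ^+ 2 <= t ^+ 2) ->
  1 - 2 * phi p d * t / a <= smix s g Q x.
Proof.
move=> Bx pQ t0 Qt; rewrite smix_normv//; set Q' := Q + _.
have pQ' : psd Q' by apply: psdD => //; exact: psd_scalar (sqr_ge0 s).
pose E : set B1 := [set v | a < lpnorm p v].
have mE : measurable E by exact: measurable_lpnorm_gt.
have tail : fine (normv Q' E) <= 2 * phi p d * t / a.
  apply: normv_tail => // j; rewrite !mxE eqxx mulr1n; exact: Qt.
apply: (@le_trans _ _ (1 - fine (normv Q' E))); first by lra.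
have mv := @measurable_mulv R d (mxsqrt Q').
rewrite (fine_normv Q' mE) -[X in X - _](Rintegral_cstP gamma).
have i1 : gamma.-integrable setT (EFin \o (fun=> 1) : B1 -> \bar R) by exact: finite_measure_integrable_cst.
have iE := indic_comp_integrable gamma mv mE.
rewrite -(RintegralB measurableT i1 iE); apply: ler_Rintegral.
- by apply: eq_integrable (integrableB measurableT i1 iE).
- apply: (g_integrable (f := fun y => x + mxsqrt Q' *m (y : 'cV[R]_d))).
  by apply: measurable_addmx => //; exact: measurable_cst.
- move=> y; rewrite indicE; case: (boolP (_ \in E)) => [_|yE].
    by rewrite subrr; have /andP[] := g01 (x + mxsqrt Q' *m y).
  rewrite subr0 /g ramp_one// (le_trans (@rdist_le R d p B B0 _ _ Bx))//.
  have : ~ (a < lpnorm p (mxsqrt Q' *m y)) by move/negP: yE => h h'; apply: h; exact/mem_set.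
  by rewrite addrAC subrr add0r => /negP; rewrite -leNgt.
Qed.

(** The noise splits into N(0, Sigma) and an isotropic part. If the latter has p-norm at most [c]
    and the ramp does not vanish at the sum, then the N(0, Sigma) part lies in the enlargement by
    [a + b + c]. *)
Lemma smix_upper Sigma v c t : psd Sigma -> 0 <= v -> 0 < c -> 0 < t -> v + s ^+ 2 <= t ^+ 2 ->
  smix s g (Sigma + v%:M) 0 <=
  fine (normv Sigma (enlarge p (a + b + c) B)) + 2 * phi p d * t / c.
Proof.
move=> pS v0 c0 t0 vt; rewrite smix_normv; last by apply: psdD => //; exact: psd_scalar.
set Q := (v + s ^+ 2)%:M : 'M[R]_d.
have pQ : psd Q by apply: psd_scalar; rewrite addr_ge0// sqr_ge0.
have -> : Sigma + v%:M + (s ^+ 2)%:M = Q + Sigma by rewrite -addrA -raddfD addrC.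
under eq_Rintegral do rewrite add0r.
rewrite -(normvD (k := g) (c := 1) pQ pS)//.
pose E : set B1 := [set v | c < lpnorm p v].
pose A : set B1 := enlarge p (a + b + c) B.
have mE : measurable E by exact: measurable_lpnorm_gt.
have mA : measurable A by exact: measurable_enlarge.
have tail : fine (normv Q E) <= 2 * phi p d * t / c.
  by apply: normv_tail => // j; rewrite !mxE eqxx mulr1n.
have mS := @measurable_mulv R d (mxsqrt Sigma).
have mQ := @measurable_mulv R d (mxsqrt Q).
rewrite (fine_normv Sigma mA).
have iA := indic_comp_integrable gamma mS mA.
have iE := indic_comp_integrable gamma mQ mE.
have ic (k : R) : gamma.-integrable setT (EFin \o (fun=> k) : B1 -> \bar R) by exact: finite_measure_integrable_cst.
apply: (@le_trans _ _ (\int[gamma]_y (\1_A (mxsqrt Sigma *m y) + fine (normv Q E)))); last first.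
  by rewrite (RintegralD measurableT iA (ic _)) Rintegral_cstP lerD2l.
have mgy y : measurable_fun setT ((fun y' => mxsqrt Sigma *m y + mxsqrt Q *m (y' : 'cV[R]_d)) : B1 -> B1).
  by apply: measurable_addmx => //; exact: measurable_cst.
apply: ler_Rintegral.
- apply: (bounded_integrable 1).
    apply: (measurable_Rintegral_param (T1 := B1) gamma (f := fun y y' => g (mxsqrt Sigma *m (y : 'cV[R]_d) + mxsqrt Q *m (y' : 'cV[R]_d)))).
    apply: (measurableT_comp mg); apply: measurable_addmx.
      exact: (measurableT_comp mS (@measurable_fst _ _ B1 B1)).
    exact: (measurableT_comp mQ (@measurable_snd _ _ B1 B1)).
  move=> y; have /andP[h0 h1] : 0 <= \int[gamma]_y' g (mxsqrt Sigma *m y + mxsqrt Q *m y') <= 1.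
    by apply: Rintegral_bounds => //; exact: (measurableT_comp mg (mgy y)).
  by rewrite ger0_norm.
- by apply: eq_integrable (integrableD measurableT iA (ic _)).
- move=> y; rewrite -[X in _ <= X + _](Rintegral_cstP gamma) (fine_normv Q mE).
  rewrite -(RintegralD measurableT (ic _) iE).
  apply: ler_Rintegral; first exact: (g_integrable (mgy y)).
    by apply: eq_integrable (integrableD measurableT (ic _) iE).
  move=> y'; set v1 := mxsqrt Sigma *m y; set v2 := mxsqrt Q *m y'.
  have /andP[g0 g1] := g01 (v1 + v2).
  rewrite !indicE; case: (boolP (v1 \in A)) => [_|v1A]; first by rewrite (le_trans g1)// lerDl.
  case: (boolP (v2 \in E)) => [_|v2E]; first by rewrite add0r.
  rewrite /g ramp_zero// .
  have h1 : ~ (rdist p B v1 <= a + b + c).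
    by move/negP: v1A => h h'; apply: h; apply/mem_set; rewrite /A enlargeE.
  have h2 : ~ (c < lpnorm p v2) by move/negP: v2E => h h'; apply: h; exact/mem_set.
  move/negP: h1; rewrite -ltNge => h1; move/negP: h2; rewrite -leNgt => h2.
  have := rdist_lip p1 B0 v1 (v1 + v2).
  rewrite opprD addNKr lpnormN => h3; lra.
Qed.

End gaussian_tails.

Section markov.
Import HBNNSimple.

(** The simple function equal to [c] on [D] and 0 elsewhere lies below [f], and the integral is a
    supremum over such functions. In this form it applies directly to the operator norm. *)
Lemma markov_ge0 {R : realType} d (T : measurableType d) (mu : {measure set T -> \bar R})
    (f : T -> \bar R) (D : set T) (c : R) : measurable D -> 0 <= c -> (forall x, 0 <= f x)%E ->
  (forall x, D x -> c%:E <= f x)%E -> (c%:E * mu D <= \int[mu]_x f x)%E.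
Proof.
move=> mD c0 f0 cf; rewrite ge0_integralTE//.
apply: ereal_sup_ubound; exists (scale_nnsfun (indic_nnsfun R mD) c0) => [x|].
  rewrite /= mindicE; case: (boolP (x \in D)) => [/set_mem/cf|_]; first by rewrite mulr1.
  by rewrite mulr0.
rewrite -(sintegral_indic mu D) -(sintegralrM mu c (indic_nnsfun R mD)).
by apply: eq_sintegral.
Qed.

End markov.

Lemma cube_bound {R : realType} (t a x : R) : 0 < x -> t * a <= x ^+ 3 -> t * (a / x ^+ 2) <= x.
Proof.
by move=> x0 h; rewrite mulrA ler_pdivrMr ?exprn_gt0.
Qed.

Section one_sided.
Context {R : realType} (n d : nat) (d_ge1 : (1 <= d)%N)
    (disp : measure_display) (W : measurableType disp) (P : probability W R)
    (H : nat -> set (set W)) (H_filtration : filtration n H)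
    (X : 'I_n -> W -> 'cV[R]_d)
    (X_L2 : forall i : 'I_n,
      P.-integrable setT (fun w => (lpnorm 2%:E (X i w) ^+ 2)%:E))
    (X_adapted : forall i : 'I_n,
      sub_measurable (H i.+1) (X i : W -> mxBorel R d 1))
    (X_mds : forall i : 'I_n, cond_mean P (H i) (X i) (fun=> 0))
    (Sigma : 'M[R]_d) (Sigma_psd : psd Sigma)
    (V : 'I_n -> W -> 'M[R]_d)
    (V_condvar : forall i : 'I_n, cond_var P (H i) (X i) (V i))
    (T : W -> 'cV[R]_d) (T_rv : random_vector T)
    (T_normal : mvnormal0 Sigma (law P T))
    (Zs : 'I_n -> W -> 'cV[R]_d) (Zs_rv : forall i, random_vector (Zs i))
    (Zs_normal : forall i, mvnormal0 1%:M (law P (Zs i)))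
    (Zs_indep : indep_sigma P (sigma_of Zs) (H n)).
Notation B1 := (mxBorel R d 1).
Notation Bd := (mxBorel R d d).
Notation gamma := (stdgauss d).

Let H_sigma k : (k <= n)%N -> sigma_algebra setT (H k).
Proof. by move=> kn; case: H_filtration => /(_ k kn)[]. Qed.

Let H_measurable k : (k <= n)%N -> H k `<=` measurable.
Proof. by move=> kn; case: H_filtration => /(_ k kn)[]. Qed.

Let H_nd k : (k < n)%N -> H k `<=` H k.+1.
Proof. by case: H_filtration => _; exact. Qed.

Let H_last k : (k <= n)%N -> H k `<=` H n.
Proof.
move=> kn; rewrite -(subnKC kn); move: (n - k)%N (subnKC kn) => m e.
have : (k + m <= n)%N by rewrite e.
elim: m {e} => [|m ih]; first by rewrite addn0 => _ w.
by rewrite addnS => km; apply: subset_trans (H_nd km); apply: ih; exact: ltnW.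
Qed.

(** Extension by zero to all natural indices, as the recursion on the steps is indexed by [nat]. *)
Let Xn k w : 'cV[R]_d := if insub k is Some i then X i w else 0.
Let Vn k w : 'M[R]_d := if insub k is Some i then V i w else 0.

Let XnE (i : 'I_n) : Xn i = X i. Proof. by apply/funext => w; rewrite /Xn valK. Qed.
Let VnE (i : 'I_n) : Vn i = V i. Proof. by apply/funext => w; rewrite /Vn valK. Qed.

Let mX (i : 'I_n) : measurable_fun setT (X i : g_sigma_algebraType (H i.+1) -> B1).
Proof. by apply/(sub_measurableP (X i : W -> B1) (H_sigma (ltn_ord i))). Qed.

Let mXW (i : 'I_n) : measurable_fun setT (X i : W -> B1).
Proof. exact: (measurable_fun_widen (H_measurable (ltn_ord i)) (@mX i)). Qed.

Let iXX (i : 'I_n) j k : P.-integrable setT (EFin \o (fun w => X i w j 0 * X i w k 0)).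
Proof.
have m j' : measurable_fun setT (fun w => X i w j' 0) by exact: (measurable_fun_coord j' 0 (@mXW i)).
have h : P.-integrable setT (EFin \o (fun w => dotv (X i w) (X i w))).
  by have := X_L2 i; apply: eq_integrable => // w _ /=; rewrite lpnorm2_sqr.
apply: (le_abs_integrable _ h); first exact: measurable_funM.
move=> w; set x := X i w; have sq l : x l 0 ^+ 2 <= dotv x x.
  by rewrite dotvE (bigD1 l)//= -expr2 lerDl sumr_ge0// => l' _; rewrite -expr2 sqr_ge0.
have := sq j; have := sq k; rewrite ler_norml => h1 h2; apply/andP; split; nra.
Qed.

Let iX (i : 'I_n) j : P.-integrable setT (EFin \o (fun w => X i w j 0)).
Proof. by case: (X_mds i j). Qed.

Let Hi (i : 'I_n) : (i <= n)%N. Proof. exact: ltnW. Qed.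

Let mV (i : 'I_n) : measurable_fun setT (V i : g_sigma_algebraType (H i) -> Bd).
Proof. exact: (cond_var_measurable (H_sigma (Hi i)) (V_condvar i)). Qed.

Let mVW (i : 'I_n) : measurable_fun setT (V i : W -> Bd).
Proof. exact: (measurable_fun_widen (H_measurable (Hi i)) (@mV i)). Qed.

Let V_psd : {ae P, forall w, forall i, psd (V i w)}.
Proof.
apply: ae_forall_countable => i.
exact: (cond_var_psd (H_sigma (Hi i)) (H_measurable (Hi i)) (@mXW i) (iXX i) (X_mds i) (V_condvar i)).
Qed.

Let lindeberg Sig (Sig_psd : psd Sig) (p : \bar R) (L s : R) (g : 'cV[R]_d -> R) :
  (1 <= p)%E -> 0 < L -> 0 < s -> (forall x, 0 <= g x <= 1) ->
  (forall x y, `|g x - g y| <= L * lpnorm p (x - y)) ->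
  (\sum_(k < n) cubic_moment P Xn Vn p k < +oo)%E ->
  (\int[P]_w (smix s g (remcov Vn Sig n w) (stopped_sum Xn Vn Sig n w))%:E <=
   (smix s g Sig 0)%:E + (2 * L / s ^+ 2)%:E * \sum_(k < n) cubic_moment P Xn Vn p k)%E.
Proof.
apply: (@lindeberg_bound R d disp W P n H H_measurable H_nd) => //.
- by move=> k kn; rewrite -[k]/(val (Ordinal kn)) XnE; exact: (@mX (Ordinal kn)).
- by move=> k kn; rewrite -[k]/(val (Ordinal kn)) VnE; exact: (@mV (Ordinal kn)).
- by move=> k j kn; rewrite -[k]/(val (Ordinal kn)) XnE; exact: iX.
- by move=> k j l kn; rewrite -[k]/(val (Ordinal kn)) XnE; exact: iXX.
- by move=> k j l kn; rewrite -[k]/(val (Ordinal kn)) VnE; exact: (cond_var_integrable (V_condvar _)).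
- move=> k j phi c kn; rewrite -[k]/(val (Ordinal kn)) XnE => mphi phic.
  exact: (cond_mean0_mul (H_sigma (Hi (Ordinal kn))) (H_measurable (Hi (Ordinal kn))) (X_mds _) j mphi phic).
- move=> k j l phi c kn; rewrite -[k]/(val (Ordinal kn)) XnE VnE => mphi phic.
  set i := Ordinal kn.
  have h0 := cond_var0 (H_sigma (Hi i)) (H_measurable (Hi i)) (@mXW i) (@iXX i) (X_mds i) (V_condvar i) j l.
  have h := cond_exp_mul (H_sigma (Hi i)) (H_measurable (Hi i)) h0.
  exact: (h _ _ mphi phic).
Qed.

Let law_Zs i B : measurable B -> push P (Zs_rv i) B = gamma B.
Proof.
move=> mB; apply: (@gaussv_unique R d _ _ (fun u => dotv u (1%:M *m u))) => // u.
  have := @gaussv_mvnormal0 R d 1%:M (push P (Zs_rv i)) (psd1 d) (Zs_normal i) u.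
  exact.
by rewrite mul1mx; exact: gaussf_stdgauss.
Qed.

(** [Zs i] is independent of [H n], hence of [V i], so it can be integrated out with [V i]
    frozen. *)
Let beta2E p : (1 <= p)%E -> (\sum_(k < n) cubic_moment P Xn Vn p k = beta2 P X V Zs p)%E.
Proof.
move=> p1; apply: eq_bigr => i _; rewrite /cubic_moment XnE VnE unlock.
have mc := @measurable_cubic R d p.
have mZ : measurable_fun setT (fun w => cubic p (mxsqrt (V i w) *m Zs i w)).
  apply: (measurableT_comp mc); apply: measurable_mulmx; last exact: Zs_rv.
  exact: (measurableT_comp (@measurable_mxsqrt R d) (@mVW i)).
have mXc : measurable_fun setT (fun w => cubic p (X i w)) by exact: (measurableT_comp mc (@mXW i)).
transitivity (\int[P]_w ((cubic p (X i w))%:E + (cubic p (mxsqrt (V i w) *m Zs i w))%:E))%E; last first.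
  by apply: eq_integral => w _; rewrite -EFinD /cubic -(lpnorm2_sqr (X i w)) -(lpnorm2_sqr (mxsqrt (V i w) *m Zs i w)).
rewrite [RHS]ge0_integralD//; last 4 first.
- by move=> w _; rewrite lee_fin cubic_ge0.
- exact/measurable_EFinP.
- by move=> w _; rewrite lee_fin cubic_ge0.
- exact/measurable_EFinP.
congr (_ + _)%E.
have ind (A : set Bd) (B : set B1) : measurable A -> measurable B ->
    P ((V i @^-1` A) `&` (Zs i @^-1` B)) = (P (V i @^-1` A) * P (Zs i @^-1` B))%E.
  move=> mA mB; rewrite setIC muleC; apply: Zs_indep.
    by apply: sub_gen_smallest; exists i, B.
  apply: (H_last (Hi i)).
  have := @mV i measurableT _ mA; rewrite setTI /measurable/= sigma_algebra_id//.
  exact: (H_sigma (Hi i)).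
rewrite (ge0_integral_indep (@mVW i) (Zs_rv i) ind (f := fun v z => (cubic p (mxsqrt v *m z))%:E)).
- apply: eq_integral => w _; apply: eq_measure_integral => B mB _.
  exact: (esym (law_Zs i mB)).
- apply/measurable_EFinP; apply: (measurableT_comp mc); apply: measurable_mulmx; last exact: measurable_snd.
  exact: (measurableT_comp (@measurable_mxsqrt R d) (@measurable_fst _ _ Bd B1)).
- by move=> v z; rewrite lee_fin cubic_ge0.
Qed.

Let S w := \sum_(i < n) X i w.
Let Omega w := \sum_(i < n) V i w - Sigma.

Let mS : measurable_fun setT (S : W -> B1).
Proof. by apply: measurable_summx => i; exact: @mXW. Qed.

Let mOmega : measurable_fun setT (Omega : W -> Bd).
Proof.
apply: measurable_addmx; last exact: measurable_cst.
by apply: measurable_summx => i; exact: @mVW.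
Qed.

(* x ^ 3 and m ^ 3 bound the two arguments of the cube roots in Gamma_p. Of the
   total 18 x + 16 m, the Lindeberg sum contributes 6 x, the Gaussian tail beyond
   eta / 3 of the noise left around S at most 6 x + 9 m, that of the noise added
   to T 6 x + 6 m, and Markov's inequality m. *)
Section bound.
Variables (p : \bar R) (B : set 'cV[R]_d) (eta b o x m : R).
Hypotheses (p1 : (1 <= p)%E) (mB : measurable (B : set B1)) (B0 : B !=set0) (eta0 : 0 < eta).
Hypotheses (bE : (beta2 P X V Zs p <= b%:E)%E) (oE : ('E_P[fun w => opnorm2 (Omega w)] <= o%:E)%E).
Hypotheses (x0 : 0 < x) (bx : b * (phi p d ^+ 2 / eta ^+ 3) <= x ^+ 3).
Hypotheses (m0 : 0 < m) (om : o * (phi p d ^+ 2 / eta ^+ 2) <= m ^+ 3).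

Let f := phi p d.
Let f0 : 0 < f. Proof. exact: phi_gt0. Qed.
(** With these scales the Markov bound [o / nu^2] is at most [m^3 / m^2 = m], and the Lindeberg
    bound [6 b / (eta s^2)] at most [6 x^3 / x^2 = 6 x]. *)
Let nu := m * eta / f.
Let s := x * eta / f.
Let a := eta / 3.
Let nu0 : 0 < nu. Proof. by rewrite divr_gt0// mulr_gt0. Qed.
Let s0 : 0 < s. Proof. by rewrite divr_gt0// mulr_gt0. Qed.
Let a0 : 0 < a. Proof. by rewrite divr_gt0. Qed.
Let Sig := Sigma + (nu ^+ 2)%:M.
Let Sig_psd : psd Sig. Proof. by apply: psdD => //; exact: psd_scalar (sqr_ge0 nu). Qed.
Let g := ramp p B a a.
Let F w := smix s g (remcov Vn Sig n w) (stopped_sum Xn Vn Sig n w).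

Let g01 y : 0 <= g y <= 1. Proof. by rewrite ramp_ge0 ramp_le1. Qed.
Let gL y z : `|g y - g z| <= a^-1 * lpnorm p (y - z). Proof. exact: ramp_lip. Qed.

Let F01 w : 0 <= F w <= 1. Proof. exact: (smix_bounds s p1 g01 gL). Qed.

Let mF : measurable_fun setT F.
Proof.
have h : measurable_fun setT (F : g_sigma_algebraType (H n) -> R); last first.
  exact: (measurable_fun_widen (H_measurable (leqnn n)) h).
apply: (measurable_smix_comp s p1 gL).
  apply: (measurable_remcov (n := n) H_nd) => // k kn.
  by rewrite -[k]/(val (Ordinal kn)) VnE; exact: (@mV (Ordinal kn)).
apply: (measurable_stopped_sum (n := n) H_nd) => // k kn.
  by rewrite -[k]/(val (Ordinal kn)) XnE; exact: (@mX (Ordinal kn)).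
by rewrite -[k]/(val (Ordinal kn)) VnE; exact: (@mV (Ordinal kn)).
Qed.

(** On [allpsd], two consequences of [opnorm2 (Omega w) < nu^2], expressed by conditions on matrices
    whose measurability is already known. *)
Let good : set W := [set w | psd ((nu ^+ 2)%:M - Omega w) /\
  forall j, ((nu ^+ 2)%:M - Omega w) j j <= 2 * nu ^+ 2].

Let m_good : measurable good.
Proof.
have mD : measurable_fun setT ((fun w => (nu ^+ 2)%:M - Omega w) : W -> Bd).
  by apply: measurable_addmx; [exact: measurable_cst|exact: measurable_oppmx].
have -> : good = ((fun w => (nu ^+ 2)%:M - Omega w) @^-1` [set M | psd M]) `&`
    \bigcap_(j in [set: 'I_d]) [set w | ((nu ^+ 2)%:M - Omega w) j j <= 2 * nu ^+ 2].
  apply/seteqP; split=> w [h1 h2]; split=> //; first by move=> j _; exact: h2.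
  by move=> j; exact: h2.
apply: measurableI.
  by rewrite -[X in measurable X]setTI; exact: (mD measurableT _ (@measurable_psd R d)).
apply: fin_bigcap_measurable => // j _; rewrite -[X in measurable X]setTI.
apply: (@measurable_fun_ler _ W _ _ (fun w => ((nu ^+ 2)%:M - Omega w) j j) (cst (2 * nu ^+ 2))) => //.
exact: (measurable_fun_coord j j mD).
Qed.

Let allpsd : set W := [set w | forall i, psd (V i w)].

Let m_allpsd : measurable allpsd.
Proof.
have -> : allpsd = \bigcap_(i in [set: 'I_n]) (V i @^-1` [set M | psd M]).
  by apply/seteqP; split=> w h; [move=> i _; exact: h|move=> i; exact: h].
apply: fin_bigcap_measurable => // i _; rewrite -[X in measurable X]setTI.
exact: (@mVW i measurableT _ (@measurable_psd R d)).
Qed.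

Let allpsd_negligible : P (~` allpsd) = 0%E.
Proof.
apply/negligibleP; first exact: measurableC.
by have := V_psd; rewrite /almost_everywhere /=.
Qed.

Let bad_opnorm w : allpsd w -> ~ good w -> nu ^+ 2 <= opnorm2 (Omega w).
Proof.
move=> aw ng; rewrite leNgt; apply/negP => h; apply: ng.
have q y := opnorm2_qf y (ltW h); split.
  apply/psdP; split=> [|y].
    rewrite linearB/= tr_scalar_mx; congr (_ - _).
    rewrite /Omega linearB/= linear_sum/= (proj1 Sigma_psd); congr (_ - _).
    by apply: eq_bigr => i _; exact: (proj1 (aw i)).
  rewrite mulmxBl mul_scalar_mx dotvDr dotvNr dotvZr subr_ge0.
  by rewrite (le_trans (ler_norm _))// q.
move: (Omega w) q => O q j; rewrite !mxE eqxx mulr1n.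
have := q (delta_mx j 0); rewrite !dotv_delta mulmx_delta mxE !eqxx mulr1.
rewrite ler_norml => /andP[h1 _]; lra.
Qed.

Let bad_bound : (P (allpsd `\` good) <= m%:E)%E.
Proof.
have mD : measurable (allpsd `\` good) by exact: measurableD.
have h : ((nu ^+ 2)%:E * P (allpsd `\` good) <= 'E_P[fun w => opnorm2 (Omega w)])%E.
  rewrite unlock; apply: markov_ge0 => //; first exact: sqr_ge0.
    by move=> w; rewrite lee_fin opnorm2_ge0.
  by move=> w [aw gw]; rewrite lee_fin; exact: bad_opnorm.
have {}h := le_trans h oE.
have fP : P (allpsd `\` good) \is a fin_num by exact: fin_num_measure.
rewrite -(fineK fP) lee_fin; rewrite -(fineK fP) -EFinM lee_fin in h.
have nu2 : 0 < nu ^+ 2 by rewrite exprn_gt0.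
rewrite -(ler_pM2l nu2) (le_trans h)//.
have e : nu ^+ 2 * m = m ^+ 3 * (eta ^+ 2 / f ^+ 2).
  by rewrite /nu; field; rewrite gt_eqF.
rewrite e; have k0 : 0 < eta ^+ 2 / f ^+ 2 by rewrite divr_gt0// exprn_gt0.
have om' : o * (f ^+ 2 / eta ^+ 2) * (eta ^+ 2 / f ^+ 2) <= m ^+ 3 * (eta ^+ 2 / f ^+ 2) by rewrite ler_pM2r.
rewrite (le_trans _ om')//.
rewrite le_eqVlt; apply/orP; left; apply/eqP; field.
by rewrite !gt_eqF.
Qed.

(** The remaining noise has coordinate variances at most [2 nu^2 + s^2], which is at most [t^2]
    because [9 / 4 >= 2]. *)
Let t := 3 / 2 * nu + s.
Let t0 : 0 < t. Proof. by rewrite addr_gt0// mulr_gt0. Qed.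

Let good_lower w : allpsd w -> good w -> B (S w) -> 1 - 2 * f * t / a <= F w.
Proof.
move=> aw [gp gj] Bw.
have e : Sig - \sum_(j < n) Vn j w = (nu ^+ 2)%:M - Omega w.
  rewrite /Sig /Omega (eq_bigr (fun i => V i w)) => [|i _]; last by rewrite VnE.
  by rewrite opprB addrA [Sigma + _]addrC.
have [||eQ eS] := @remcov_sum R d disp W Xn Vn Sig n w.
- by move=> j jn; rewrite -[j]/(val (Ordinal jn)) VnE; exact: aw.
- by rewrite e.
rewrite /F eQ eS e (eq_bigr (fun i => X i w)) => [|i _]; last by rewrite XnE.
apply: smix_lower => // j.
move: (gj j); move: (((nu ^+ 2)%:M - Omega w) j j) => q; rewrite /t.
have := mulr_gt0 nu0 s0; move: (sqr_ge0 nu); rewrite !expr2 => h1 h2 h3; nra.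
Qed.

Lemma one_sided_bound : (P (S @^-1` B) <= P (T @^-1` enlarge p eta B) + (18 * x + 16 * m)%:E)%E.
Proof.
have bfin : (\sum_(k < n) cubic_moment P Xn Vn p k < +oo)%E.
  by rewrite beta2E// (le_lt_trans bE)// ltry.
have ai0 : 0 < a^-1 by rewrite invr_gt0.
have := lindeberg Sig_psd p1 ai0 s0 g01 gL bfin.
rewrite beta2E// -/F => lind.
have iF : P.-integrable setT (EFin \o F).
  by apply: (bounded_integrable 1) => // w; have /andP[h0 h1] := F01 w; rewrite ger0_norm.
(* Three bands of width [eta / 3]: the ramp is 1 on the first, decreases over the second, and the
   third absorbs the isotropic noise, whose variance [nu^2 + s^2] is at most [(nu + s)^2]. *)
have up := @smix_upper R d p p1 d_ge1 B B0 s a a s0 a0 Sigma (nu ^+ 2) a (nu + s) Sigma_psd (sqr_ge0 nu) a0.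
have {}up : smix s g Sig 0 <= fine (normv Sigma (enlarge p eta B)) + 2 * f * (nu + s) / a.
  have e3 : eta = a + a + a by rewrite /a; field.
  rewrite e3; apply: up; first exact: addr_gt0.
  by have := mulr_gt0 nu0 s0; rewrite !expr2 => h; nra.
have mA : measurable (enlarge p eta B : set B1) by exact: measurable_enlarge.
have lawT : normv Sigma (enlarge p eta B) = P (T @^-1` enlarge p eta B).
  rewrite -(@gaussv_eq_normv R d Sigma (push P T_rv))//.
  exact: gaussv_mvnormal0.
pose tau := 2 * f * t / a.
have tau0 : 0 <= tau by rewrite divr_ge0 ?(ltW a0)// !mulr_ge0// ltW.
pose c := 2 * a^-1 / s ^+ 2.
have c0 : 0 <= c by rewrite divr_ge0 ?sqr_ge0// mulr_ge0// ltW.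
pose U := (S @^-1` B) `&` (allpsd `&` good).
have mSB : measurable (S @^-1` B) by rewrite -[X in measurable X]setTI; exact: mS.
have mU : measurable U by apply: measurableI => //; exact: measurableI.
have PU : fine (P U) <= \int[P]_w F w + tau.
  have -> : fine (P U) = \int[P]_w (\1_U w) by rewrite /Rintegral integral_indic// setIT.
  have ic : P.-integrable setT (EFin \o (fun=> tau) : W -> \bar R) by exact: finite_measure_integrable_cst.
  rewrite -[X in _ <= _ + X](Rintegral_cstP P) -(RintegralD measurableT iF ic).
  apply: ler_Rintegral.
  - apply: (bounded_integrable 1); first exact: measurable_indic.
    exact: indic_le1.
  - by apply: eq_integrable (integrableD measurableT iF ic).
  - move=> w; rewrite indicE; case: (boolP (w \in U)) => [/set_mem[Bw [aw gw]]|_].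
      by have := good_lower aw gw Bw; rewrite -/tau lerBlDr.
    by have /andP[h0 _] := F01 w; rewrite addr_ge0.
have IF : \int[P]_w F w <= smix s g Sig 0 + c * b.
  rewrite -lee_fin -(EFin_Rintegral iF) EFinD EFinM (le_trans lind)// leeD2l//.
  by rewrite lee_wpmul2l// lee_fin.
have split : (P (S @^-1` B) <= P U + P (allpsd `\` good) + P (~` allpsd))%E.
  have mD : measurable (allpsd `\` good) by exact: measurableD.
  have mC : measurable (~` allpsd) by exact: measurableC.
  apply: (@le_trans _ _ (P ((U `|` (allpsd `\` good)) `|` ~` allpsd))).
    apply: le_measure; rewrite ?inE//.
      by apply: measurableU => //; exact: measurableU.
    move=> w Bw; have [aw|aw] := pselect (allpsd w); last by right.
    by left; have [gw|gw] := pselect (good w); [left|right].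
  apply: (le_trans (measureU2 _ _ _)) => //; first exact: measurableU.
  by rewrite leeD2r// measureU2.
apply: (le_trans split); rewrite allpsd_negligible adde0.
have fU : P U \is a fin_num by exact: fin_num_measure.
have fT : P (T @^-1` enlarge p eta B) \is a fin_num by rewrite -lawT; exact: fin_num_measure.
rewrite -(fineK fU) -(fineK fT) -EFinD.
apply: (@le_trans _ _ ((fine (P U))%:E + m%:E)%E); first exact: leeD2l bad_bound.
rewrite -EFinD lee_fin -lawT.
have cb : c * b <= 6 * x.
  have := cube_bound x0 bx; set v := b * (_ / _) => h.
  have -> : c * b = 6 * v.
    by rewrite /v /c /s /a -/f; field; rewrite !gt_eqF.
  by rewrite ler_pM2l.
have e1 : tau = 9 * m + 6 * x.
  by rewrite /tau /t /nu /s /a; field; rewrite !gt_eqF.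
have e2 : 2 * f * (nu + s) / a = 6 * m + 6 * x.
  by rewrite /nu /s /a; field; rewrite !gt_eqF.
rewrite e2 in up; rewrite e1 in PU; move: up PU IF cb.
set A1 := fine (normv _ _); set A2 := fine (P U); set A3 := smix _ _ _ _; set A4 := \int[P]_w _.
set A5 := c * b; move=> *; lra.
Qed.

End bound.

End one_sided.

(** * Coupling of Gaussian laws *)

Section gaussian_coupling.
Context {R : realType} {d : nat} (d_gt0 : (0 < d)%N).
Notation B1 := (mxBorel R d 1).
Notation gamma := (stdgauss d).

Lemma opnorm2_eq0 (M : 'M[R]_d) : opnorm2 M = 0 -> M = 0.
Proof.
move=> M0; apply/matrixP => i j; have := opnorm2_sqrP M (delta_mx j 0).
rewrite M0 expr0n/= mul0r => h.
have e : M *m delta_mx j 0 = 0 :> 'cV[R]_d.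
  apply: gram_eq0; apply/matrixP => k l; rewrite !ord1 [RHS]mxE.
  by apply/eqP; rewrite eq_le h; exact: dotv_ge0.
by rewrite -mulmx_delta e !mxE.
Qed.

(** A p-norm above [eta] forces some coordinate of [D y] above [eta / d^(1/p)]. The j-th coordinate
    has variance equal to the squared norm of [D e_j], at most the squared operator norm. *)
Lemma gaussian_displacement p (eta : R) (M N : 'M[R]_d) : (1 <= p)%E -> 0 < eta -> psd M -> psd N ->
  (gamma [set y : 'cV[R]_d | (eta < lpnorm p (mxsqrt M *m y - mxsqrt N *m y))%R] <=
    (2 * d%:R * exp_term M N p eta)%:E)%E.
Proof.
move=> p1 eta0 pM pN; rewrite /exp_term; case: eqP => [->|MN].
  rewrite (_ : [set y | _] = set0) ?measure0 ?mulr0//.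
  by apply/seteqP; split=> y //=; rewrite subrr lpnorm0// ltNge (ltW eta0).
set D := mxsqrt M - mxsqrt N; set s := opnorm2 D.
have DT : D^T = D.
  by rewrite /D linearB/= (proj1 (proj1 (mxsqrtP pM))) (proj1 (proj1 (mxsqrtP pN))).
have s0 : 0 < s.
  rewrite lt_neqAle opnorm2_ge0 andbT eq_sym; apply/eqP => /opnorm2_eq0/eqP.
  by rewrite subr_eq0 => /eqP.
have k0 : 0 < dimpow p d :> R.
  by case/lp_exponentP : p1 => [[r r1 ->]|->] //=; rewrite powR_gt0// ltr0n.
have sk0 : 0 < Num.sqrt (dimpow p d : R) by rewrite sqrtr_gt0.
pose a := eta / Num.sqrt (dimpow p d).
have a0 : 0 <= a by rewrite divr_ge0 ?(ltW eta0) ?(ltW sk0).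
have sg : subgauss (push gamma (measurable_mulv D)) s.
  apply: (subgauss_gaussv (gaussv_mulv D)) => j.
  have := opnorm2_sqrP D (delta_mx j 0).
  have e1 : dotv (delta_mx j 0 : 'cV[R]_d) (delta_mx j 0) = 1 by rewrite dotv_delta mxE !eqxx.
  by rewrite e1 mulr1 dotv_mulmx DT dotvC dotv_delta mulmxA mulmx_delta.
have := subgauss_tail_max sg s0 a0; rewrite /= /push => h.
have -> : - eta ^+ 2 / (2 * dimpow p d * s ^+ 2) = - a ^+ 2 / (2 * s ^+ 2).
  rewrite /a expr_div_n sqr_sqrtr ?(ltW k0)//; field.
  by rewrite !gt_eqF.
apply: le_trans h; apply: le_measure; rewrite ?inE.
- rewrite (_ : [set y | _] = (fun y => D *m y) @^-1` [set v | eta < lpnorm p v]); last first.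
    by apply/seteqP; split=> y /=; rewrite /D mulmxBl.
  by rewrite -[X in measurable X]setTI; exact: (measurable_mulv D measurableT (measurable_lpnorm_gt p eta)).
- rewrite -[X in measurable X]setTI.
  exact: (measurable_mulv D measurableT (measurable_some_coord_gt a)).
- move=> y /=; rewrite -mulmxBl -/D => ey; apply: contrapT => ny.
  move: ey; rewrite ltNge => /negP; apply.
  have -> : eta = Num.sqrt (dimpow p d) * a by rewrite /a mulrC divfK// gt_eqF.
  apply: lpnorm_le_max => // i; rewrite leNgt; apply/negP => h; apply: ny; by exists i.
Qed.

Lemma gaussian_coupling p (eta : R) (M N : 'M[R]_d) (E F : set B1) (t : \bar R) : psd M -> psd N ->
  measurable E -> measurable F ->
  (gamma [set y : 'cV[R]_d | (eta < lpnorm p (mxsqrt M *m y - mxsqrt N *m y))%R] <= t)%E ->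
  (forall x y : 'cV[R]_d, lpnorm p (x - y) <= eta -> E x -> F y) ->
  (normv M E <= normv N F + t)%E.
Proof.
move=> pM pN mE mF tail EF; rewrite /normv /= /push.
pose G := [set y : 'cV[R]_d | (eta < lpnorm p (mxsqrt M *m y - mxsqrt N *m y))%R] : set B1.
have mG : measurable G.
  rewrite (_ : G = (fun y => (mxsqrt M - mxsqrt N) *m y) @^-1` [set v | eta < lpnorm p v]); last first.
    by apply/seteqP; split=> y /=; rewrite /G/= mulmxBl.
  by rewrite -[X in measurable X]setTI; exact: (measurable_mulv _ measurableT (measurable_lpnorm_gt p eta)).
have mpre (B : 'M[R]_d) (A : set B1) : measurable A -> measurable ((fun y => B *m y) @^-1` A : set B1).
  by move=> mA; rewrite -[X in measurable X]setTI; exact: (measurable_mulv _ measurableT mA).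
apply: (@le_trans _ _ (gamma (((fun y => mxsqrt N *m y) @^-1` F) `|` G))).
  apply: le_measure; rewrite ?inE; [exact: mpre|apply: measurableU => //; exact: mpre|].
  move=> y Ey; have [h|h] := leP (lpnorm p (mxsqrt M *m y - mxsqrt N *m y)) eta; last by right.
  by left; apply: EF Ey.
apply: (le_trans (measureU2 _ _ _)) => //; first exact: mpre.
exact: leeD2l.
Qed.

End gaussian_coupling.

(** * Combination of the one-sided bounds with the coupling *)

Theorem propositionA2 (R : realType) (n d : nat) (n_ge1 : (1 <= n)%N)
    (d_ge1 : (1 <= d)%N)
    (disp : measure_display) (W : measurableType disp) (P : probability W R)
    (P_complete : measure_is_complete P)
    (H : nat -> set (set W)) (H_filtration : filtration n H)
    (H_cg : forall k, (k <= n)%N -> countably_generated (H k))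
    (* X i, V i and Z i, for i : 'I_n, are X_(i+1), V_(i+1) and Z_(i+1) *)
    (X : 'I_n -> W -> 'cV[R]_d)
    (X_L2 : forall i : 'I_n,
      P.-integrable setT (fun w => (lpnorm 2%:E (X i w) ^+ 2)%:E))
    (X_adapted : forall i : 'I_n,
      sub_measurable (H i.+1) (X i : W -> mxBorel R d 1))
    (X_mds : forall i : 'I_n, cond_mean P (H i) (X i) (fun=> 0))
    (Sigma : 'M[R]_d) (Sigma_psd : psd Sigma)
    (V : 'I_n -> W -> 'M[R]_d)
    (V_condvar : forall i : 'I_n, cond_var P (H i) (X i) (V i))
    (T : W -> 'cV[R]_d) (T_rv : random_vector T)
    (T_normal : mvnormal0 Sigma (law P T))
    (Zs : 'I_n -> W -> 'cV[R]_d) (Zs_rv : forall i, random_vector (Zs i))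
    (Zs_normal : forall i, mvnormal0 1%:M (law P (Zs i)))
    (Zs_iid : mutually_indep P Zs)
    (Zs_indep : indep_sigma P (sigma_of Zs) (H n))
    (Shat : W -> 'M[R]_d) (Shat_psd : forall w, psd (Shat w))
    (Shat_meas : sub_measurable (sigma_of X) (Shat : W -> mxBorel R d d))
    (Z : W -> 'cV[R]_d) (Z_rv : random_vector Z)
    (Z_normal : mvnormal0 1%:M (law P Z))
    (Z_indep : indep_sigma P (sigma_of (fun _ : 'I_1 => Z)) (sigma_of X))
    (K : W -> probability (mxBorel R d 1) R)
    (K_cond : regular_cond_law P (sigma_of X)
      (fun w => mxsqrt (Shat w) *m Z w) K)
    (K_normal : forall w, mvnormal0 (Shat w) (K w))
    (C : set (set 'cV[R]_d))
    (C_meas : C `<=` (@measurable _ (mxBorel R d 1))) (w : W) :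
  let S w' := \sum_(i < n) X i w' in
  let Omega w' := \sum_(i < n) V i w' - Sigma in
  (sup_nneg [set `|P (S @^-1` A) - K w A| | A in C]
   <= ereal_inf [set
        ereal_inf [set
          Gamma P X V Zs Omega p eta + 2%:E * Delta P T p C eta
          + (2 * d%:R * exp_term (Shat w) Sigma p eta)%:E
        | eta in [set eta : R | (0 < eta)%R]]
      | p in [set p : \bar R | 1 <= p]])%E.
Proof.
cbv zeta; pose S w' := \sum_(i < n) X i w'; pose Omega w' := \sum_(i < n) V i w' - Sigma.
have mX i : measurable_fun setT (X i : W -> mxBorel R d 1).
  case: H_filtration => hH _; have [hs hm] := hH _ (ltn_ord i).
  exact: (measurable_fun_widen hm ((sub_measurableP (X i : W -> mxBorel R d 1) hs).1 (X_adapted i))).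
have mS : measurable_fun setT (S : W -> mxBorel R d 1) by exact: measurable_summx.
have oneside := one_sided_bound d_ge1 H_filtration X_L2 X_adapted X_mds Sigma_psd V_condvar
  T_rv T_normal Zs_rv Zs_normal Zs_indep.
apply: le_ereal_inf_tmp => _ [p p1 <-]; apply: le_ereal_inf_tmp => _ [eta eta0 <-].
rewrite /= in p1 eta0.
set D := Delta P T p C eta.
pose tau := 2 * d%:R * exp_term (Shat w) Sigma p eta.
have tau0 : 0 <= tau.
  by rewrite !mulr_ge0// /exp_term; case: ifP => // _; exact: expR_ge0.
have D0 : (0 <= D)%E by apply: ereal_sup_ubound; left.
have beta0 : (0 <= beta2 P X V Zs p)%E.
  apply: sume_ge0 => i _; rewrite unlock; apply: integral_ge0 => w' _.
  by rewrite lee_fin addr_ge0// mulr_ge0 ?sqr_ge0// lpnorm_ge0.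
have om0 : (0 <= 'E_P[fun w' => opnorm2 (Omega w')])%E.
  by rewrite unlock; apply: integral_ge0 => w' _; rewrite lee_fin opnorm2_ge0.
have f0 := phi_gt0 d_ge1 p1 : 0 < phi p d :> R.
have k1 : 0 < phi p d ^+ 2 / eta ^+ 3 by rewrite divr_gt0// exprn_gt0.
have k2 : 0 < phi p d ^+ 2 / eta ^+ 2 by rewrite divr_gt0// exprn_gt0.
have third0 : (3^-1 : R) != 0 by rewrite invr_eq0.
have G0 : (0 <= Gamma P X V Zs Omega p eta)%E.
  by apply: adde_ge0; apply: mule_ge0 => //; exact: poweR_ge0.
have rest0 : (0 <= 2%:E * D + tau%:E)%E by apply: adde_ge0 => //; exact: mule_ge0.
(* An infinite [Gamma] leaves nothing to prove. When it is finite, so are [beta2] and the mean norm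
   of [Omega], since their coefficients are positive, and the computation moves to the reals. *)
rewrite -addeA; have [Goo|Gfin] := eqVneq (Gamma P X V Zs Omega p eta) +oo%E.
  rewrite -/D -/tau Goo addye ?leey//.
  by rewrite gt_eqF// (lt_le_trans (ltNyr 0)).
apply: ge_ereal_sup => _ [->|[A CA <-]]; first exact: adde_ge0.
have bfin : beta2 P X V Zs p \is a fin_num.
  rewrite ge0_fin_numE// ltey; apply/eqP => boo; move/eqP: Gfin; apply.
  rewrite /Gamma boo gt0_mulye// poweRyr// gt0_muley// addye//.
  rewrite gt_eqF// (lt_le_trans (ltNyr 0))// mule_ge0//; exact: poweR_ge0.
have ofin : ('E_P[fun w' => opnorm2 (Omega w')])%E \is a fin_num.
  rewrite ge0_fin_numE// ltey; apply/eqP => boo; move/eqP: Gfin; apply.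
  rewrite /Gamma boo gt0_mulye// poweRyr// gt0_muley// addey//.
  rewrite gt_eqF// (lt_le_trans (ltNyr 0))// mule_ge0//; exact: poweR_ge0.
set b := fine (beta2 P X V Zs p); set o := fine ('E_P[fun w' => opnorm2 (Omega w')])%E.
have b0 : 0 <= b by exact: fine_ge0.
have o0 : 0 <= o by exact: fine_ge0.
pose u : R := (b * (phi p d ^+ 2 / eta ^+ 3)) `^ 3^-1.
pose v : R := (o * (phi p d ^+ 2 / eta ^+ 2)) `^ 3^-1.
have GE : Gamma P X V Zs Omega p eta = (24 * u + 17 * v)%:E.
  by rewrite /Gamma -(fineK bfin) -(fineK ofin).
have cube (t : R) : 0 <= t -> (t `^ 3^-1) ^+ 3 = t.
  by move=> t0; rewrite -powR_mulrn ?powR_ge0// -powRrM mulVf// powRr1.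
have u0 : 0 <= u by exact: powR_ge0.
have v0 : 0 <= v by exact: powR_ge0.
have ucube e : 0 < e -> b * (phi p d ^+ 2 / eta ^+ 3) <= (u + e) ^+ 3.
  move=> e0; rewrite -[leLHS](cube _ (mulr_ge0 b0 (ltW k1))) -/u.
  by apply: lerXn2r; rewrite ?nnegrE ?lerDl ?(ltW e0)// addr_ge0// ltW.
have vcube e : 0 < e -> o * (phi p d ^+ 2 / eta ^+ 2) <= (v + e) ^+ 3.
  move=> e0; rewrite -[leLHS](cube _ (mulr_ge0 o0 (ltW k2))) -/v.
  by apply: lerXn2r; rewrite ?nnegrE ?lerDl ?(ltW e0)// addr_ge0// ltW.
have mA : measurable (A : set (mxBorel R d 1)) by exact: C_meas.
have mCA : measurable (~` A : set (mxBorel R d 1)) by exact: measurableC.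
have mpT (B : set (mxBorel R d 1)) : measurable B -> measurable (T @^-1` B).
  by move=> mB; rewrite -[X in measurable X]setTI; exact: T_rv.
have mpS (B : set (mxBorel R d 1)) : measurable B -> measurable (S @^-1` B).
  by move=> mB; rewrite -[X in measurable X]setTI; exact: mS.
have fP (B : set W) : measurable B -> P B \is a fin_num by move=> mB; exact: fin_num_measure.
(* The one-sided bound asks for positive majorants, whereas [u] or [v] may be 0; [e] is removed at
   the end. It also asks for a nonempty set, so the empty one is treated directly. *)
have side (B : set 'cV[R]_d) e : measurable (B : set (mxBorel R d 1)) -> 0 < e ->
    fine (P (S @^-1` B)) <= fine (P (T @^-1` enlarge p eta B)) + (18 * (u + e) + 16 * (v + e)).
  move=> mB e0; have ue : 0 < u + e by rewrite ltr_wpDl.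
  have ve : 0 < v + e by rewrite ltr_wpDl.
  have [->|/set0P B0] := eqVneq B set0.
    rewrite preimage_set0 measure0/= addr_ge0//; first exact: fine_ge0.
    by rewrite addr_ge0// mulr_ge0// ltW.
  rewrite -lee_fin EFinD !fineK//; last 2 first.
  - by apply/fP/mpT; exact: measurable_enlarge.
  - exact/fP/mpS.
  apply: (oneside p B eta b o (u + e) (v + e)) => //.
  - by rewrite fineK.
  - by rewrite fineK.
  - exact: ucube.
  - exact: vcube.
have lawT (B : set (mxBorel R d 1)) : measurable B -> normv Sigma B = P (T @^-1` B).
  have gT : gaussv Sigma (push P T_rv) by exact: (@gaussv_mvnormal0 R d Sigma (push P T_rv) Sigma_psd T_normal).
  by move=> mB; rewrite -(gaussv_eq_normv Sigma_psd gT mB).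
have lawK : K w A = normv (Shat w) A.
  exact: (gaussv_eq_normv (Shat_psd w) (gaussv_mvnormal0 (Shat_psd w) (K_normal w)) mA).
have mE : measurable (enlarge p eta A : set (mxBorel R d 1)) by exact: measurable_enlarge.
have mEC : measurable (enlarge p eta (~` A) : set (mxBorel R d 1)) by exact: measurable_enlarge.
have mSh : measurable (shrink p eta A : set (mxBorel R d 1)) by exact: measurableC.
have near_enlarge (B : set 'cV[R]_d) x y : lpnorm p (x - y) <= eta -> B x -> enlarge p eta B y.
  move=> xy Bx; rewrite enlargeE; [|by exists x].
  by rewrite /= (le_trans (rdist_le p _ y Bx))// 1?lpnorm_distrC//; exists x.
have tail1 := gaussian_displacement d_ge1 p1 eta0 (Shat_psd w) Sigma_psd.
have c1 : fine (K w A) <= fine (P (T @^-1` enlarge p eta A)) + tau.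
  have h := gaussian_coupling (Shat_psd w) Sigma_psd mA mE tail1 (near_enlarge A).
  rewrite -lee_fin EFinD !fineK ?lawK -?lawT//; exact: fin_num_measure.
(* A point within [eta] of the shrunk set lies in [A]: otherwise the point of the shrunk set would
   be in the enlargement of the complement. *)
have c2 : fine (P (T @^-1` shrink p eta A)) <= fine (K w A) + tau.
  have tail2 : (stdgauss d [set y : 'cV[R]_d | (eta < lpnorm p (mxsqrt Sigma *m y - mxsqrt (Shat w) *m y))%R] <= tau%:E)%E.
    rewrite (_ : [set y | _] = [set y : 'cV[R]_d | (eta < lpnorm p (mxsqrt (Shat w) *m y - mxsqrt Sigma *m y))%R])//.
    by apply/seteqP; split=> y /=; rewrite lpnorm_distrC.
  have h := gaussian_coupling Sigma_psd (Shat_psd w) mSh mA tail2.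
  rewrite -lee_fin EFinD !fineK ?lawK -?lawT//; [|exact: fin_num_measure..].
  apply: h => x y xy sx; apply: contrapT => nAy; apply: sx.
  by apply: near_enlarge nAy; rewrite lpnorm_distrC.
(* Each direction passes from the enlargement of [A] to its shrunk set and so pays for both
   differences, each at most [D]; hence the factor 2. *)
have dlt : (P (T @^-1` (enlarge p eta A `\` A)) + P (T @^-1` (A `\` shrink p eta A)) <= 2%:E * D)%E.
  have hD : (maxe (P (T @^-1` (enlarge p eta A `\` A))) (P (T @^-1` (A `\` shrink p eta A))) <= D)%E.
    by apply: ereal_sup_ubound; right; exists A.
  move: hD; rewrite ge_max => /andP[h1 h2].
  by rewrite mule_natl mule2n leeD.
have fsub (B1 B2 B3 : set W) : measurable B1 -> measurable B2 -> measurable B3 ->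
    B1 `<=` B2 `|` B3 -> fine (P B1) <= fine (P B2) + fine (P B3).
  move=> m1 m2 m3 s123; rewrite -lee_fin EFinD !fineK; [|exact: fP..].
  apply: le_trans (measureU2 P m2 m3); apply: le_measure; rewrite ?inE//.
  exact: measurableU.
have t1 : fine (P (T @^-1` enlarge p eta A)) <= fine (P (T @^-1` A)) + fine (P (T @^-1` (enlarge p eta A `\` A))).
  apply: fsub; [exact: mpT|exact: mpT|exact/mpT/measurableD|].
  by move=> w' Tw; have [?|?] := pselect (A (T w')); [left|right].
have t2 : fine (P (T @^-1` A)) <= fine (P (T @^-1` shrink p eta A)) + fine (P (T @^-1` (A `\` shrink p eta A))).
  apply: fsub; [exact: mpT|exact: mpT|exact/mpT/measurableD|].
  by move=> w' Tw; have [?|?] := pselect (shrink p eta A (T w')); [left|right].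
have PC (B : set W) : measurable B -> fine (P (~` B)) = 1 - fine (P B).
  move=> mB; rewrite probability_setC// fineB//; exact: fP.
have fK : K w A \is a fin_num by rewrite lawK; exact: fin_num_measure.
have fS : P (S @^-1` A) \is a fin_num by exact/fP/mpS.
rewrite GE -(fineK fS) -(fineK fK) -EFinB /=.
apply: (@le_trans _ _ ((24 * u + 17 * v + (fine (P (T @^-1` (enlarge p eta A `\` A))) + fine (P (T @^-1` (A `\` shrink p eta A))) + tau))%:E)); last first.
  rewrite EFinD leeD2l// EFinD leeD2r// EFinD !fineK//.
  - exact/fP/mpT/measurableD.
  - exact/fP/mpT/measurableD.
rewrite lee_fin; apply/ler_addgt0Pr => e e0.
(* The one-sided bound has coefficients 18 and 16, with sum 34, so the perturbations add up to [e];
   its main terms are within [24 u + 17 v]. *)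
have e1 : 0 < e / 34 by rewrite divr_gt0.
have s1 := side A _ mA e1.
have s2 := side (~` A) _ mCA e1.
have e2 : fine (P (S @^-1` (~` A))) = 1 - fine (P (S @^-1` A)) by exact: (PC _ (mpS _ mA)).
have e3 : fine (P (T @^-1` shrink p eta A)) = 1 - fine (P (T @^-1` enlarge p eta (~` A))).
  exact: (PC _ (mpT _ mEC)).
rewrite e2 in s2; rewrite e3 in c2 t2.
move: s1 s2 c1 c2 t1 t2.
set a1 := fine (P (S @^-1` A)); set a2 := fine (P (T @^-1` enlarge p eta A)).
set a3 := fine (P (T @^-1` enlarge p eta (~` A))); set a4 := fine (K w A).
set a5 := fine (P (T @^-1` A)); set a6 := fine _; set a7 := fine _.
move=> h1 h2 h3 h4 h5 h6; rewrite ler_norml; apply/andP; split; lra.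
Qed.
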